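(* Let $\mathcal{D}\subset\mathbb{R}^N$ be an open, bounded domain satisfying the external cone condition. For a given bounded, uniformly continuous $F:\mathbb{R}^N\to\mathbb{R}$ and $\epsilon>0$, let $u_\epsilon:\mathbb{R}^N\to\mathbb{R}$ be the unique bounded Borel solution of $$u_\epsilon=\mathcal{A}_\epsilon u_\epsilon\ \text{ in }\mathcal{D},\qquad u_\epsilon=F\ \text{ in }\mathbb{R}^N\setminus\mathcal{D}.$$ Then every sequence $\{u_\epsilon\}_{\epsilon\in J,\ \epsilon\to0}$ (with $J\subset(0,\infty)$ a sequence converging to $0$) has a further subsequence that converges uniformly in $\mathbb{R}^N$, as $\epsilon\to0$, to a viscosity solution of $$\Delta_{\mathbf p}^su=0\ \text{ in }\mathcal{D},\qquad u=F\ \text{ in }\mathbb{R}^N\setminus\mathcal{D}.$$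
   Context: Fix an integer $N\ge 2$, $\mathbf p\in[2,\infty)$ and $s\in(\frac12,1)$. $B_r(x)$ is the open ball, $e_1,e_2,\dots$ the standard basis of $\mathbb{R}^N$, $\angle(y,z)$ the angle between vectors. $\mathrm{d}\mu_s^N(z)=\frac{C(N,s)}{|z|^{N+2s}}\,\mathrm{d}z$ with $C(N,s)=\frac{4^s s\,\Gamma(\frac N2+s)}{\pi^{N/2}\Gamma(1-s)}$. Let $\alpha_{\mathbf p}\in(0,\frac\pi2]$ be the angle such that, with $A_{\mathbf p}=\{|z|=1:\ \angle(e_1,z)<\alpha_{\mathbf p}\}$ and $\sigma$ the surface measure on the unit sphere, $\mathbf p-1=\int_{A_{\mathbf p}}\langle z,e_1\rangle^2\,\mathrm{d}\sigma(z)\big/\int_{A_{\mathbf p}}\langle z,e_2\rangle^2\,\mathrm{d}\sigma(z)$; $|A_{\mathbf p}|=\sigma(A_{\mathbf p})$. For $0\le a\le b\le\infty$ and $|y|=1$ let $T_{\mathbf p}^{a,b}(y)=\{z\in\mathbb{R}^N:\ \angle(y,z)<\alpha_{\mathbf p},\ a<|z|<b\}$. For bounded Borel $u$ and $\epsilon>0$ define $$\mathcal{A}_\epsilon u(x)=\frac12\Big(\sup_{|y|=1}⨍_{T_{\mathbf p}^{\epsilon,\infty}(y)}u(x+z)\,\mathrm{d}\mu_s^N(z)+\inf_{|y|=1}⨍_{T_{\mathbf p}^{\epsilon,\infty}(y)}u(x+z)\,\mathrm{d}\mu_s^N(z)\Big),$$ where $⨍_T f\,\mathrm{d}\mu_s^N=\frac{1}{\mu_s^N(T)}\int_T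 f\,\mathrm{d}\mu_s^N$. For a bounded Borel $v$ that is $C^2$ near $x$ with $p_x=\nabla v(x)\ne0$ define $$\mathcal{L}_{s,\mathbf p}[v](x)=\int_{T_{\mathbf p}^{0,\infty}(p_x/|p_x|)}\big(v(x+z)+v(x-z)-2v(x)\big)\,\mathrm{d}\mu_s^N(z),\qquad \Delta_{\mathbf p}^sv(x)=\frac{2-2s}{C(N,s)}\cdot\frac{N+\mathbf p-2}{|A_{\mathbf p}|}\mathcal{L}_{s,\mathbf p}[v](x).$$ External cone condition: there exists a finite cone $C$ (a truncated circular cone with vertex at $0$, positive aperture and positive height) such that for each $x\in\partial\mathcal{D}$ there is a rotation $S_x\in SO(N)$ with $x+S_xC\subset\mathbb{R}^N\setminus\mathcal{D}$. Viscosity solution: a bounded continuous $u:\mathbb{R}^N\to\mathbb{R}$ with $u=F$ in $\mathbb{R}^N\setminus\mathcal{D}$ is a viscosity solution of $\Delta_{\mathbf p}^su=0$ in $\mathcal{D}$, $u=F$ in $\mathbb{R}^N\setminus\mathcal{D}$, if for every $x\in\mathcal{D}$, $r>0$ and every $\phi\in C^2(\mathbb{R}^N)$ with $\phi(x)=u(x)$ and $\nabla\phi(x)\ne0$, setting $\tilde\phi=\mathbf 1_{\bar B_r(x)}\phi+\mathbf 1_{\mathbb{R}^N\setminus\bar B_r(x)}u$: (i) if $\phi>u$ on $\bar B_r(x)\setminus\{x\}$ then $\mathcal{L}_{s,\mathbf p}[\tilde\phi](x)\ge0$; (ii) if $\phi<u$ on $\bar B_r(x)\setminus\{x\}$ then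 $\mathcal{L}_{s,\mathbf p}[\tilde\phi](x)\le0$. *)

(* Defs.v *)
From HB Require Import structures.
From mathcomp Require Import all_boot all_order all_algebra.
From mathcomp Require Import all_classical all_reals all_analysis.
From mathcomp Require Import measurable_realfun.

Set Implicit Arguments.
Unset Strict Implicit.
Unset Printing Implicit Defensive.

Import Order.TTheory GRing.Theory Num.Theory.
Import numFieldNormedType.Exports.
Local Open Scope classical_set_scope.
Local Open Scope ring_scope.

(* Row vectors carry the Borel sigma-algebra. *)
HB.instance Definition _ (R : realType) (n : nat) :=
  @isMeasurable.Build (sigma_display (@open 'rV[R]_n)) 'rV[R]_n
    <<s @open 'rV[R]_n >> (@sigma_algebra0 _ setT _) (@sigma_algebraC _ _)
    (@sigma_algebra_bigcup _ setT _).

(* n-dimensional Lebesgue measure, as the iterated product of the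
   one-dimensional one (the body below unfolds [product_measure1]); it is shown
   to be a sigma-finite Borel measure. *)
Fixpoint lebesgue_rV (R : realType) (n : nat) : set 'rV[R]_n -> \bar R :=
  match n with
  | 0 => dirac (0 : 'rV[R]_0)
  | n'.+1 => fun A => (\int[lebesgue_measure]_a
      lebesgue_rV [set v : 'rV[R]_n' | A (row_mx a%:M v)])%E
  end.
Arguments lebesgue_rV R n _ : clear implicits.

Lemma continuous_measurable_rV (R : realType) n (f : 'rV[R]_n -> R) :
  continuous f -> measurable_fun setT f.
Proof.
move=> /continuousP cf; apply: (measurability _ (RGenOInfty.measurableE R)).
move=> _ [_ [x ->] <-]; rewrite setTI; apply: sub_sigma_algebra.
by apply: cf; exact: interval_open.
Qed.

Lemma measurable_fun_rV (R : realType) n d (T : measurableType d)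
    (f : T -> 'rV[R]_n) :
  (forall i, measurable_fun setT (fun x => f x 0 i)) -> measurable_fun setT f.
Proof.
move=> mf; apply: (@measurability _ _ _ _ _ _ (@open 'rV[R]_n)) => //.
move=> _ [U oU <-]; rewrite setTI.
pose box (q : 'rV[rat]_n * nat) :=
  [set y : 'rV[R]_n | forall i, `|y 0 i - ratr (q.1 0 i)| < q.2.+1%:R^-1].
pose G q := if pselect (box q `<=` U) then box q else set0.
have -> : U = \bigcup_q G q.
  apply/seteqP; split => [x Ux|x [q _]]; last first.
    by rewrite /G; case: pselect => [bU|//] /= bx; exact: bU.
  have /nbhs_ballP[e /= e0 xeU] : nbhs x U by exact: open_nbhs_nbhs.
  have [k ke] : exists k, k.+1%:R^-1 < e / 2.
    have /ltr_add_invr[k] : 0 < e / 2 by rewrite divr_gt0.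
    by rewrite add0r; exists k.
  have k0 : 0 < k.+1%:R^-1 :> R by rewrite invr_gt0.
  have /choice[q hq] : forall i, exists q : rat,
      `|x 0 i - ratr q| < k.+1%:R^-1.
    move=> i; have /rat_in_itvoo[q] : x 0 i - k.+1%:R^-1 < x 0 i + k.+1%:R^-1.
      by rewrite ltrD2l gt0_cp.
    by rewrite in_itv/= -ltr_distl distrC; exists q.
  have bx : box (\row_i q i, k) x by move=> i; rewrite /= mxE.
  exists (\row_i q i, k) => //; rewrite /G; case: pselect => [_ //|[]].
  move=> y by_; apply: xeU; split => // i j; rewrite (ord1 i) /ball/=.
  rewrite -(subrKA (ratr (q j))) (le_lt_trans (ler_normD _ _))// (splitr e).
  apply: ltrD; first exact: lt_trans (hq j) ke.
  rewrite distrC; apply: lt_trans ke; have := by_ j; by rewrite /= mxE.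
rewrite preimage_bigcup; apply: countable_bigcupT_measurable => [|q].
  exact: countableP.
rewrite /G; case: pselect => /= [_|_]; last by rewrite preimage_set0.
have -> : f @^-1` box q = \bigcap_i
    ((fun x => f x 0 i) @^-1` (ball (ratr (q.1 0 i) : R) q.2.+1%:R^-1 : set R)).
  apply/seteqP; split => x /= bx i; have := bx i.
    by move=> bxi _; rewrite /ball/= distrC.
  by move=> /(_ I); rewrite /ball/= distrC.
rewrite -[X in measurable X]setCK setC_bigcap; apply: measurableC.
apply: countable_bigcupT_measurable => [|i]; first exact: countableP.
apply: measurableC.
rewrite -[X in measurable X]setTI.
by apply: mf => //; exact: measurable_ball.
Qed.

Lemma measurable_coord_rV (R : realType) n (i : 'I_n) :
  measurable_fun setT (fun v : 'rV[R]_n => v 0 i).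
Proof. by apply: continuous_measurable_rV => v; exact: coord_continuous. Qed.

Section sigma_finite_measure_of.
Context d (T : measurableType d) (R : realType) (m : {measure set T -> \bar R}).

Definition sigma_finite_measure_of (sf : sigma_finite setT m)
  : set T -> \bar R := m.

Variable sf : sigma_finite setT m.
HB.instance Definition _ := Measure.on (sigma_finite_measure_of sf).
HB.instance Definition _ :=
  Measure_isSigmaFinite.Build _ _ _ (sigma_finite_measure_of sf) sf.

End sigma_finite_measure_of.

Lemma lebesgue_rV_sigma_finite_measure (R : realType) n :
  exists mu : {sigma_finite_measure set 'rV[R]_n -> \bar R},
    lebesgue_rV R n = mu.
Proof.
elim: n => [|n [mu IH]].
  by exists (dirac (0 : 'rV[R]_0)).
pose cons (x : measurableTypeR R * 'rV[R]_n) : 'rV[R]_n.+1 := row_mx x.1%:M x.2.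
have mcons : measurable_fun setT cons.
  apply: measurable_fun_rV => i; rewrite /cons.
  rewrite -(splitK (i : 'I_(1 + n))); case: (fintype.split _) => j /=.
    rewrite [X in measurable_fun _ X](_ : _ = fst); first exact: measurable_fst.
    by apply/funext => x; apply: etrans (row_mxEl _ _ _ _) _; rewrite mxE (ord1 j) eqxx.
  rewrite [X in measurable_fun _ X](_ : _ = fun x : measurableTypeR R * 'rV[R]_n => x.2 0 j); last first.
    by apply/funext => x; exact: row_mxEr.
  apply: (measurableT_comp (measurable_coord_rV j)); exact: measurable_snd.
pose L : {sigma_finite_measure set (measurableTypeR R) -> \bar R} :=
  lebesgue_measure.
pose P : {measure set (measurableTypeR R * 'rV[R]_n)%type -> \bar R} :=
  (L \x mu)%E.
pose nu := pushforward P cons.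
have nuE : lebesgue_rV R n.+1 = nu.
  apply/funext => A; rewrite /nu /pushforward /product_measure1 /=.
  apply: eq_integral => a _; rewrite IH /=; congr (mu _).
  by apply/seteqP; split => v /=; rewrite /xsection/= inE.
have nu_sf : sigma_finite setT nu.
  have [F FT Ffin] : sigma_finite setT P.
    have /sigma_finiteP[F [TF ndF Foo]] := sigma_finiteT L.
    have /sigma_finiteP[G [TG ndG Goo]] := sigma_finiteT mu.
    exists (fun k => F k `*` G k).
      rewrite -setXTT TF TG predeqE => -[x y]; split.
        move=> [/= [i _ Fx] [k _ Gy]]; exists (maxn i k) => //; split.
        - by move: x Fx; exact/subsetPset/ndF/leq_maxl.
        - by move: y Gy; exact/subsetPset/ndG/leq_maxr.
      by move=> [k _ []/= ? ?]; split; exists k.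
    move=> k; have [? ?] := Foo k; have [? ?] := Goo k.
    split; first exact: measurableX.
    by rewrite [ltLHS]product_measure1E// lte_mul_pinfty// ge0_fin_numE.
  pose uncons (w : 'rV[R]_(1 + n)) := (w 0 0, rsubmx w).
  have uncK x : uncons (cons x) = x.
    case: x => a v; rewrite /uncons /cons row_mxKr; congr pair.
    have <- : lshift n (0 : 'I_1) = 0 by exact/val_inj.
    by rewrite row_mxEl mxE.
  have muncons : measurable_fun setT uncons.
    apply: measurable_fun_pair; first exact: measurable_coord_rV.
    apply: measurable_fun_rV => i.
    under eq_fun do rewrite mxE.
    exact: measurable_coord_rV.
  exists (fun k => uncons @^-1` F k).
    by rewrite -preimage_bigcup -FT preimage_setT.
  move=> k; have [mF Fk] := Ffin k; split.
    by rewrite -[X in measurable X]setTI; exact: muncons.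
  rewrite /nu /pushforward (_ : _ @^-1` _ = F k) //.
  by apply/seteqP; split => x /=; rewrite uncK.
pose nuM0 : {measure set 'rV[R]_n.+1 -> \bar R} := nu.
have [nuM nuME] : exists m : {measure set 'rV[R]_n.+1 -> \bar R},
    nu = m :> (set _ -> _) by exists (nuM0 mcons).
rewrite nuME in nuE nu_sf.
exists (sigma_finite_measure_of nu_sf).
by [].
Qed.

Section lebesgue_rV_measure.
Context (R : realType) (n : nat).

Let leb0 : lebesgue_rV R n set0 = 0%E.
Proof. by have [mu ->] := lebesgue_rV_sigma_finite_measure R n. Qed.

Let leb_ge0 A : (0 <= lebesgue_rV R n A)%E.
Proof. by have [mu ->] := lebesgue_rV_sigma_finite_measure R n. Qed.

Let leb_sigma_additive : semi_sigma_additive (lebesgue_rV R n).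
Proof.
have [mu ->] := lebesgue_rV_sigma_finite_measure R n.
exact: measure_semi_sigma_additive.
Qed.

HB.instance Definition _ := isMeasure.Build _ _ _ (lebesgue_rV R n)
  leb0 leb_ge0 leb_sigma_additive.

Let leb_sigma_finite : sigma_finite setT (lebesgue_rV R n).
Proof.
have [mu ->] := lebesgue_rV_sigma_finite_measure R n.
exact: sigma_finiteT.
Qed.

HB.instance Definition _ := Measure_isSigmaFinite.Build _ _ _ (lebesgue_rV R n)
  leb_sigma_finite.

End lebesgue_rV_measure.

Section euclidean.
Context (R : realType) (N : nat).
Implicit Types (x y z v : 'rV[R]_N).

Definition dotv y z : R := \sum_i y 0 i * z 0 i.

(* The norm [`| z |] that MathComp-Analysis puts on matrices is the sup norm. *)
Definition enorm z : R := Num.sqrt (dotv z z).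

Definition angle y z : R := acos (dotv y z / (enorm y * enorm z)).

(* Zero-based: e_1 and e_2 are [stdbasis 0] and [stdbasis 1]. *)
Definition stdbasis (k : nat) : 'rV[R]_N := \row_j (j == k :> nat)%:R.

Definition unit_sphere : set 'rV[R]_N := [set z | enorm z = 1].

Definition normalize z : 'rV[R]_N := (enorm z)^-1 *: z.

Definition is_rotation (S : 'M[R]_N) := S *m S^T = 1%:M /\ \det S = 1.

Definition grad (f : 'rV[R]_N -> R) x : 'rV[R]_N :=
  \row_i 'D_(stdbasis i) f x.

Definition C2 (f : 'rV[R]_N -> R) :=
  [/\ continuous f,
      forall (i : 'I_N) x, derivable f x (stdbasis i),
      forall i : 'I_N, continuous ('D_(stdbasis i) f),
      forall (i j : 'I_N) x, derivable ('D_(stdbasis i) f) x (stdbasis j) &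
      forall i j : 'I_N, continuous ('D_(stdbasis j) ('D_(stdbasis i) f))].

End euclidean.
Arguments stdbasis {R N} k.
Arguments unit_sphere {R N}.

(* Surface measure on the unit sphere, seen as a Borel measure on R^N that
   vanishes off the sphere: sigma(A) = N * |{ r w : w in A, 0 < r < 1 }|. *)
Definition sphere_measure (R : realType) (N : nat) (A : set 'rV[R]_N) : \bar R :=
  (N%:R%:E *
   lebesgue_rV R N [set z | (0 < enorm z < 1)%R /\ A (normalize z)])%E.
Arguments sphere_measure R N A : clear implicits.

Lemma measurable_enorm (R : realType) N : measurable_fun setT (@enorm R N).
Proof.
apply: measurableT_comp.
  by apply: continuous_measurable_fun; exact: sqrt_continuous.
apply: measurable_sum => i.
by apply: measurable_funM; exact: measurable_coord_rV.
Qed.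

Lemma measurable_normalize (R : realType) N :
  measurable_fun setT (@normalize R N).
Proof.
apply: measurable_fun_rV => i; under eq_fun do rewrite mxE.
apply: measurable_funM; last exact: measurable_coord_rV.
rewrite [X in measurable_fun _ X](_ : _ = fun z => enorm z `^ (-1)).
  apply: (measurableT_comp (measurable_powR _)).
  exact: measurable_enorm.
by apply/funext => z; rewrite powR_inv1// sqrtr_ge0.
Qed.

Lemma sphere_measure_measure (R : realType) N :
  exists mu : {measure set 'rV[R]_N -> \bar R}, sphere_measure R N = mu.
Proof.
pose B : set 'rV[R]_N := [set z | 0 < enorm z < 1].
have mB : measurable B.
  rewrite (_ : B = @enorm R N @^-1` `]0, 1[%classic).
    rewrite -[X in measurable X]setTI.
    exact: measurable_enorm.
  by apply/seteqP; split => z; rewrite /B/= in_itv.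
pose mu0 : {measure set 'rV[R]_N -> \bar R} :=
  pushforward (mrestr (lebesgue_rV R N) mB) (@normalize R N).
have [mu muE] : exists mu : {measure set 'rV[R]_N -> \bar R},
    pushforward (mrestr (lebesgue_rV R N) mB) (@normalize R N) = mu :> (_ -> _).
  by exists (mu0 (@measurable_normalize R N)).
exists (mscale N%:R%:nng mu); apply/funext => A.
rewrite /= /mscale -muE /sphere_measure /pushforward /mrestr /=.
by congr (_ * lebesgue_rV _ _ _)%E; apply/seteqP; split => z [].
Qed.

Section sphere_measure_measure.
Context (R : realType) (N : nat).

Let sph0 : sphere_measure R N set0 = 0%E.
Proof. by have [mu ->] := sphere_measure_measure R N. Qed.

Let sph_ge0 A : (0 <= sphere_measure R N A)%E.
Proof. by have [mu ->] := sphere_measure_measure R N. Qed.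

Let sph_sigma_additive : semi_sigma_additive (sphere_measure R N).
Proof.
have [mu ->] := sphere_measure_measure R N.
exact: measure_semi_sigma_additive.
Qed.

HB.instance Definition _ := isMeasure.Build _ _ _ (sphere_measure R N)
  sph0 sph_ge0 sph_sigma_additive.

End sphere_measure_measure.

Definition Gamma (R : realType) (x : R) : R :=
  \int[lebesgue_measure]_(t in `]0, +oo[) (t `^ (x - 1) * expR (- t)).

Section fractional.
Context (R : realType) (N : nat).
Implicit Types (p s alpha r eps : R) (u v phi : 'rV[R]_N -> R)
  (x y z : 'rV[R]_N) (T D : set 'rV[R]_N).

Definition cap alpha : set 'rV[R]_N :=
  [set z | unit_sphere z /\ angle (stdbasis 0) z < alpha].

Definition is_aperture p alpha :=
  0 < alpha <= pi / 2 /\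
  p - 1 =
    (\int[sphere_measure R N]_(z in cap alpha) dotv z (stdbasis 0) ^+ 2) /
    (\int[sphere_measure R N]_(z in cap alpha) dotv z (stdbasis 1) ^+ 2).

Definition cone_shell alpha (a b : \bar R) y : set 'rV[R]_N :=
  [set z | angle y z < alpha /\ (a < (enorm z)%:E < b)%E].

Definition frac_const s : R :=
  4 `^ s * s * Gamma (N%:R / 2 + s) / (pi `^ (N%:R / 2) * Gamma (1 - s)).

(* Integral of f over T against dmu_s(z) = C(N,s) / |z|^(N+2s) dz; at z = 0 the
   density takes the value 0, because 0^-1 = 0. *)
Definition mu_int s T (f : 'rV[R]_N -> R) : R :=
  \int[lebesgue_rV R N]_(z in T)
    (f z * (frac_const s / enorm z `^ (N%:R + 2 * s))).

Definition mu_avg s T (f : 'rV[R]_N -> R) : R :=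
  mu_int s T f / mu_int s T (cst 1).

Definition averaging alpha s eps u x : R :=
  let avg y := mu_avg s (cone_shell alpha eps%:E +oo y) (fun z => u (x + z)) in
  2^-1 * (sup [set avg y | y in unit_sphere] +
          inf [set avg y | y in unit_sphere]).

Definition frac_op alpha s v x : R :=
  mu_int s (cone_shell alpha 0 +oo (normalize (grad v x)))
    (fun z => v (x + z) + v (x - z) - 2 * v x).

(* Closed circular cone with vertex 0, axis a (a unit vector), half-angle theta
   and height h. The vertex is listed apart since [angle a 0] is pi / 2. *)
Definition finite_cone (a : 'rV[R]_N) (theta h : R) : set 'rV[R]_N :=
  [set z | z = 0 \/ (angle a z <= theta /\ dotv a z <= h)].

Definition external_cone D :=
  exists (a : 'rV[R]_N) (theta h : R),
    [/\ unit_sphere a, 0 < theta < pi / 2, 0 < h &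
      forall x, (closure D `\` interior D) x ->
        exists2 S : 'M[R]_N, is_rotation S &
          forall z, finite_cone a theta h z -> ~ D (x + z *m S)].

Definition averaging_solution alpha s eps D (F u : 'rV[R]_N -> R) :=
  [/\ bounded_fun u, measurable_fun setT u,
      forall x, D x -> u x = averaging alpha s eps u x &
      forall x, ~ D x -> u x = F x].

(* Delta_p^s is a positive multiple of [frac_op], so that the viscosity
   inequalities are imposed on the latter. *)
Definition viscosity_solution alpha s D (F u : 'rV[R]_N -> R) :=
  [/\ bounded_fun u, continuous u, forall x, ~ D x -> u x = F x &
    forall x r phi, D x -> 0 < r -> C2 phi ->
      phi x = u x -> grad phi x != 0 ->
      let B := [set y | enorm (y - x) <= r] in
      let phit := patch u B phi in
      ((forall y, B y -> y <> x -> u y < phi y) ->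
         0 <= frac_op alpha s phit x) /\
      ((forall y, B y -> y <> x -> phi y < u y) ->
         frac_op alpha s phit x <= 0)].

End fractional.

(* Main.v *)
Require Import Defs.
From HB Require Import structures.
From mathcomp Require Import all_boot all_order all_algebra.
From mathcomp Require Import all_classical all_reals all_analysis.
From mathcomp Require Import measurable_realfun ring lra.

(** As [eps] tends to 0, the solutions [u_eps] are bounded and asymptotically
    equicontinuous on the whole space; a uniform limit along a subsequence is
    then tested against smooth functions.

    Comparison. From a bounded set, a jump exits with a probability bounded from
    below, whatever the axis of the cone in which it takes place. Hence a
    subsolution and a supersolution of [u = averaging u] are ordered everywhere
    as soon as they are ordered outside a bounded set ([comparison]).

    Boundary. The exterior cone contains balls of radius proportional to the
    distance to the boundary point ([exterior_balls]). A small power of the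
    distance to a pole close to that point, cut to zero on the exterior of the
    domain, is a supersolution ([barrier_super]): the first-order terms of the
    supremum and of the infimum compensate each other, the second-order errors
    carry the exponent [b] as a factor, and the gain due to the jumps into the
    exterior balls does not. By comparison, [u_eps] is close to [F] near the
    boundary, uniformly for small [eps] ([boundary_regularity]).

    Interior. A translate of a solution is a solution in the translated domain.
    A solution and its translate by a small vector are close outside the
    intersection of the two domains, because points there are close to the
    boundary or to the exterior; by comparison they are close everywhere
    ([equicontinuity]). A subsequence converges uniformly
    ([uniform_subsequence]).

    Limit. Let [phi] touch the limit [v] from above at [x0]. Near [x0], the
    difference of the approximating solution and of [phi] is almost maximal at
    some point, where the averaging equation says that the second difference of
    a function close to [v] glued with [phi] has an almost nonnegative integral
    over the cone truncated at [eps], with an axis almost realising the supremum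
    ([approximate_touching]). As [s > 1/2], the first moment of the truncated
    cone blows up when [eps] tends to 0, so that this axis has to approach the
    direction of the gradient of [phi]. Second differences are dominated by the
    integrable function [min(|z|^2, |z|)], and dominated convergence gives the
    first viscosity inequality ([viscosity_limit]); the second one follows by
    changing signs ([viscosity_of_limit]).

    Two facts are needed throughout. The mass of a cone and the length of its
    first moment do not depend on its axis, which amounts to the invariance of Lebesgue measure
    under reflections ([lebesgue_rV_isometry]). The constant of the kernel is
    positive, because the integral defining the Gamma function is finite and
    positive ([Gamma_gt0]). *)

Set Implicit Arguments.
Unset Strict Implicit.
Unset Printing Implicit Defensive.

Import Order.TTheory GRing.Theory Num.Theory.
Import numFieldNormedType.Exports.
Local Open Scope classical_set_scope.
Local Open Scope ring_scope.

(** * Euclidean geometry of row vectors *)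

Section euclidean_geometry.
Context (R : realType) (N : nat).
Implicit Types (x y z v : 'rV[R]_N) (a b : R).

Lemma dotvC x y : dotv x y = dotv y x.
Proof. by apply: eq_bigr => i _; rewrite mulrC. Qed.

Lemma dotvDl x y z : dotv (x + y) z = dotv x z + dotv y z.
Proof.
by rewrite /dotv -big_split/=; apply: eq_bigr => i _; rewrite mxE mulrDl.
Qed.

Lemma dotvZl a x y : dotv (a *: x) y = a * dotv x y.
Proof. by rewrite /dotv mulr_sumr; apply: eq_bigr => i _; rewrite mxE mulrA. Qed.

Lemma dotvDr x y z : dotv z (x + y) = dotv z x + dotv z y.
Proof. by rewrite dotvC dotvDl !(dotvC z). Qed.

Lemma dotvZr a x y : dotv y (a *: x) = a * dotv y x.
Proof. by rewrite dotvC dotvZl (dotvC y). Qed.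

Lemma dotvNl x y : dotv (- x) y = - dotv x y.
Proof. by rewrite -scaleN1r dotvZl mulN1r. Qed.

Lemma dotvNr x y : dotv x (- y) = - dotv x y.
Proof. by rewrite dotvC dotvNl dotvC. Qed.

Lemma dotvBl x y z : dotv (x - y) z = dotv x z - dotv y z.
Proof. by rewrite dotvDl dotvNl. Qed.

Lemma dotvBr x y z : dotv z (x - y) = dotv z x - dotv z y.
Proof. by rewrite dotvDr dotvNr. Qed.

Lemma dotv0 x : dotv x 0 = 0.
Proof. by rewrite -(scale0r x) dotvZr mul0r. Qed.

Lemma dot0v x : dotv 0 x = 0.
Proof. by rewrite dotvC dotv0. Qed.

Lemma dotv_ge0 x : 0 <= dotv x x.
Proof. by apply: sumr_ge0 => i _; rewrite -expr2 sqr_ge0. Qed.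

Lemma enorm_ge0 x : 0 <= enorm x. Proof. exact: sqrtr_ge0. Qed.

Lemma sqr_enorm x : enorm x ^+ 2 = dotv x x.
Proof. by rewrite sqr_sqrtr// dotv_ge0. Qed.

Lemma enorm_coord x i : `|x 0 i| <= enorm x.
Proof.
rewrite -sqrtr_sqr ler_sqrt ?dotv_ge0// /dotv (bigD1 i)//= -expr2 lerDl.
by apply: sumr_ge0 => j _; rewrite -expr2 sqr_ge0.
Qed.

Lemma enorm_eq0 x : (enorm x == 0) = (x == 0).
Proof.
apply/eqP/eqP => [x0|->]; last by rewrite /enorm dotv0 sqrtr0.
apply/rowP => i; rewrite mxE; apply/eqP; rewrite -normr_le0 -x0.
exact: enorm_coord.
Qed.

Lemma enorm0 : enorm (0 : 'rV[R]_N) = 0.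
Proof. by apply/eqP; rewrite enorm_eq0. Qed.

Lemma enorm_gt0 x : (0 < enorm x) = (x != 0).
Proof. by rewrite lt_neqAle enorm_ge0 andbT eq_sym enorm_eq0. Qed.

Lemma enormZ a x : enorm (a *: x) = `|a| * enorm x.
Proof.
by rewrite /enorm dotvZl dotvZr mulrA -expr2 sqrtrM ?sqr_ge0// sqrtr_sqr.
Qed.

Lemma enormN x : enorm (- x) = enorm x.
Proof. by rewrite -scaleN1r enormZ normrN1 mul1r. Qed.

Lemma enormB x y : enorm (x - y) = enorm (y - x).
Proof. by rewrite -enormN opprB. Qed.

Lemma sqr_enormD x y :
  enorm (x + y) ^+ 2 = enorm x ^+ 2 + 2 * dotv x y + enorm y ^+ 2.
Proof. by rewrite !sqr_enorm dotvDl !dotvDr (dotvC y x); ring. Qed.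

Lemma dotv_le x y : dotv x y <= enorm x * enorm y.
Proof.
have [->|y0] := eqVneq y 0; first by rewrite dotv0 enorm0 mulr0.
have [->|x0] := eqVneq x 0; first by rewrite dot0v enorm0 mul0r.
have xy0 : 0 < enorm x * enorm y by rewrite mulr_gt0 ?enorm_gt0.
have := dotv_ge0 (enorm y *: x - enorm x *: y).
rewrite !dotvBl !dotvBr !dotvZl !dotvZr -!sqr_enorm (dotvC y x).
have -> : enorm y * (enorm y * enorm x ^+ 2) - enorm y * (enorm x * dotv x y) -
  (enorm x * (enorm y * dotv x y) - enorm x * (enorm x * enorm y ^+ 2)) =
  2 * (enorm x * enorm y) * (enorm x * enorm y - dotv x y) by ring.
by rewrite pmulr_rge0 ?subr_ge0// mulr_gt0.
Qed.

Lemma norm_dotv_le x y : `|dotv x y| <= enorm x * enorm y.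
Proof. by rewrite ler_norml dotv_le lerNl -dotvNl -(enormN x) dotv_le. Qed.

Lemma enormD x y : enorm (x + y) <= enorm x + enorm y.
Proof.
rewrite -(ler_pXn2r (_ : 0 < 2)%N) ?nnegrE ?addr_ge0 ?enorm_ge0//.
have := dotv_le x y; rewrite sqr_enormD sqrrD mulr2n; lra.
Qed.

Lemma enorm_subD x y z : enorm (x - z) <= enorm (x - y) + enorm (y - z).
Proof. by rewrite -{1}(subrKA y) enormD. Qed.

Lemma lerB_enorm x y : enorm x - enorm y <= enorm (x + y).
Proof.
by rewrite lerBlDr -{1}(addrK y x) -(enormN y); exact: enormD.
Qed.

Lemma normr_le_enorm x : `|x| <= enorm x.
Proof.
rewrite [leLHS]mx_normrE; apply/bigmax_leP; split; first exact: enorm_ge0.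
by move=> [i j] _; rewrite /= (ord1 i) enorm_coord.
Qed.

Lemma coord_le_normr x i : `|x 0 i| <= `|x|.
Proof.
rewrite [leRHS]mx_normrE; apply/bigmax_geP; right => /=.
by exists (0, i).
Qed.

Lemma enorm_le_normr x : enorm x <= N%:R * `|x|.
Proof.
rewrite -(ler_pXn2r (_ : 0 < 2)%N) ?nnegrE ?mulr_ge0 ?enorm_ge0//.
rewrite sqr_enorm; apply: (@le_trans _ _ (\sum_(i < N) `|x| ^+ 2)).
  apply: ler_sum => i _; rewrite -expr2 -real_normK ?num_real//.
  by rewrite ler_pXn2r ?nnegrE// coord_le_normr.
rewrite sumr_const card_ord exprMn -(mulr_natl (`|x| ^+ 2)) ler_wpM2r ?sqr_ge0 ?exprn_ge0//.
by rewrite -natrX ler_nat; case: (N) => // n; rewrite leq_pmulr.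
Qed.

Lemma continuous_dotv y : continuous (dotv y).
Proof.
apply: (@continuous_big R _ +%R 0 xpredT) => [|i _].
  by move=> [a b]; exact: (@cvgD _ R^o _ _ _ fst snd a b cvg_fst cvg_snd).
by move=> x; apply: (continuous_comp (g := *%R (y 0 i)) (@coord_continuous _ _ _ 0 i x)); exact: mulrl_continuous.
Qed.

Lemma continuous_enorm : continuous (@enorm R N).
Proof.
move=> x; apply: (@continuous_comp _ _ _ (fun z => dotv z z) Num.sqrt).
  move: x; apply: (@continuous_big R _ +%R 0 xpredT) => [|i _].
    by move=> [a b]; exact: (@cvgD _ R^o _ _ _ fst snd a b cvg_fst cvg_snd).
  by move=> x; apply: (@cvgM _ _ (nbhs x)); exact: (@coord_continuous _ _ _ 0 i x).
exact: sqrt_continuous.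
Qed.

Lemma angle_cos_bound y z : unit_sphere y ->
  -1 <= dotv y z / (enorm y * enorm z) <= 1.
Proof.
move=> y1; rewrite y1 mul1r -ler_norml normrM normfV (ger0_norm (enorm_ge0 z)).
have [->|z0] := eqVneq z 0; first by rewrite dotv0 normr0 mul0r.
by rewrite ler_pdivrMr ?enorm_gt0// mul1r (le_trans (norm_dotv_le _ _))// y1 mul1r.
Qed.

Lemma angle_lt alpha y z : 0 <= alpha <= pi -> unit_sphere y -> z != 0 ->
  (angle y z < alpha) = (cos alpha * enorm z < dotv y z).
Proof.
move=> al y1 z0; have yz := angle_cos_bound z y1.
rewrite /angle -ltr_cos ?acosK//; last first.
  by rewrite in_itv/= acos_ge0// acos_lepi.
by rewrite y1 mul1r ltr_pdivlMr ?enorm_gt0.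
Qed.

Lemma angle_le alpha y z : 0 <= alpha <= pi -> unit_sphere y -> z != 0 ->
  (angle y z <= alpha) = (cos alpha * enorm z <= dotv y z).
Proof.
move=> al y1 z0; have yz := angle_cos_bound z y1.
rewrite leNgt /angle -ltr_cos ?acosK//; last first.
  by rewrite in_itv/= acos_ge0// acos_lepi.
by rewrite y1 mul1r ltr_pdivrMr ?enorm_gt0// -leNgt.
Qed.

(** Written with the cosine of its half-angle, a cone is defined by an
    inequality between continuous functions, and the vertex is excluded. *)
Definition opencone (c : R) y : set 'rV[R]_N :=
  [set z | c * enorm z < dotv y z].

Definition shell (a : R) : set 'rV[R]_N := [set z | a < enorm z].

Lemma cone_shellE alpha a y : 0 <= a -> 0 < alpha <= pi / 2 -> unit_sphere y ->
  cone_shell alpha a%:E +oo y = opencone (cos alpha) y `&` shell a.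
Proof.
move=> a0 /andP[al0 al2] y1.
have al : 0 <= alpha <= pi.
  rewrite (ltW al0) (le_trans al2)// ler_pdivrMr// ler_peMr ?pi_ge0//; lra.
apply/seteqP; split => z; rewrite /cone_shell /shell /= lte_fin ltry andbT.
  move=> [az za]; split=> //; rewrite /opencone /= -angle_lt//.
  by rewrite -enorm_gt0 (le_lt_trans a0).
move=> [az za]; split=> //; rewrite angle_lt//.
by rewrite -enorm_gt0 (le_lt_trans a0).
Qed.

(** The Householder reflection in the hyperplane orthogonal to the unit vector
    [v]. *)
Definition reflect_in v z := z - (2 * dotv v z) *: v.

Lemma dotv_reflect v x z : dotv x (reflect_in v z) = dotv (reflect_in v x) z.
Proof. by rewrite dotvBl dotvBr dotvZl dotvZr (dotvC x v); ring. Qed.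

Lemma reflectK v : unit_sphere v -> involutive (reflect_in v).
Proof.
move=> v1 z; rewrite /reflect_in dotvBr dotvZr -sqr_enorm v1.
apply/rowP => i; rewrite !mxE; ring.
Qed.

Lemma enorm_reflect v z : unit_sphere v -> enorm (reflect_in v z) = enorm z.
Proof. by move=> v1; rewrite /enorm dotv_reflect reflectK. Qed.

Lemma reflectD v x y : reflect_in v (x + y) = reflect_in v x + reflect_in v y.
Proof. by rewrite /reflect_in dotvDr mulrDr scalerDl opprD addrACA. Qed.

Lemma reflect_orth v y : dotv v y = 0 -> reflect_in v y = y.
Proof. by move=> vy; rewrite /reflect_in vy mulr0 scale0r subr0. Qed.

Lemma unit_normalize x : x != 0 -> unit_sphere (normalize x).
Proof.
move=> x0; rewrite /unit_sphere /= /normalize enormZ normfV.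
by rewrite (ger0_norm (enorm_ge0 _)) mulVf// enorm_eq0.
Qed.

Lemma unitN y : unit_sphere y -> unit_sphere (- y).
Proof. by move=> y1; rewrite /unit_sphere /= enormN. Qed.

(** Every axis is thus carried to any other one by an involutive isometry, of the
    kind covered by [lebesgue_rV_isometry]. *)
Lemma reflect_swap x y : unit_sphere x -> unit_sphere y -> x != y ->
  reflect_in (normalize (x - y)) y = x.
Proof.
move=> x1 y1 xy; have n0 : enorm (x - y) != 0 by rewrite enorm_eq0 subr_eq0.
rewrite /reflect_in /normalize dotvZl scalerA.
have E : enorm (x - y) ^+ 2 = 2 - 2 * dotv x y.
  rewrite sqr_enormD dotvNr enormN x1 y1; ring.
have -> : 2 * ((enorm (x - y))^-1 * dotv (x - y) y) / enorm (x - y) = -1.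
  have -> : dotv (x - y) y = - (enorm (x - y) ^+ 2 / 2).
    by rewrite E dotvBl -(sqr_enorm y) y1; field.
  by field.
by rewrite scaleN1r opprK addrCA subrr addr0.
Qed.

End euclidean_geometry.

(** * Invariance of Lebesgue measure *)

Section lebesgue_rV_invariance.
Context (R : realType).

Lemma open_measurable_rV n (A : set 'rV[R]_n) : open A -> measurable A.
Proof. exact: sub_sigma_algebra. Qed.

Lemma closed_measurable_rV n (A : set 'rV[R]_n) : closed A -> measurable A.
Proof.
move=> cA; rewrite -(setCK A); apply: measurableC; apply: open_measurable_rV.
exact: closed_openC.
Qed.

Lemma measurable_preimage_rV d (T : measurableType d) n (f : T -> 'rV[R]_n)
    (A : set 'rV[R]_n) :
  (forall i, measurable_fun setT (fun x => f x 0 i)) ->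
  measurable A -> measurable [set x | A (f x)].
Proof.
move=> mf mA; rewrite -[X in measurable X]setTI.
exact: (measurable_fun_rV mf).
Qed.

Lemma lebesgue_shift (c : R) (A : set (measurableTypeR R)) : measurable A ->
  pushforward lebesgue_measure (+%R^~ c : _ -> measurableTypeR R) A =
  lebesgue_measure A.
Proof.
have mc : measurable_fun setT (+%R^~ c : _ -> measurableTypeR R).
  exact: measurable_funD.
move=> mA; apply/esym/lebesgue_measure_unique => //= _ [[a b]] _ <-.
rewrite /pushforward/=.
rewrite (_ : _ @^-1` _ = `](a - c), (b - c)]%classic); last first.
  by apply/seteqP; split => x /=; rewrite !in_itv/= ltrBlDr lerBrDr.
rewrite !lebesgue_measure_itv/= !lte_fin ltrD2r.
by case: ifP => // _; rewrite -!EFinB opprB addrA subrK.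
Qed.

Lemma ge0_integral_shift (c : R) (g : measurableTypeR R -> \bar R) :
  measurable_fun setT g -> (forall x, 0 <= g x)%E ->
  (\int[lebesgue_measure]_x g (x + c)%R = \int[lebesgue_measure]_x g x)%E.
Proof.
move=> mg g0; have mc : measurable_fun setT (+%R^~ c : _ -> measurableTypeR R).
  exact: measurable_funD.
have := @ge0_integral_pushforward _ _ (measurableTypeR R) (measurableTypeR R) R _ mc
  lebesgue_measure setT g measurableT mg.
rewrite preimage_setT => <-; last by move=> x _; exact: g0.
apply: eq_measure_integral => A mA _; exact: lebesgue_shift.
Qed.

Let cons n (x : measurableTypeR R * 'rV[R]_n) : 'rV[R]_n.+1 := row_mx x.1%:M x.2.

Let measurable_cons n (A : set 'rV[R]_n.+1) : measurable A ->
  measurable [set x | A (@cons n x)].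
Proof.
apply: measurable_preimage_rV => i; rewrite /cons.
rewrite -(splitK (i : 'I_(1 + n))); case: (fintype.split _) => j /=.
  rewrite [X in measurable_fun _ X](_ : _ = fst); first exact: measurable_fst.
  by apply/funext => x; apply: etrans (row_mxEl _ _ _ _) _; rewrite mxE (ord1 j) eqxx.
rewrite [X in measurable_fun _ X](_ : _ = fun x : measurableTypeR R * 'rV[R]_n => x.2 0 j); last first.
  by apply/funext => x; exact: row_mxEr.
apply: (measurableT_comp (measurable_coord_rV j)); exact: measurable_snd.
Qed.

Let measurable_slice n (A : set 'rV[R]_n.+1) : measurable A ->
  measurable_fun setT
    (fun a : measurableTypeR R => lebesgue_rV R n [set v | A (row_mx a%:M v)]).
Proof.
move=> mA; have mA' := measurable_cons mA.
rewrite (_ : (fun a : measurableTypeR R => _) =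
  lebesgue_rV R n \o xsection [set x | A (@cons n x)]).
  exact: measurable_fun_xsection.
apply/funext => a /=; congr (lebesgue_rV R n _).
by apply/seteqP; split => v /=; rewrite /xsection/= inE.
Qed.

Lemma lebesgue_rV_translate n (c : 'rV[R]_n) (A : set 'rV[R]_n) : measurable A ->
  lebesgue_rV R n [set v | A (v + c)] = lebesgue_rV R n A.
Proof.
elim: n c A => [|n IH] c A mA.
  by congr (lebesgue_rV _ _ _); apply/seteqP; split => v /=; rewrite (thinmx0 (v + c)) (thinmx0 v).
pose c' : 'rV[R]_(1 + n) := c.
rewrite /= -[RHS](@ge0_integral_shift (c' 0 0)); last 2 first.
- exact: measurable_slice.
- by move=> a; apply: measure_ge0.
apply: eq_integral => a _.
rewrite -[RHS](IH (rsubmx c')); last first.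
  apply: (measurable_preimage_rV _ mA) => i.
  rewrite -(splitK (i : 'I_(1 + n))); case: (fintype.split _) => j /=.
    rewrite [X in measurable_fun _ X](_ : _ = cst ((a + c' 0 0)%:M 0 j)) //.
    by apply/funext => x; apply: row_mxEl.
  rewrite [X in measurable_fun _ X](_ : _ = fun x : 'rV[R]_n => x 0 j); last first.
    by apply/funext => x; exact: row_mxEr.
  exact: measurable_coord_rV.
have E (v : 'rV[R]_n) :
    row_mx a%:M v + c = row_mx (a + c' 0 0)%:M (v + rsubmx c').
  transitivity (row_mx a%:M v + row_mx (lsubmx c') (rsubmx c')).
    by rewrite hsubmxK.
  rewrite add_row_mx; congr row_mx; apply/rowP => i.
  by rewrite !mxE (ord1 i) eqxx !mulr1n; congr (_ + c' 0 _); exact/val_inj.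
by congr (lebesgue_rV _ _ _); apply/seteqP; split => v /=; rewrite E.
Qed.

Lemma lebesgue_rV_box n (r : R) : 0 <= r ->
  lebesgue_rV R n [set v | forall i, `|v 0 i| < r] = ((2 * r) ^+ n)%:E.
Proof.
move=> r0; elim: n => [|n IH].
  by rewrite /= diracE mem_set//= => -[].
rewrite /= (eq_integral (fun a : measurableTypeR R =>
    ((2 * r) ^+ n)%:E * (\1_(ball (0 : R) r : set (measurableTypeR R)) a)%:E)%E); last first.
  have ballE (b : R) : ball (0 : R) r b = (`|b| < r) :> Prop.
    by rewrite /ball/= sub0r normrN.
  move=> a _; rewrite indicE.
  have rE (v : 'rV[R]_n) i : row_mx a%:M v 0 (rshift 1 i) = v 0 i.
    exact: row_mxEr.
  have lE (v : 'rV[R]_n) : row_mx a%:M v 0 (lshift n (0 : 'I_1)) = a.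
    by apply: etrans (row_mxEl _ _ _ _) _; rewrite mxE eqxx.
  have [/[!inE]/= ar|/negP] := boolP (a \in _).
    rewrite mule1 -IH; congr (lebesgue_rV _ _ _); apply/seteqP; split => v /= vr i.
      by rewrite -rE.
    rewrite -(splitK (i : 'I_(1 + n))); case: (fintype.split _) => j /=.
      by rewrite (ord1 j) lE -ballE.
    by rewrite rE.
  rewrite inE/= => ar; rewrite mule0.
  rewrite (_ : [set v | _] = set0) ?measure0//; apply/seteqP; split => v //= vr.
  by apply: ar; rewrite ballE -(lE v); exact: vr.
rewrite ge0_integralZl//; last 2 first.
  by apply/measurable_EFinP/measurable_indic; exact: measurable_ball.
  by rewrite lee_fin exprn_ge0// mulr_ge0.
rewrite integral_indic ?setIT//; last exact: measurable_ball.
rewrite [X in (_ * X)%E](lebesgue_measure_ball 0 r0).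
by rewrite exprSr EFinM mulr_natl.
Qed.

End lebesgue_rV_invariance.

Section lebesgue_rV_unique.
Context (R : realType) (n : nat).
Local Notation L := (lebesgue_rV R n).

Lemma fubini_set (X : set ('rV[R]_n * 'rV[R]_n)) : measurable X ->
  (\int[L]_x L [set y | X (x, y)] = \int[L]_y L [set x | X (x, y)])%E.
Proof.
move=> mX; transitivity (\int[L]_x (L \o xsection X) x)%E.
  apply: eq_integral => x _ /=; congr (L _).
  by apply/seteqP; split => y /=; rewrite /xsection/= inE.
rewrite -indic_fubini_tonelli_FE//.
rewrite indic_fubini_tonelli// indic_fubini_tonelli_GE//.
apply: eq_integral => x _ /=; congr (L _).
by apply/seteqP; split => y /=; rewrite /ysection/= inE.
Qed.

Lemma integral_setI_cst (A : set 'rV[R]_n) (S : 'rV[R]_n -> set 'rV[R]_n)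
    (c : \bar R) : measurable A -> (0 <= c)%E -> (forall x, L (S x) = c) ->
  (\int[L]_x L [set y | A x /\ S x y] = L A * c)%E.
Proof.
move=> mA c0 Sc; rewrite (eq_integral (fun x => (\1_A x)%:E * c)%E).
  rewrite ge0_integralZr ?integral_indic ?setIT//.
  by apply/measurable_EFinP; exact: measurable_indic.
move=> x _; rewrite indicE; have [/[!inE] Ax|] := boolP (x \in A).
  rewrite mul1e -(Sc x); congr (L _); apply/seteqP; split => y /=; last by split.
  by case.
rewrite notin_setE => nAx; rewrite mul0e (_ : [set y | _] = set0) ?measure0//.
by apply/seteqP; split => y //= -[].
Qed.

(** Both sides are the double integral of [A x * B (f y - x)], computed in the
    two orders: it is the usual proof that an invariant measure is unique up to
    a factor, for the measure transported by [f]. *)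
Lemma lebesgue_rV_transport (f g : 'rV[R]_n -> 'rV[R]_n) (A B : set 'rV[R]_n) :
  (forall x y, f (x + y) = f x + f y) -> cancel g f ->
  (forall i, measurable_fun setT (fun x => f x 0 i)) ->
  measurable A -> measurable B -> (forall x, B (- x) <-> B x) ->
  (L A * L [set v | B (f v)] = L B * L [set v | A (f v)])%E.
Proof.
move=> fD fK mf mA mB BN.
have mAf : measurable [set v | A (f v)] by exact: measurable_preimage_rV.
have mBf : measurable [set v | B (f v)] by exact: measurable_preimage_rV.
have mfst i : measurable_fun setT (fun x : 'rV[R]_n * 'rV[R]_n => x.1 0 i).
  apply: (measurableT_comp (measurable_coord_rV i)); exact: measurable_fst.
have mfsnd i : measurable_fun setT (fun x : 'rV[R]_n * 'rV[R]_n => f x.2 0 i).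
  apply: (measurableT_comp (mf i)); exact: measurable_snd.
have mneg i : measurable_fun setT (fun x : 'rV[R]_n => (- x) 0 i).
  under eq_fun do rewrite mxE.
  by apply: measurableT_comp => //; exact: measurable_coord_rV.
have madd (c : 'rV[R]_n) i : measurable_fun setT (fun x : 'rV[R]_n => (x + c) 0 i).
  under eq_fun do rewrite mxE.
  by apply: measurable_funD => //; exact: measurable_coord_rV.
have f0 : f 0 = 0 by apply: (addrI (f 0)); rewrite -fD !addr0.
have fN z : f (- z) = - f z by apply/eqP; rewrite -addr_eq0 -fD addNr f0.
have fB x y : f (y - g x) = f y - x by rewrite fD fN fK.
have fA x y : f (y + g x) = f y + x by rewrite fD fK.
have mXA : measurable
    [set p : 'rV[R]_n * 'rV[R]_n | A p.1 /\ B (f p.2 - p.1)].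
  apply: measurableI.
    exact: (@measurable_preimage_rV _ _ _ _ fst).
  apply: (@measurable_preimage_rV _ _ ('rV[R]_n * 'rV[R]_n)%type _ (fun p => f p.2 - p.1)) => // i.
  by under eq_fun do rewrite mxE mxE; apply: measurable_funB.
have mXB : measurable
    [set p : 'rV[R]_n * 'rV[R]_n | B p.1 /\ A (f p.2 + p.1)].
  apply: measurableI.
    exact: (@measurable_preimage_rV _ _ _ _ fst).
  apply: (@measurable_preimage_rV _ _ ('rV[R]_n * 'rV[R]_n)%type _ (fun p => f p.2 + p.1)) => // i.
  by under eq_fun do rewrite mxE; apply: measurable_funD.
rewrite -(integral_setI_cst (S := fun x => [set y | B (f y - x)]))//; last first.
  move=> x; rewrite -(lebesgue_rV_translate (- g x) mBf).
  by congr (L _); apply/seteqP; split => y /=; rewrite fB.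
rewrite -(integral_setI_cst (S := fun x => [set y | A (f y + x)]))//; last first.
  move=> x; rewrite -(lebesgue_rV_translate (g x) mAf).
  by congr (L _); apply/seteqP; split => y /=; rewrite fA.
rewrite (fubini_set mXA) (fubini_set mXB); apply: eq_integral => y _ /=.
have mS : measurable [set x | A x /\ B (f y - x)].
  apply: measurableI => //; apply: (@measurable_preimage_rV _ _ 'rV[R]_n _ (fun x => f y - x) B) => // i.
  by under eq_fun do rewrite mxE mxE; apply: measurable_funB => //; exact: measurable_coord_rV.
rewrite -(lebesgue_rV_translate (f y) mS); congr (L _).
apply/seteqP; split => x /=; rewrite opprD addrCA subrr addr0 (addrC x).
  by move=> [? /BN].
by move=> [/BN ? ?].
Qed.

Lemma measurable_enorm_lt (r : R) : measurable [set z : 'rV[R]_n | enorm z < r].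
Proof.
rewrite -[X in measurable X]setTI.
by have /(_ measurableT `]-oo, r[%classic (measurable_itv _)) := @measurable_enorm R n.
Qed.

Let box (r : R) : set 'rV[R]_n := [set v | forall i, `|v 0 i| < r].

Lemma measurable_box r : measurable (box r).
Proof.
rewrite (_ : box r = ~` \bigcup_i [set v | ~ `|v 0 i| < r]).
  apply/measurableC/countable_bigcupT_measurable => [|i]; first exact: countableP.
  apply: measurableC; rewrite -[X in measurable X]setTI.
  have : measurable_fun setT (fun v : 'rV[R]_n => `|v 0 i|).
    by apply: measurableT_comp => //; exact: measurable_coord_rV.
  by move=> /(_ measurableT `]-oo, r[%classic (measurable_itv _)).
apply/seteqP; split => v /=; first by move=> vr [i _]; exact.
by move=> vr i; apply: contrapT => nv; apply: vr; exists i.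
Qed.

(** The factor is computed on a cube, whose measure is known. *)
Lemma lebesgue_rV_scale (l : R) (A : set 'rV[R]_n) : 0 < l -> measurable A ->
  (L [set v | A (l *: v)] * (l ^+ n)%:E = L A)%E.
Proof.
move=> l0 mA; have l1 : 0 <= l^-1 by rewrite invr_ge0 ltW.
have : (L A * L [set v | box 1 (l *: v)] = L (box 1) * L [set v | A (l *: v)])%E.
  apply: (@lebesgue_rV_transport ( *:%R l) ( *:%R l^-1)) => //.
  - exact: scalerDr.
  - by move=> x; rewrite scalerA divff ?scale1r// gt_eqF.
  - move=> i; under eq_fun do rewrite mxE.
    by apply: measurable_funM => //; exact: measurable_coord_rV.
  - exact: measurable_box.
  - by move=> x; split => + i => /(_ i); rewrite mxE normrN.
have -> : [set v | box 1 (l *: v)] = box l^-1.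
  apply/seteqP; split => v + i => /(_ i);
  by rewrite mxE normrM gtr0_norm// -ltr_pdivlMl// mulr1.
rewrite !lebesgue_rV_box// !exprMn expr1n mulr1 => H.
have lN : l ^+ n != 0 by rewrite expf_neq0 ?gt_eqF.
have E : (((2 ^+ n)^-1)%:E * (L A * (2 ^+ n * l^-1 ^+ n)%:E) =
     L [set v | A (l *: v)])%E.
  by rewrite H muleA -EFinM mulVf ?mul1e// expf_neq0.
rewrite -E -muleA muleC -!muleA -!EFinM.
rewrite (_ : _ * _ = 1) ?mule1//.
by rewrite exprVn; field; rewrite lN expf_neq0.
Qed.

Lemma lebesgue_rV_ball_lty (r : R) : L [set v | enorm v < r] \is a fin_num.
Proof.
rewrite ge0_fin_numE//; apply: (@le_lt_trans _ _ (L (box `|r|))).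
  apply: le_measure; rewrite ?inE.
  - exact: measurable_enorm_lt.
  - exact: measurable_box.
  - move=> v /= vr i; apply: le_lt_trans (enorm_coord v i) _.
    by rewrite (lt_le_trans vr)// ler_norm.
by rewrite lebesgue_rV_box// ltry.
Qed.

Lemma lebesgue_rV_ball_gt0 (r : R) : 0 < r ->
  (0 < L [set v | (enorm v < r)%R])%E.
Proof.
move=> r0; have d0 : 0 < r / n.+1%:R by rewrite divr_gt0.
apply: (@lt_le_trans _ _ (L (box (r / n.+1%:R)))).
  by rewrite lebesgue_rV_box ?(ltW d0)// lte_fin exprn_gt0// mulr_gt0.
apply: le_measure; rewrite ?inE.
- exact: measurable_box.
- exact: measurable_enorm_lt.
- move=> v /= vr; apply: le_lt_trans (enorm_le_normr v) _.
  apply: (@le_lt_trans _ _ (n%:R * (r / n.+1%:R))).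
    rewrite ler_wpM2l// [leLHS]mx_normrE; apply/bigmax_leP; split; first exact: ltW.
    by move=> [i j] _; rewrite /= (ord1 i) ltW.
  rewrite mulrCA gtr_pMr// ltr_pdivrMr// mul1r ltr_nat//.
Qed.

(** An isometry preserves the unit ball, so that the factor is 1. *)
Lemma lebesgue_rV_isometry (f : 'rV[R]_n -> 'rV[R]_n) (A : set 'rV[R]_n) :
  (forall x y, f (x + y) = f x + f y) -> involutive f ->
  (forall x, enorm (f x) = enorm x) ->
  (forall i, measurable_fun setT (fun x => f x 0 i)) -> measurable A ->
  L [set v | A (f v)] = L A.
Proof.
move=> fD fK fI mf mA.
have := lebesgue_rV_transport fD fK mf mA (@measurable_enorm_lt 1).
rewrite (_ : [set v | [set v | enorm v < 1] (f v)] = [set v | enorm v < 1]); last first.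
  by apply/seteqP; split => v /=; rewrite fI.
have B0 := lebesgue_rV_ball_gt0 ltr01; have Bfin := lebesgue_rV_ball_lty 1.
set b := L [set v | _] in B0 Bfin *; set A' := L [set v | _] => H.
have {}H : (L A * b = b * A')%E by apply: H => x; rewrite /= enormN.
have bK (z : \bar R) : ((fine b)^-1%:E * (b * z) = z)%E.
  rewrite muleA -{2}(fineK Bfin) -EFinM mulVf ?mul1e//.
  by rewrite gt_eqF// fine_gt0// B0 ltey_eq Bfin.
by rewrite -[RHS]bK (muleC b) H bK.
Qed.

End lebesgue_rV_unique.

Section change_of_variables.
Context (R : realType) (n : nat).
Local Notation L := (lebesgue_rV R n).

Lemma measurable_scale_rV (l : R) i :
  measurable_fun setT (fun x : 'rV[R]_n => (l *: x) 0 i).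
Proof.
under eq_fun do rewrite mxE.
by apply: measurable_funM => //; exact: measurable_coord_rV.
Qed.

Lemma integral_isometry (f : 'rV[R]_n -> 'rV[R]_n) (T : set 'rV[R]_n)
    (g : 'rV[R]_n -> \bar R) :
  (forall x y, f (x + y) = f x + f y) -> involutive f ->
  (forall x, enorm (f x) = enorm x) ->
  (forall i, measurable_fun setT (fun x => f x 0 i)) -> measurable T ->
  measurable_fun setT g ->
  (\int[L]_(x in T) g x = \int[L]_(x in [set x | T (f x)]) g (f x))%E.
Proof.
move=> fD fK fI mf mT mg; have mf' := measurable_fun_rV mf.
have H (h : 'rV[R]_n -> \bar R) : measurable_fun setT h -> (forall x, 0 <= h x)%E ->
    (\int[L]_(x in T) h x = \int[L]_(x in [set x | T (f x)]) h (f x))%E.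
  move=> mh h0; rewrite -[RHS](@ge0_integral_pushforward _ _ _ _ _ _ mf' L T h)//.
    apply: eq_measure_integral => A mA _; apply/esym.
    by rewrite -[RHS](lebesgue_rV_isometry fD fK fI mf mA).
  exact: measurable_funTS.
rewrite [LHS]integralE [RHS]integralE.
have -> : ((fun x => g (f x))^\+ = g^\+ \o f)%E by exact: funepos_comp.
have -> : ((fun x => g (f x))^\- = g^\- \o f)%E by exact: funeneg_comp.
by rewrite !H//; [exact: measurable_funeneg|exact: measurable_funepos].
Qed.

Lemma integral_scale (l : R) (T : set 'rV[R]_n) (g : 'rV[R]_n -> \bar R) :
  0 < l -> measurable T -> measurable_fun setT g ->
  (\int[L]_(x in T) g x =
   (l ^+ n)%:E * \int[L]_(x in [set x | T (l *: x)]) g (l *: x)%R)%E.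
Proof.
move=> l0 mT mg.
have mf : measurable_fun setT ( *:%R l : 'rV[R]_n -> 'rV[R]_n).
  by apply: measurable_fun_rV => i; exact: measurable_scale_rV.
have ln0 : 0 <= l ^+ n by rewrite exprn_ge0// ltW.
have H (h : 'rV[R]_n -> \bar R) : measurable_fun setT h -> (forall x, 0 <= h x)%E ->
    (\int[L]_(x in T) h x = (l ^+ n)%:E * \int[L]_(x in [set x | T (l *: x)]) h (l *: x)%R)%E.
  move=> mh h0; rewrite -[X in (_ * X)%E](@ge0_integral_pushforward _ _ _ _ _ _ mf L T h)//; last first.
    exact: measurable_funTS.
  rewrite -(@ge0_integral_mscale _ _ _ _ T mT (NngNum ln0))//; last exact: measurable_funTS.
  apply: eq_measure_integral => A mA _.
  by rewrite /mscale/= /pushforward -(lebesgue_rV_scale l0 mA) muleC.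
rewrite [LHS]integralE [in RHS]integralE.
have -> : ((fun x => g (l *: x)%R)^\+ = g^\+ \o *:%R l)%E by exact: funepos_comp.
have -> : ((fun x => g (l *: x)%R)^\- = g^\- \o *:%R l)%E by exact: funeneg_comp.
rewrite !H//; [|exact: measurable_funeneg|exact: measurable_funepos].
have k0 : 0 < l ^+ n by rewrite exprn_gt0.
have EN (a b : \bar R) : ((l ^+ n)%:E * a - (l ^+ n)%:E * b = (l ^+ n)%:E * (a - b))%E.
  case: a => [a||]; case: b => [b||]//=;
  rewrite ?(gt0_muley, gt0_muleNy, lte_fin)//= ?(gt0_muley, gt0_muleNy, lte_fin)//.
  by rewrite -!EFinM -!EFinB -mulrBr.
exact: EN.
Qed.

End change_of_variables.

(** * Integration against the fractional kernel *)

Section geometric_integral.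
Context (R : realType) (n : nat).
Local Notation L := (lebesgue_rV R n).

(** If [f] is multiplied by [th < 1] under dilation by [l], Jacobian included,
    its integrals over the successive dilates of the shell [S0] form a geometric
    series. [S k] is the union of the first [k] of them. *)
Lemma geometric_integral (f : 'rV[R]_n -> R) (S : nat -> set 'rV[R]_n)
    (S0 : set 'rV[R]_n) (l th B : R) :
  0 < l -> 0 < th < 1 -> 0 <= B -> (forall z, 0 <= f z) -> measurable_fun setT f ->
  (forall z, f (l *: z) * l ^+ n = th * f z) ->
  (forall k, measurable (S k)) -> measurable S0 -> nondecreasing_seq S ->
  S 0%N = set0 ->
  (forall k, S k.+1 `<=` S0 `|` [set z | S k (l^-1 *: z)]) ->
  (forall k, [disjoint S0 & [set z | S k (l^-1 *: z)]]) ->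
  (\int[L]_(z in S0) (f z)%:E <= B%:E)%E ->
  (\int[L]_(z in \bigcup_k S k) (f z)%:E <= (B / (1 - th))%:E)%E.
Proof.
move=> l0 /andP[th0 th1] B0 f0 mf fl mS mS0 ndS SE Sincl Sdisj fB.
have l1 : 0 < l^-1 by rewrite invr_gt0.
have mf' : measurable_fun setT (EFin \o f) by apply/measurable_EFinP.
have mlS k : measurable [set z | S k (l^-1 *: z)].
  by apply: (@measurable_preimage_rV _ _ 'rV[R]_n _ _ _ _ (mS k)) => i; exact: measurable_scale_rV.
have bnd k : (\int[L]_(z in S k) (f z)%:E <= (B / (1 - th))%:E)%E.
  elim: k => [|k IH]; first by rewrite SE integral_set0 lee_fin divr_ge0// subr_ge0 ltW.
  apply: (@le_trans _ _ (\int[L]_(z in S0 `|` [set z | S k (l^-1 *: z)]) (f z)%:E)%E).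
    apply: ge0_subset_integral => //; first exact: measurableU.
      exact: measurable_funTS.
    by move=> x _; rewrite lee_fin.
  rewrite ge0_integral_setU//; last 2 first.
  - exact: measurable_funTS.
  - by move=> x _; rewrite lee_fin.
  rewrite [X in (_ + X)%E](_ : _ = (th%:E * \int[L]_(z in S k) (f z)%:E)%E).
    apply: (@le_trans _ _ (B%:E + th%:E * (B / (1 - th))%:E)%E).
      by rewrite leeD// lee_wpmul2l// lee_fin ltW.
    rewrite -EFinM -EFinD lee_fin le_eqVlt; apply/orP; left; apply/eqP.
    by field; rewrite subr_eq0 gt_eqF.
  rewrite (integral_scale l0 (mlS k) mf')/=.
  rewrite (_ : [set x | _] = S k); last first.
    by apply/seteqP; split => z /=; rewrite scalerA mulVf ?scale1r// gt_eqF.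
  have mfl : measurable_fun (S k) (fun z => (f (l *: z))%:E).
    apply: measurable_funTS; apply: (measurableT_comp mf').
    by apply: measurable_fun_rV => i; exact: measurable_scale_rV.
  rewrite -ge0_integralZl_EFin//; last 2 first.
  - by move=> x _; rewrite lee_fin.
  - by rewrite exprn_ge0// ltW.
  rewrite -ge0_integralZl_EFin//; last 3 first.
  - by move=> x _; rewrite lee_fin.
  - exact: measurable_funTS.
  - exact: ltW.
  by apply: eq_integral => z _; rewrite -!EFinM mulrC fl.
have := @ge0_nondecreasing_set_cvg_integral _ _ _ S (EFin \o f) L ndS mS.
move=> /(_ _ _)/cvg_lim <-//; last 2 first.
- by move=> i; exact: measurable_funTS.
- by move=> i x _; rewrite lee_fin.
apply: lime_le; last by apply: nearW.
apply: ereal_nondecreasing_is_cvgn.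
apply: ge0_nondecreasing_set_nondecreasing_integral => //.
- by move=> i; exact: measurable_funTS.
- by move=> i x _; rewrite lee_fin.
Qed.

End geometric_integral.

Lemma exists_pow2 (R : realType) (x : R) : exists k, x < 2 ^+ k.
Proof.
by exists (Num.bound x); exact: Num.Theory.upper_nthrootP.
Qed.

Section kernel.
Context (R : realType) (N : nat) (s : R).
Local Notation L := (lebesgue_rV R N).
Implicit Types (T : set 'rV[R]_N) (f g : 'rV[R]_N -> R).

Definition kern (z : 'rV[R]_N) : R :=
  frac_const N s / enorm z `^ (N%:R + 2 * s).

Definition kintegrable T f := L.-integrable T (EFin \o (fun z => f z * kern z)).

(** The size of a second difference at [z]: quadratic near the origin, and at
    most linear at infinity, where it bounds first-order terms. *)
Definition esize (z : 'rV[R]_N) : R := Num.min (enorm z ^+ 2) (enorm z).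

Lemma mu_intE T f : mu_int s T f = \int[L]_(z in T) (f z * kern z).
Proof. by []. Qed.

Lemma measurable_kern : measurable_fun setT kern.
Proof.
apply: measurable_funM => //.
under eq_fun do rewrite -powRN.
by apply: (measurableT_comp (measurable_powR _)); exact: measurable_enorm.
Qed.

Lemma measurable_esize : measurable_fun setT esize.
Proof.
apply: measurable_minr; last exact: measurable_enorm.
by apply: measurable_funX; exact: measurable_enorm.
Qed.

Lemma kern_enorm y z : enorm y = enorm z -> kern y = kern z.
Proof. by rewrite /kern => ->. Qed.

Lemma kern_scale l z : 0 < l ->
  kern (l *: z) = l `^ (- (N%:R + 2 * s)) * kern z.
Proof.
move=> l0; rewrite /kern enormZ (gtr0_norm l0) powRM ?enorm_ge0 ?(ltW l0)//.
by rewrite powRN invfM mulrCA mulrA.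
Qed.

Lemma kern_scaleX l z : 0 < l ->
  kern (l *: z) * l ^+ N = l `^ (- (2 * s)) * kern z.
Proof.
move=> l0; have l0' : l != 0 by rewrite gt_eqF.
rewrite kern_scale// opprD powRD ?l0' ?implybT//.
rewrite (powRN _ N%:R) powR_mulrn ?ltW//.
have lN : l ^+ N != 0 by rewrite expf_neq0 ?gt_eqF.
by field.
Qed.

Hypothesis C0 : 0 < frac_const N s.
Hypothesis hs : 1 / 2 < s < 1.

Lemma kern_ge0 z : 0 <= kern z.
Proof. by rewrite divr_ge0 ?powR_ge0 ?ltW. Qed.

Lemma kern_gt0 z : z != 0 -> 0 < kern z.
Proof. by move=> z0; rewrite divr_gt0// powR_gt0// enorm_gt0. Qed.

Lemma esize_ge0 z : 0 <= esize z.
Proof. by rewrite le_min sqr_ge0 enorm_ge0. Qed.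

Lemma measurable_enorm_between (a b : R) :
  measurable [set z : 'rV[R]_N | a < enorm z <= b].
Proof.
rewrite -[X in measurable X]setTI.
by have /(_ measurableT `]a, b]%classic (measurable_itv _)) := @measurable_enorm R N.
Qed.

Lemma measurable_shell (a : R) : measurable (shell a : set 'rV[R]_N).
Proof.
rewrite (_ : shell a = setT `&` (@enorm R N) @^-1` `]a, +oo[%classic).
  exact: measurable_enorm.
by apply/seteqP; split => z; rewrite /shell/= in_itv/= andbT => // -[].
Qed.

Let integral_annulus (g : 'rV[R]_N -> R) (a b M : R) : 0 < a ->
  measurable_fun setT g -> (forall z, 0 <= g z) ->
  (forall z, a < enorm z <= b -> g z <= M) ->
  exists2 B, 0 <= B & (\int[L]_(z in [set z | (a < enorm z <= b)%R]) (g z)%:E <= B%:E)%E.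
Proof.
move=> a0 mg g0 gM; set A := [set z | _].
have mA : measurable A by exact: measurable_enorm_between.
have LA : L A \is a fin_num.
  rewrite ge0_fin_numE//; apply: (@le_lt_trans _ _ (L [set v | enorm v < b + 1])).
    apply: le_measure; rewrite ?inE//.
      exact: measurable_enorm_lt.
    by move=> z /= /andP[_ zb]; rewrite (le_lt_trans zb)// ltrDl.
  by rewrite -ge0_fin_numE//; exact: lebesgue_rV_ball_lty.
exists (`|M| * fine (L A)); first by rewrite mulr_ge0// fine_ge0.
rewrite EFinM fineK// -integral_cst//.
apply: ge0_le_integral => //.
- by move=> z _; rewrite lee_fin.
- by apply/measurable_EFinP; exact: measurable_funTS.
- by move=> z zA; rewrite lee_fin (le_trans (gM z zA))// ler_norm.
Qed.

Let kern_annulus_le (a b : R) z : 0 < a -> a < enorm z <= b ->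
  kern z <= frac_const N s / a `^ (N%:R + 2 * s).
Proof.
move=> a0 /andP[az zb]; rewrite /kern ler_wpM2l ?(ltW C0)// lef_pV2 ?posrE ?powR_gt0//.
  apply: ge0_ler_powR; rewrite ?nnegrE ?enorm_ge0 ?(ltW a0) ?(ltW az)//.
  by have := ler0n R N; case/andP: hs; lra.
exact: lt_trans az.
Qed.

Let mek : measurable_fun setT (fun z : 'rV[R]_N => enorm z * kern z).
Proof. by apply: measurable_funM; [exact: measurable_enorm|exact: measurable_kern]. Qed.

Let me2k : measurable_fun setT (fun z : 'rV[R]_N => enorm z ^+ 2 * kern z).
Proof.
apply: measurable_funM; last exact: measurable_kern.
by apply: measurable_funX; exact: measurable_enorm.
Qed.

(** Away from the origin, dilating by 2 multiplies [enorm z * kern z dz] by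
    [2 ^ (1 - 2 s) < 1]: the dyadic shells form a convergent geometric series. *)
Let int_far :
  (\int[L]_(z in [set z | (1 < enorm z)%R]) (enorm z * kern z)%:E < +oo)%E.
Proof.
have [B B0 HB] : exists2 B, 0 <= B &
    (\int[L]_(z in [set z | (1 < enorm z <= 2)%R]) (enorm z * kern z)%:E <= B%:E)%E.
  apply: (@integral_annulus _ 1 2 (2 * (frac_const N s / 1 `^ (N%:R + 2 * s)))) => //.
    by move=> z; rewrite mulr_ge0 ?enorm_ge0 ?kern_ge0.
  move=> z z2; rewrite ler_pM ?enorm_ge0 ?kern_ge0 ?(kern_annulus_le _ z2)//.
  by case/andP: z2.
pose S k := [set z : 'rV[R]_N | 1 < enorm z <= 2 ^+ k].
rewrite (_ : [set z | _] = \bigcup_k S k); last first.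
  apply/seteqP; split => z /=; last by move=> [k _ /andP[]].
  move=> z1; have [k] := exists_pow2 (enorm z).
  by move=> /ltW zk; exists k => //; rewrite /S/= z1.
apply: (@le_lt_trans _ _ (B / (1 - 2 `^ (1 - 2 * s)))%:E); last exact: ltry.
apply: (@geometric_integral _ _ (fun z => enorm z * kern z) S
    [set z : 'rV[R]_N | 1 < enorm z <= 2] 2) => //.
- rewrite powR_gt0//=; case/andP: hs => s1 _.
  by rewrite -[ltRHS](powRr0 2) /powR gt_eqF// ltr_expR ltr_pM2r ?ln_gt0 ?ltr1n//; lra.
- by move=> z; rewrite mulr_ge0 ?enorm_ge0 ?kern_ge0.
- move=> z; rewrite -mulrA kern_scaleX// enormZ gtr0_norm// powRD ?pnatr_eq0 ?implybT//.
  by rewrite powRr1//; ring.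
- by move=> k; exact: measurable_enorm_between.
- exact: measurable_enorm_between.
- apply/nondecreasing_seqP => k; apply/subsetPset => z /= /andP[z1 zk].
  by rewrite /S/= z1 (le_trans zk)// ler_weXn2l// ler1n.
- by apply/seteqP; split => z //=; rewrite /S/= expr0 => /andP[z1 /le_lt_trans/(_ z1)]; rewrite ltxx.
- move=> k z /= /andP[z1 zk]; have [z2|z2] := leP (enorm z) 2; [left|right] => /=.
    by apply/andP; split.
  rewrite /S/= enormZ ger0_norm ?invr_ge0// ltr_pdivlMl// mulr1 z2/=.
  by rewrite ler_pdivrMl// -exprS.
- move=> k; apply/disj_setPS => z /= [/andP[_ z2]]; rewrite /S/=.
  rewrite enormZ ger0_norm ?invr_ge0// ltr_pdivlMl// mulr1 => /andP[z2' _].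
  by have := le_lt_trans z2 z2'; rewrite ltxx.
Qed.

(** Dilating by 1/2, the factor is now [2 ^ (2 s - 2) < 1]. *)
Let int_near :
  (\int[L]_(z in [set z | (0 < enorm z <= 1)%R]) (enorm z ^+ 2 * kern z)%:E < +oo)%E.
Proof.
have h0 : 0 < 2^-1 :> R by rewrite invr_gt0.
have [B B0 HB] : exists2 B, 0 <= B &
    (\int[L]_(z in [set z | (2^-1 < enorm z <= 1)%R]) (enorm z ^+ 2 * kern z)%:E <= B%:E)%E.
  apply: (@integral_annulus _ 2^-1 1 (1 * (frac_const N s / 2^-1 `^ (N%:R + 2 * s)))) => //.
    by move=> z; rewrite mulr_ge0 ?sqr_ge0 ?kern_ge0.
  move=> z z2; rewrite ler_pM ?sqr_ge0 ?kern_ge0 ?(kern_annulus_le _ z2)//.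
  by rewrite expr_le1 ?enorm_ge0//; case/andP: z2.
pose S k := [set z : 'rV[R]_N | 2^-1 ^+ k < enorm z <= 1].
rewrite (_ : [set z | _] = \bigcup_k S k); last first.
  apply/seteqP; split => z /=.
    move=> /andP[z0 z1]; have [k] := exists_pow2 (enorm z)^-1.
    move=> zk; exists k => //; rewrite /S/= z1 andbT exprVn.
    by rewrite -[ltRHS]invrK ltf_pV2 ?posrE ?invr_gt0 ?exprn_gt0.
  by move=> [k _ /andP[zk ->]]; rewrite andbT (lt_trans _ zk)// exprn_gt0.
apply: (@le_lt_trans _ _ (B / (1 - 2^-1 `^ (2 - 2 * s)))%:E); last exact: ltry.
apply: (@geometric_integral _ _ (fun z => enorm z ^+ 2 * kern z) S
    [set z : 'rV[R]_N | 2^-1 < enorm z <= 1] 2^-1) => //.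
- rewrite powR_gt0//=; case/andP: hs => _ s1.
  rewrite -[ltRHS](powRr0 2^-1) /powR gt_eqF// ltr_expR ltr_nM2r; first by lra.
  by rewrite lnV ?posrE// oppr_lt0 ln_gt0 ?ltr1n.
- by move=> z; rewrite mulr_ge0 ?sqr_ge0 ?kern_ge0.
- move=> z; rewrite -mulrA kern_scaleX// enormZ gtr0_norm//.
  rewrite powRD; last by rewrite invr_eq0 pnatr_eq0 implybT.
  by rewrite exprMn (powR_mulrn 2)// ?ltW//; ring.
- by move=> k; exact: measurable_enorm_between.
- exact: measurable_enorm_between.
- apply/nondecreasing_seqP => k; apply/subsetPset => z /= /andP[zk z1].
  rewrite /S/= z1 andbT (le_lt_trans _ zk)//.
  by rewrite exprS ger_pMl ?exprn_gt0// invf_le1// ler1n.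
- by apply/seteqP; split => z //=; rewrite /S/= expr0 => /andP[z1 /le_lt_trans/(_ z1)]; rewrite ltxx.
- move=> k z /= /andP[zk z1]; have [z2|z2] := ltP 2^-1 (enorm z); [left|right] => /=.
    exact: z1.
  rewrite invrK /S/= enormZ gtr0_norm// -ler_pdivlMl// mulr1 z2 andbT.
  by rewrite -ltr_pdivrMl// -exprS.
- move=> k; apply/disj_setPS => z /= [/andP[z2 _]]; rewrite /S/=.
  rewrite invrK enormZ gtr0_norm// -ler_pdivlMl// mulr1 => /andP[_ z2'].
  by have := le_lt_trans z2' z2; rewrite ltxx.
Qed.

(** This is where both bounds on [s] enter: [s < 1] makes [|z|^2] integrable near
    the origin, and [s > 1/2] makes [|z|] integrable at infinity. *)
Lemma kintegrable_esize : kintegrable setT esize.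
Proof.
have mek' : measurable_fun setT (fun z => esize z * kern z).
  by apply: measurable_funM; [exact: measurable_esize|exact: measurable_kern].
apply/integrableP; split; first exact/measurable_EFinP.
set A := [set z : 'rV[R]_N | 0 < enorm z <= 1].
set B := [set z : 'rV[R]_N | 1 < enorm z].
have mA : measurable A by exact: measurable_enorm_between.
have mB : measurable B by exact: measurable_shell.
pose gA : 'rV[R]_N -> \bar R := fun z => (enorm z ^+ 2 * kern z)%:E.
pose gB : 'rV[R]_N -> \bar R := fun z => (enorm z * kern z)%:E.
have gA0 z : (0 <= gA z)%E by rewrite lee_fin mulr_ge0 ?sqr_ge0 ?kern_ge0.
have gB0 z : (0 <= gB z)%E by rewrite lee_fin mulr_ge0 ?enorm_ge0 ?kern_ge0.
have mgA : measurable_fun setT gA by apply/measurable_EFinP.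
have mgB : measurable_fun setT gB by apply/measurable_EFinP.
apply: (@le_lt_trans _ _ (\int[L]_(z in A) gA z + \int[L]_(z in B) gB z)%E).
  rewrite (integral_mkcond A) (integral_mkcond B) -ge0_integralD//; last 4 first.
  - by move=> z _; apply: erestrict_ge0.
  - by apply/(measurable_restrictT gA mA); exact: measurable_funTS.
  - by move=> z _; apply: erestrict_ge0.
  - by apply/(measurable_restrictT gB mB); exact: measurable_funTS.
  apply: ge0_le_integral => //.
  - by apply: measurableT_comp => //; exact/measurable_EFinP.
  - apply: emeasurable_funD.
      by apply/(measurable_restrictT gA mA); exact: measurable_funTS.
    by apply/(measurable_restrictT gB mB); exact: measurable_funTS.
  move=> z _ /=; rewrite ger0_norm; last first.
    by apply: mulr_ge0; [exact: esize_ge0|exact: kern_ge0].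
  have [->|z0] := eqVneq z 0.
    rewrite /esize enorm0 expr0n/= minxx mul0r.
    by apply: adde_ge0; exact: erestrict_ge0.
  rewrite !patchE; have [z1|z1] := ltP 1 (enorm z).
    rewrite (mem_set (z1 : B z)) memNset; last by rewrite /A/= => /andP[_]; rewrite leNgt z1.
    by rewrite add0e lee_fin ler_wpM2r ?kern_ge0// ge_min lexx orbT.
  rewrite (@memNset _ B); last by rewrite /B/= => /lt_le_trans/(_ z1); rewrite ltxx.
  rewrite mem_set; last by rewrite /A/= enorm_gt0 z0.
  by rewrite adde0 lee_fin ler_wpM2r ?kern_ge0// ge_min lexx.
exact: lte_add_pinfty.
Qed.

Lemma kintegrable_dom T f K : measurable T -> measurable_fun setT f ->
  (forall z, T z -> `|f z| <= K * esize z) -> kintegrable T f.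
Proof.
move=> mT mf fK.
have iT : L.-integrable T (EFin \o (fun z => K * (esize z * kern z))).
  apply: (@integrableS _ _ _ _ setT) => //.
  by have := integrableZl measurableT K kintegrable_esize; apply: eq_integrable.
apply: (le_integrable mT _ _ iT) => /=.
  apply/measurable_EFinP/measurable_funTS.
  by apply: measurable_funM => //; exact: measurable_kern.
move=> z Tz; rewrite lee_fin mulrA (normrM (f z)) (normrM (K * esize z)).
by rewrite ler_wpM2r// (le_trans (fK z Tz))// ler_norm.
Qed.

Lemma kintegrableS T T' f : measurable T -> measurable T' -> T' `<=` T ->
  kintegrable T f -> kintegrable T' f.
Proof. by move=> mT mT' TT' iT; exact: integrableS iT. Qed.

Lemma kintegrableD T f g : measurable T -> kintegrable T f -> kintegrable T g ->
  kintegrable T (fun z => f z + g z).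
Proof.
move=> mT fi gi; apply: eq_integrable (integrableD mT fi gi) => // z _ /=.
by rewrite -EFinD mulrDl.
Qed.

Lemma kintegrableZ T f a : measurable T -> kintegrable T f ->
  kintegrable T (fun z => a * f z).
Proof.
move=> mT fi; apply: eq_integrable (integrableZl mT a fi) => // z _ /=.
by rewrite -EFinM mulrA.
Qed.

Lemma mu_intD T f g : measurable T -> kintegrable T f -> kintegrable T g ->
  mu_int s T (fun z => f z + g z) = mu_int s T f + mu_int s T g.
Proof.
move=> mT fi gi; rewrite !mu_intE -RintegralD//.
by apply: eq_Rintegral => z _; rewrite mulrDl.
Qed.

Lemma mu_intZ T f a : measurable T -> kintegrable T f ->
  mu_int s T (fun z => a * f z) = a * mu_int s T f.
Proof.
move=> mT fi; rewrite !mu_intE -RintegralZl//.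
by apply: eq_Rintegral => z _; rewrite mulrA.
Qed.

Lemma mu_int_le T f g : measurable T -> kintegrable T f -> kintegrable T g ->
  (forall z, T z -> f z <= g z) -> mu_int s T f <= mu_int s T g.
Proof.
move=> mT fi gi fg; rewrite !mu_intE; apply: le_Rintegral => // z Tz.
by rewrite ler_wpM2r ?kern_ge0// fg.
Qed.

Lemma eq_mu_int T f g : (forall z, T z -> f z = g z) -> mu_int s T f = mu_int s T g.
Proof.
by move=> fg; rewrite !mu_intE; apply: eq_Rintegral => z /[!inE] Tz; rewrite fg.
Qed.

Lemma mu_int_ge0 T f : (forall z, T z -> 0 <= f z) -> 0 <= mu_int s T f.
Proof.
move=> f0; rewrite mu_intE; apply: Rintegral_ge0 => z Tz.
by rewrite mulr_ge0 ?kern_ge0 ?f0.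
Qed.

Lemma mu_int_isometry (h : 'rV[R]_N -> 'rV[R]_N) T f :
  (forall x y, h (x + y) = h x + h y) -> involutive h ->
  (forall x, enorm (h x) = enorm x) ->
  (forall i, measurable_fun setT (fun x => h x 0 i)) -> measurable T ->
  measurable_fun setT f ->
  mu_int s T f = mu_int s [set z | T (h z)] (fun z => f (h z)).
Proof.
move=> hD hK hI mh mT mf; rewrite !mu_intE /Rintegral.
rewrite (integral_isometry hD hK hI mh mT); last first.
  apply/measurable_EFinP; apply: measurable_funM => //; exact: measurable_kern.
apply: (congr1 (@fine R)); apply: eq_integral => z _.
by rewrite (kern_enorm (hI z)).
Qed.

Lemma mu_int_scale l T f : 0 < l -> measurable T -> measurable_fun setT f ->
  kintegrable [set z | T (l *: z)] (fun z => f (l *: z)) ->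
  mu_int s T f = l `^ (- (2 * s)) *
    mu_int s [set z | T (l *: z)] (fun z => f (l *: z)).
Proof.
move=> l0 mT mf fi.
have mT' : measurable [set z | T (l *: z)].
  apply: (@measurable_preimage_rV _ _ 'rV[R]_N _ _ _ _ mT) => i.
  exact: measurable_scale_rV.
rewrite !mu_intE /Rintegral (integral_scale l0 mT); last first.
  by apply/measurable_EFinP; apply: measurable_funM => //; exact: measurable_kern.
rewrite [X in (_ * X)%E](_ : _ = (l `^ (- (N%:R + 2 * s)))%:E *
    \int[L]_(z in [set z | T (l *: z)]) (f (l *: z) * kern z)%:E)%E; last first.
  rewrite -integralZl//; apply: eq_integral => z _.
  by rewrite /= kern_scale// -EFinM mulrCA.
have fin := integrable_fin_num mT' fi.
rewrite muleA -EFinM fineM//; apply: (congr1 ( *%R^~ _)).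
have l0' : l != 0 by rewrite gt_eqF.
rewrite opprD powRD; last by rewrite l0' implybT.
rewrite (powRN _ N%:R) powR_mulrn ?ltW// mulrA divff ?mul1r//.
by rewrite expf_neq0.
Qed.

End kernel.

(** * Mass and drift of truncated cones *)

Section cones.
Context (R : realType) (N : nat) (s c : R).
Hypotheses (N0 : (0 < N)%N) (C0 : 0 < frac_const N s) (hs : 1 / 2 < s < 1)
  (hc : 0 <= c < 1).
Local Notation L := (lebesgue_rV R N).
Implicit Types (x y z : 'rV[R]_N) (f g : 'rV[R]_N -> R) (eps : R).

Lemma open_cone y : open (opencone c y).
Proof.
rewrite (_ : opencone c y = (fun z => dotv y z - c * enorm z) @^-1` [set r | 0 < r]).
  apply: open_comp; last exact: open_gt.
  move=> z _; apply: (@cvgB _ _ _ (nbhs z)); first exact: (@continuous_dotv _ _ y z).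
  apply: (@cvgM _ _ (nbhs z)); first exact: cvg_cst.
  exact: (@continuous_enorm _ _ z).
by apply/seteqP; split => z; rewrite /opencone/= subr_gt0.
Qed.

Lemma open_shell a : open (shell a : set 'rV[R]_N).
Proof.
apply: (@open_comp _ _ (@enorm R N) [set r | a < r]); last exact: open_gt.
by move=> z _; exact: (@continuous_enorm _ _ z).
Qed.

Definition conetail eps y : set 'rV[R]_N := opencone c y `&` shell eps.

Lemma open_conetail eps y : open (conetail eps y).
Proof. by apply: openI; [exact: open_cone|exact: open_shell]. Qed.

Lemma measurable_conetail eps y : measurable (conetail eps y).
Proof. by apply: open_measurable_rV; exact: open_conetail. Qed.
Hint Resolve measurable_conetail : core.

Lemma stdbasis_unit : unit_sphere (stdbasis 0 : 'rV[R]_N).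
Proof.
rewrite /unit_sphere/= /enorm /dotv; case: N N0 => // n _.
rewrite (bigD1 ord0)//= big1.
  by rewrite addr0 !mxE/= mulr1 sqrtr1.
by move=> i; rewrite -val_eqE/= !mxE => /negPf ->; rewrite mul0r.
Qed.

Lemma lebesgue_open_gt0 (U : set 'rV[R]_N) x : open U -> U x -> (0 < L U)%E.
Proof.
move=> oU Ux; have /nbhs_ballP[r /= r0 rU] : nbhs x U by exact: open_nbhs_nbhs.
apply: (lt_le_trans (lebesgue_rV_ball_gt0 N r0)).
have mU := open_measurable_rV oU.
rewrite -(lebesgue_rV_translate x mU).
apply: le_measure; rewrite ?inE.
- exact: measurable_enorm_lt.
- apply: (measurable_preimage_rV _ mU) => i; under eq_fun do rewrite mxE.
  by apply: measurable_funD => //; exact: measurable_coord_rV.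
- move=> v /= vr; apply: rU; rewrite -ball_normE/= opprD addrCA subrr addr0 normrN.
  exact: le_lt_trans (normr_le_enorm v) vr.
Qed.

Lemma mu_int_gt0 (T : set 'rV[R]_N) f : measurable T -> (0 < L T)%E ->
  kintegrable s T f -> (forall z, T z -> z != 0 /\ 0 < f z) -> 0 < mu_int s T f.
Proof.
move=> mT LT fi f0; rewrite lt_neqAle mu_int_ge0//; last by move=> z /f0[_ /ltW].
rewrite andbT; apply/negP => /eqP/esym I0.
have [mf _] := integrableP _ _ _ fi.
have I1 : (\int[L]_(z in T) `|(f z * kern s z)%:E| = 0)%E.
  transitivity (\int[L]_(z in T) (f z * kern s z)%:E)%E.
    apply: eq_integral => z /[!inE] /f0[z0 fz].
    by rewrite gee0_abs// lee_fin ltW// mulr_gt0// kern_gt0.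
  by rewrite -(fineK (integrable_fin_num mT fi)); apply: (congr1 EFin).
have [Z [mZ LZ TZ]] := (ae_eq_integral_abs L mT mf).1 I1.
have : (L T <= L Z)%E.
  apply: le_measure; rewrite ?inE// => z Tz; apply: TZ => /= /(_ Tz) [].
  by apply/eqP; rewrite gt_eqF// mulr_gt0 ?kern_gt0//; have [] := f0 z Tz.
by rewrite LZ leNgt LT.
Qed.

Lemma conetail_neq0 eps y z : conetail eps y z -> z != 0.
Proof.
move=> [yz _]; apply: contraPneq yz => ->.
by rewrite /opencone/= dotv0 enorm0 mulr0 ltxx.
Qed.

Lemma conetail_nonempty eps y : unit_sphere y ->
  conetail eps y ((`|eps| + 1) *: y).
Proof.
move=> y1; have p0 : 0 < `|eps| + 1 by rewrite ltr_pwDr.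
split; rewrite /shell/opencone/= enormZ gtr0_norm// y1 mulr1.
  rewrite dotvZr -sqr_enorm y1 expr1n mulr1.
  by rewrite gtr_pMl//; case/andP: hc.
by rewrite (le_lt_trans (ler_norm _))// ltrDl.
Qed.

Lemma lebesgue_conetail_gt0 eps y : unit_sphere y -> (0 < L (conetail eps y))%E.
Proof.
move=> y1; exact: lebesgue_open_gt0 (@open_conetail eps y) (conetail_nonempty eps y1).
Qed.

(** This makes functions of at most linear growth integrable on truncated cones. *)
Lemma shell_esize eps z : 0 < eps -> shell eps z ->
  1 <= (1 + eps^-1 + eps ^- 2) * esize z /\
  enorm z <= (1 + eps^-1 + eps ^- 2) * esize z.
Proof.
move=> e0; rewrite /shell/= => ez.
have i0 : 0 < eps^-1 by rewrite invr_gt0.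
have i2 : eps ^- 2 = eps^-1 ^+ 2 by rewrite exprVn.
have ie : eps^-1 * eps = 1 by rewrite mulVf// gt_eqF.
have iz : 1 <= eps^-1 * enorm z by rewrite ler_pdivlMl// mulr1 ltW.
rewrite /esize i2; have [z1|z1] := leP (enorm z ^+ 2) (enorm z).
  split.
    have : 1 <= (eps^-1 * enorm z) ^+ 2 by rewrite exprn_ege1.
    by have := sqr_ge0 (enorm z); nra.
  have : enorm z * 1 <= enorm z * (eps^-1 * enorm z).
    by rewrite ler_wpM2l ?enorm_ge0.
  by have := sqr_ge0 (enorm z); nra.
have z0 : 0 < enorm z by exact: lt_trans ez.
have {}z1 : 1 < enorm z by move: z1; rewrite expr2 ltr_pMr.
by split; nra.
Qed.

Lemma kintegrable_tail_dom eps y f K : 0 < eps -> measurable_fun setT f ->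
  (forall z, `|f z| <= K * (1 + enorm z)) -> kintegrable s (conetail eps y) f.
Proof.
move=> e0 mf fK.
apply: (@kintegrable_dom _ _ _ C0 hs _ _ (2 * `|K| * (1 + eps^-1 + eps ^- 2))) => //.
move=> z [_ /(shell_esize e0)[H1 H2]]; apply: (le_trans (fK z)).
apply: (@le_trans _ _ (`|K| * (1 + enorm z))).
  by rewrite ler_wpM2r ?ler_norm// addr_ge0 ?enorm_ge0.
have := normr_ge0 K; nra.
Qed.

Lemma kintegrable_tail_bounded eps y f K : 0 < eps -> measurable_fun setT f ->
  (forall z, `|f z| <= K) -> kintegrable s (conetail eps y) f.
Proof.
move=> e0 mf fK; apply: (kintegrable_tail_dom (K := K) y e0 mf) => z.
apply: (le_trans (fK z)); rewrite ler_peMr ?(le_trans _ (fK z))//.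
by rewrite lerDl enorm_ge0.
Qed.

Lemma measurable_dotv x : measurable_fun setT (dotv x).
Proof. exact: continuous_measurable_rV (@continuous_dotv R N x). Qed.

Lemma kintegrable_tail_dotv eps y x : 0 < eps ->
  kintegrable s (conetail eps y) (dotv x).
Proof.
move=> e0; apply: (kintegrable_tail_dom (K := enorm x) y e0 (measurable_dotv x)).
move=> z; apply: (le_trans (norm_dotv_le _ _)).
by rewrite ler_wpM2l ?enorm_ge0// lerDr.
Qed.

Lemma kintegrable_tail1 eps y : 0 < eps -> kintegrable s (conetail eps y) (cst 1).
Proof. by move=> e0; apply: (@kintegrable_tail_bounded _ _ _ 1) => // z; rewrite normr1. Qed.

Lemma measurable_reflect v i :
  measurable_fun setT (fun z : 'rV[R]_N => reflect_in v z 0 i).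
Proof.
under eq_fun do rewrite !mxE.
apply: measurable_funB; first exact: measurable_coord_rV.
apply: measurable_funM => //; apply: measurable_funM => //.
exact: measurable_dotv.
Qed.

Lemma conetail_reflect v eps y : unit_sphere v ->
  [set z | conetail eps y (reflect_in v z)] = conetail eps (reflect_in v y).
Proof.
move=> v1; apply/seteqP; split => z;
by rewrite /conetail/opencone/shell/= dotv_reflect enorm_reflect.
Qed.

Lemma mu_int_reflect v eps y f : unit_sphere v -> measurable_fun setT f ->
  mu_int s (conetail eps y) f =
  mu_int s (conetail eps (reflect_in v y)) (fun z => f (reflect_in v z)).
Proof.
move=> v1 mf; rewrite -conetail_reflect//.
apply: mu_int_isometry => //.
- exact: reflectD.
- exact: reflectK.
- by move=> x; rewrite enorm_reflect.
- exact: measurable_reflect.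
Qed.

(** The total mass, and the component along the axis of the first moment, of
    [mu_s] on a truncated cone. The axis [stdbasis 0] stands for all of them. *)
Definition tailmass eps := mu_int s (conetail eps (stdbasis 0)) (cst 1).
Definition taildrift eps := mu_int s (conetail eps (stdbasis 0)) (dotv (stdbasis 0)).

Lemma tailmassE eps y : unit_sphere y ->
  mu_int s (conetail eps y) (cst 1) = tailmass eps.
Proof.
move=> y1; have [->//|ye] := eqVneq y (stdbasis 0).
have e1 := stdbasis_unit.
have v1 : unit_sphere (normalize (stdbasis 0 - y)).
  by apply: unit_normalize; rewrite subr_eq0 eq_sym.
by rewrite (mu_int_reflect eps y v1)//= reflect_swap// eq_sym.
Qed.

Lemma taildriftE eps y : unit_sphere y ->
  mu_int s (conetail eps y) (dotv y) = taildrift eps.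
Proof.
move=> y1; have [->//|ye] := eqVneq y (stdbasis 0).
have e1 := stdbasis_unit.
have v1 : unit_sphere (normalize (stdbasis 0 - y)).
  by apply: unit_normalize; rewrite subr_eq0 eq_sym.
rewrite (mu_int_reflect eps y v1)/=; last exact: measurable_dotv.
rewrite reflect_swap//; last by rewrite eq_sym.
by apply: eq_mu_int => z _; rewrite dotv_reflect reflect_swap// eq_sym.
Qed.

(** The first moment of a truncated cone is a multiple of its axis: the
    reflection along the part of [x] orthogonal to [y] preserves the cone and
    changes the sign of the contribution of that part. *)
Lemma mu_int_dotv eps x y : 0 < eps -> unit_sphere y ->
  mu_int s (conetail eps y) (dotv x) = dotv x y * taildrift eps.
Proof.
move=> e0 y1; pose v := x - dotv x y *: y.
have vy : dotv v y = 0 by rewrite dotvBl dotvZl -sqr_enorm y1 expr1n mulr1 subrr.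
have vint : mu_int s (conetail eps y) (dotv v) = 0.
  have [v0|v0] := eqVneq v 0.
    rewrite v0 (@eq_mu_int _ _ _ _ _ (fun z => 0 * dotv y z)).
      by rewrite mu_intZ ?mul0r//; exact: kintegrable_tail_dotv.
    by move=> z _; rewrite dot0v mul0r.
  have n1 := unit_normalize v0.
  have ny : dotv (normalize v) y = 0 by rewrite dotvZl vy mulr0.
  have := mu_int_reflect eps y n1 (measurable_dotv v).
  rewrite reflect_orth//.
  rewrite (@eq_mu_int _ _ _ _ (fun z => dotv v (reflect_in _ z)) (fun z => -1 * dotv v z)).
    by rewrite mu_intZ//; [lra|exact: kintegrable_tail_dotv].
  move=> z _; rewrite dotv_reflect /reflect_in dotvBl dotvZl mulN1r.
  have -> : dotv (normalize v) v = enorm v.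
    by rewrite dotvZl -sqr_enorm expr2 mulKf// enorm_eq0.
  rewrite dotvZl.
  have n0 : enorm v != 0 by rewrite enorm_eq0.
  by field.
rewrite (@eq_mu_int _ _ _ _ _ (fun z => dotv v z + dotv x y * dotv y z)).
  rewrite mu_intD//; last 2 first.
  - exact: kintegrable_tail_dotv.
  - by apply: kintegrableZ => //; exact: kintegrable_tail_dotv.
  rewrite vint add0r mu_intZ ?taildriftE//; exact: kintegrable_tail_dotv.
by move=> z _; rewrite /v dotvBl dotvZl subrK.
Qed.

Lemma tailmass_gt0 eps : 0 < eps -> 0 < tailmass eps.
Proof.
move=> e0; apply: mu_int_gt0 => //.
- exact: lebesgue_conetail_gt0 stdbasis_unit.
- exact: kintegrable_tail1.
- by move=> z /conetail_neq0.
Qed.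

Lemma cone_dotv_ge0 y z : opencone c y z -> 0 < dotv y z.
Proof.
by apply: le_lt_trans; rewrite mulr_ge0 ?enorm_ge0//; case/andP: hc.
Qed.

Lemma taildrift_gt0 eps : 0 < eps -> 0 < taildrift eps.
Proof.
move=> e0; apply: mu_int_gt0 => //.
- exact: lebesgue_conetail_gt0 stdbasis_unit.
- exact: kintegrable_tail_dotv.
- by move=> z Tz; split; [exact: conetail_neq0 Tz|case: Tz => /cone_dotv_ge0].
Qed.

Lemma conetail_scale l eps y : 0 < l ->
  [set z | conetail eps y (l *: z)] = conetail (eps / l) y.
Proof.
move=> l0; apply/seteqP; split => z;
rewrite /conetail/opencone/shell/= enormZ gtr0_norm// dotvZr ltr_pdivrMr//;
by rewrite mulrCA ltr_pM2l// (mulrC l).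
Qed.

Lemma taildrift_scale eps : 0 < eps ->
  taildrift eps = eps `^ (1 - 2 * s) * taildrift 1.
Proof.
move=> e0.
have e0' : eps != 0 by rewrite gt_eqF.
have E : mu_int s (conetail 1 (stdbasis 0)) (fun z => dotv (stdbasis 0) (eps *: z)) =
    eps * taildrift 1.
  rewrite -mu_intZ//; last exact: kintegrable_tail_dotv.
  by apply: eq_mu_int => z _; rewrite dotvZr.
have I : kintegrable s (conetail 1 (stdbasis 0)) (fun z => dotv (stdbasis 0) (eps *: z)).
  rewrite (_ : (fun z => _) = (fun z => eps * dotv (stdbasis 0) z)).
    by apply: kintegrableZ => //; exact: kintegrable_tail_dotv.
  by apply/funext => z; rewrite dotvZr.
rewrite {1}/taildrift (@mu_int_scale _ _ _ eps)//.
- rewrite conetail_scale// divff// E mulrA powRD ?e0' ?implybT// powRr1 ?ltW//.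
  by rewrite (mulrC eps).
- exact: measurable_dotv.
- by rewrite conetail_scale// divff.
Qed.

End cones.

(** * The averaging operator and the comparison principle *)

Lemma bounded_fun_ex (T : Type) (R : realType) (f : T -> R) :
  bounded_fun f -> exists K, forall x, `|f x| <= K.
Proof.
move=> [M [_ HM]]; exists (M + 1) => x.
by apply: HM => //; rewrite ltrDl.
Qed.

Section averages.
Context (R : realType) (N : nat) (s alpha : R).
Hypotheses (N0 : (0 < N)%N) (C0 : 0 < frac_const N s) (hs : 1 / 2 < s < 1)
  (hal : 0 < alpha <= pi / 2).
Local Notation c := (cos alpha).
Local Notation T := (conetail c).
Local Notation kint := (kintegrable s).
Implicit Types (x y z : 'rV[R]_N) (u w f g : 'rV[R]_N -> R) (eps K : R).

Lemma cos_aperture : 0 <= c < 1.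
Proof.
case/andP: hal => al0 al2; have pi0 := @pi_gt0 R.
rewrite cos_ge0_pihalf; last by rewrite al2 andbT; lra.
rewrite -[ltRHS]cos0 ltr_cos//= in_itv/= ?lexx; lra.
Qed.
Let hc := cos_aperture.

Definition avg eps u x y := mu_avg s (T eps y) (fun z => u (x + z)).

Lemma avgE eps u x y : unit_sphere y ->
  avg eps u x y = mu_int s (T eps y) (fun z => u (x + z)) / tailmass N s c eps.
Proof. by move=> y1; rewrite /avg /mu_avg tailmassE. Qed.

Lemma averagingE eps u x : 0 < eps ->
  averaging alpha s eps u x =
  2^-1 * (sup [set avg eps u x y | y in unit_sphere] +
          inf [set avg eps u x y | y in unit_sphere]).
Proof.
move=> e0; rewrite /averaging /avg.
suff -> : [set mu_avg s (cone_shell alpha eps%:E +oo y) (fun z => u (x + z)) |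
    y in unit_sphere] =
  [set mu_avg s (T eps y) (fun z => u (x + z)) | y in unit_sphere] by [].
by apply/seteqP; split => _ [y y1 <-]; exists y => //; rewrite cone_shellE// ltW.
Qed.

Lemma measurable_translate u x : measurable_fun setT u ->
  measurable_fun setT (fun z => u (x + z)).
Proof.
move=> mu; apply: (measurableT_comp mu); apply: measurable_fun_rV => i.
under eq_fun do rewrite mxE.
by apply: measurable_funD => //; exact: measurable_coord_rV.
Qed.

Lemma kint_translate u x y eps K : 0 < eps -> measurable_fun setT u ->
  (forall x, `|u x| <= K) -> kint (T eps y) (fun z => u (x + z)).
Proof.
move=> e0 mu uK; apply: (@kintegrable_tail_bounded _ _ _ _ C0 hs _ _ _ K) => //.
exact: measurable_translate.
Qed.

Lemma avg_norm_le eps u x y K : 0 < eps -> measurable_fun setT u ->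
  (forall x, `|u x| <= K) -> unit_sphere y -> `|avg eps u x y| <= K.
Proof.
move=> e0 mu uK y1; have m0 := tailmass_gt0 N0 C0 hs hc e0.
have mT := measurable_conetail c eps y.
have i1 := kintegrable_tail1 c C0 hs y e0.
have iu := kint_translate x y e0 mu uK.
have iK a := kintegrableZ a mT i1.
have E a : mu_int s (T eps y) (fun z => a * cst 1 z) = a * tailmass N s c eps.
  by rewrite mu_intZ// tailmassE.
rewrite avgE// ler_norml ler_pdivlMr// ler_pdivrMr// -!E.
apply/andP; split; apply: (mu_int_le C0) => // z _; rewrite /= mulr1.
  by have := uK (x + z); rewrite ler_norml => /andP[].
by have := uK (x + z); rewrite ler_norml => /andP[].
Qed.

Section bounded.
Variables (eps : R) (u : 'rV[R]_N -> R) (x : 'rV[R]_N) (K : R).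
Hypotheses (e0 : 0 < eps) (mu : measurable_fun setT u)
  (uK : forall x, `|u x| <= K).
Let S := [set avg eps u x y | y in unit_sphere].

Lemma has_sup_avg : has_sup S.
Proof.
split; first by exists (avg eps u x (stdbasis 0)), (stdbasis 0) => //; exact: stdbasis_unit.
by exists K => _ [y y1 <-]; apply: le_trans (ler_norm _) _; exact: avg_norm_le.
Qed.

Lemma has_inf_avg : has_inf S.
Proof.
split; first by exists (avg eps u x (stdbasis 0)), (stdbasis 0) => //; exact: stdbasis_unit.
exists (- K) => _ [y y1 <-]; have := avg_norm_le x e0 mu uK y1.
by rewrite ler_norml => /andP[].
Qed.

Lemma averaging_le a b y0 : (forall y, unit_sphere y -> avg eps u x y <= a) ->
  unit_sphere y0 -> avg eps u x y0 <= b ->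
  averaging alpha s eps u x <= 2^-1 * (a + b).
Proof.
move=> ua y01 ub; rewrite averagingE// ler_pM2l ?invr_gt0// lerD//.
  by apply: ge_sup; [case: has_sup_avg|move=> _ [y y1 <-]; exact: ua].
by apply: le_trans ub; apply: ge_inf; [case: has_inf_avg|exists y0].
Qed.

(** The supremum over the axes need not be attained, but an axis close to it is
    good enough; the infimum is at most the average in the opposite direction. *)
Lemma averaging_near_max tau : 0 < tau -> exists y, [/\ unit_sphere y,
  forall y', unit_sphere y' -> avg eps u x y' <= avg eps u x y + tau &
  averaging alpha s eps u x <= 2^-1 * (avg eps u x y + avg eps u x (- y)) + tau].
Proof.
move=> t0; have [_ [y y1 <-] yS] := sup_adherent t0 has_sup_avg.
exists y; have H y' : unit_sphere y' -> avg eps u x y' <= avg eps u x y + tau.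
  move=> y'1; rewrite -lerBlDr; apply: le_trans (ltW yS); rewrite lerD2r.
  by apply: ub_le_sup; [case: has_sup_avg|exists y'].
split=> //.
apply: (@le_trans _ _ (2^-1 * (avg eps u x y + tau + avg eps u x (- y)))).
  by apply: (averaging_le H (unitN y1)).
by lra.
Qed.

Lemma averaging_norm_le : `|averaging alpha s eps u x| <= K.
Proof.
rewrite averagingE//.
have sK : `|sup S| <= K.
  rewrite ler_norml; apply/andP; split; last first.
    apply: ge_sup; first by case: has_sup_avg.
    by move=> _ [y y1 <-]; apply: le_trans (ler_norm _) _; exact: avg_norm_le.
  have e1 := stdbasis_unit R N0.
  apply: (@le_trans _ _ (avg eps u x (stdbasis 0))).
    by have := avg_norm_le x e0 mu uK e1; rewrite ler_norml => /andP[].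
  by apply: ub_le_sup; [case: has_sup_avg|exists (stdbasis 0)].
have iK : `|inf S| <= K.
  rewrite ler_norml; apply/andP; split.
    apply: lb_le_inf; first by case: has_inf_avg.
    move=> _ [y y1 <-]; have := avg_norm_le x e0 mu uK y1.
    by rewrite ler_norml => /andP[].
  have e1 := stdbasis_unit R N0.
  apply: (@le_trans _ _ (avg eps u x (stdbasis 0))).
    by apply: ge_inf; [case: has_inf_avg|exists (stdbasis 0)].
  by have := avg_norm_le x e0 mu uK e1; rewrite ler_norml => /andP[].
rewrite normrM ger0_norm ?invr_ge0//.
by have := ler_normD (sup S) (inf S); lra.
Qed.

End bounded.

Lemma averaging_leD eps u w x K K' d : 0 < eps -> measurable_fun setT u ->
  measurable_fun setT w -> (forall x, `|u x| <= K) -> (forall x, `|w x| <= K') ->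
  (forall y, unit_sphere y -> avg eps u x y <= avg eps w x y + d) ->
  averaging alpha s eps u x <= averaging alpha s eps w x + d.
Proof.
move=> e0 mu mw uK wK uw; rewrite !averagingE//.
set U := [set avg eps u x y | y in _]; set W := [set avg eps w x y | y in _].
have [supU infU] := (has_sup_avg x e0 mu uK, has_inf_avg x e0 mu uK).
have [supW infW] := (has_sup_avg x e0 mw wK, has_inf_avg x e0 mw wK).
have H1 : sup U <= sup W + d.
  apply: ge_sup; first by case: supU.
  move=> _ [y y1 <-]; apply: le_trans (uw y y1) _; rewrite lerD2r.
  by apply: ub_le_sup; [case: supW|exists y].
have H2 : inf U - d <= inf W.
  apply: lb_le_inf; first by case: infW.
  move=> _ [y y1 <-]; rewrite lerBlDr; apply: le_trans (uw y y1).
  by apply: ge_inf; [case: infU|exists y].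
lra.
Qed.

Lemma mu_intN (T' : set 'rV[R]_N) f :
  mu_int s T' (fun z => - f z) = - mu_int s T' f.
Proof.
rewrite !mu_intE /Rintegral.
set I := lebesgue_rV R N.
pose h := EFin \o (fun z => f z * kern s z).
have -> : (\int[I]_(z in T') (- f z * kern s z)%:E = integral I T' (\- h))%E.
  by apply: eq_integral => z _; rewrite mulNr.
rewrite [in RHS](_ : integral I T' _ = integral I T' h)//.
rewrite integralE [in RHS]integralE funeposN funenegN.
case: (\int[I]_(z in T') _)%E => [a||]; case: (\int[I]_(z in T') _)%E => [b||] //=; rewrite ?oppr0//.
by rewrite opprB.
Qed.

Lemma averagingN eps u x : 0 < eps ->
  averaging alpha s eps (fun z => - u z) x = - averaging alpha s eps u x.
Proof.
move=> e0; rewrite !averagingE//.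
have -> : [set avg eps (fun z => - u z) x y | y in unit_sphere] =
    -%R @` [set avg eps u x y | y in unit_sphere].
  rewrite image_comp; apply: eq_imagel => y _ /=.
  by rewrite /avg /mu_avg mu_intN mulNr.
set S := [set avg eps u x y | y in _].
have S2 : -%R @` (-%R @` S) = S.
  by rewrite image_comp (_ : _ \o _ = id) ?image_id//; apply/funext => r /=; rewrite opprK.
by rewrite /inf S2 -mulrN opprD opprK addrC.
Qed.

Lemma mu_int_shell eps rho y : eps <= rho -> unit_sphere y ->
  mu_int s (T eps y) (\1_(shell rho)) = tailmass N s c rho.
Proof.
move=> erho y1; rewrite -(tailmassE s c N0 rho y1) !mu_intE.
rewrite [RHS](_ : _ = \int[lebesgue_rV R N]_(z in T eps y `&` shell rho) (1 * kern s z)).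
  rewrite [RHS]Rintegral_mkcondr; apply: eq_Rintegral => z _.
  by rewrite patchE indicE; case: (_ \in _); rewrite ?mul1r ?mul0r.
congr (Rintegral _ _ _); apply/seteqP; split => z.
  by move=> [Tz zr]; split=> //; split=> //; exact: le_lt_trans zr.
by move=> [[Tz _] zr].
Qed.

Lemma kint_shell eps rho y : 0 < eps -> kint (T eps y) (\1_(shell rho)).
Proof.
move=> e0; apply: (@kintegrable_tail_bounded _ _ _ _ C0 hs _ _ _ 1) => //.
  by apply: measurable_indic; exact: measurable_shell.
by move=> z; rewrite indicE; case: (_ \in _); rewrite ?normr1 ?normr0.
Qed.

Lemma tailmass_le eps rho : 0 < eps -> eps <= rho ->
  tailmass N s c rho <= tailmass N s c eps.
Proof.
move=> e0 erho; have e1 := stdbasis_unit R N0.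
rewrite -(mu_int_shell erho e1) -(tailmassE s c N0 eps e1).
apply: (mu_int_le C0) => //; first exact: measurable_conetail.
- exact: kint_shell.
- exact: kintegrable_tail1.
- by move=> z _; rewrite indicE; case: (_ \in _).
Qed.

(** A point of the bounded set [D'] leaves it with probability at least
    [tailmass rho / tailmass eps], whichever the axis: a positive maximum of
    [u - w - m] cannot be reproduced by the averages. *)
Lemma comparison (D' : set 'rV[R]_N) eps u w K K' m r : 0 < eps ->
  measurable_fun setT u -> measurable_fun setT w ->
  (forall x, `|u x| <= K) -> (forall x, `|w x| <= K') ->
  (forall x, D' x -> enorm x <= r) ->
  (forall x, D' x -> u x <= averaging alpha s eps u x) ->
  (forall x, D' x -> averaging alpha s eps w x <= w x) ->
  (forall x, ~ D' x -> u x <= w x + m) ->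
  forall x, u x <= w x + m.
Proof.
move=> e0 mu mw uK wK D'r uD wD uw x0; rewrite leNgt; apply/negP => x0m.
pose S := [set u x - w x | x in setT].
have S0 : S !=set0 by exists (u x0 - w x0), x0.
have ubS : has_ubound S.
  exists (K + K') => _ [x _ <-]; apply: lerD.
    exact: le_trans (ler_norm _) (uK x).
  by apply: le_trans (wK x); rewrite -normrN ler_norm.
pose M := sup S.
have uM x : u x - w x <= M by apply: ub_le_sup => //; exists x.
have mM : m < M by apply: lt_le_trans (uM x0); rewrite ltrBrDl.
pose rho := 2 * `|r| + eps + 1.
have rho0 : 0 < rho by rewrite /rho; have := normr_ge0 r; lra.
have erho : eps <= rho by rewrite /rho; have := normr_ge0 r; lra.
have t0 := tailmass_gt0 N0 C0 hs hc e0.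
have tr0 := tailmass_gt0 N0 C0 hs hc rho0.
pose q := tailmass N s c rho / tailmass N s c eps.
have q0 : 0 < q by rewrite divr_gt0.
have key x : D' x -> u x <= w x + (M - (M - m) * q).
  move=> D'x; apply: le_trans (uD x D'x) _.
  apply: le_trans (_ : averaging alpha s eps w x + (M - (M - m) * q) <= _); last first.
    by rewrite lerD2r wD.
  apply: (averaging_leD e0 mu mw uK wK) => y y1; rewrite !avgE//.
  have mT := measurable_conetail c eps y.
  have iu := kint_translate x y e0 mu uK.
  have iw := kint_translate x y e0 mw wK.
  have i1 := kintegrable_tail1 c C0 hs y e0.
  have i1M : kint (T eps y) (fun z => M * cst 1 z) by exact: kintegrableZ.
  have ish : kint (T eps y) (fun z => - (M - m) * \1_(shell rho) z).
    by apply: kintegrableZ => //; exact: kint_shell.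
  have I1 := mu_int_shell erho y1.
  have : mu_int s (T eps y) (fun z => u (x + z)) <=
      mu_int s (T eps y) (fun z => w (x + z)) + (M * tailmass N s c eps - (M - m) * tailmass N s c rho).
    have -> : M * tailmass N s c eps - (M - m) * tailmass N s c rho =
      mu_int s (T eps y) (fun z => M * cst 1 z + - (M - m) * \1_(shell rho) z).
      rewrite mu_intD// !mu_intZ// ?I1 ?tailmassE ?mulNr//.
      exact: kint_shell.
    rewrite -mu_intD//; last exact: kintegrableD.
    apply: (mu_int_le C0) => //.
      by do 2 apply: kintegrableD => //.
    move=> z _; rewrite /= mulr1 indicE; have [zr|zr] := boolP (z \in _).
      have /uw : ~ D' (x + z).
        move=> /D'r xzr; move: zr; rewrite inE /shell/= /rho => zr.
        have := lerB_enorm z x; rewrite (addrC z) => xz.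
        have xr := D'r x D'x; have := ler_norm r; have := normr_ge0 r.
        lra.
      by rewrite mulr1; lra.
    by rewrite mulr0 addr0; have := uM (x + z); lra.
  move=> H; rewrite ler_pdivrMr// mulrDl divfK ?gt_eqF// /q.
  apply: le_trans H _; rewrite lerD2l le_eqVlt; apply/orP; left; apply/eqP.
  by field; rewrite gt_eqF.
have q1 : q <= 1.
  by rewrite ler_pdivrMr// mul1r tailmass_le.
have : M <= M - (M - m) * q.
  apply: ge_sup => // _ [x _ <-]; have [D'x|nD'x] := pselect (D' x).
    by rewrite lerBlDl key.
  by have := uw x nD'x; nra.
have : 0 < (M - m) * q by rewrite mulr_gt0 ?subr_gt0.
by lra.
Qed.

End averages.

(** * Barriers at the boundary *)

Lemma dotv_mulmx (R : realType) N (x y : 'rV[R]_N) : dotv x y = (x *m y^T) 0 0.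
Proof. by rewrite mxE; apply: eq_bigr => i _; rewrite mxE. Qed.

(** The points of a cone that are close to its axis, compared to their distance
    to the vertex, fill balls of all small radii: only this consequence of the
    exterior cone condition is used for the barriers. *)
Lemma exterior_balls (R : realType) N (D : set 'rV[R]_N) : external_cone D ->
  exists kappa t0 : R, [/\ 0 < kappa < 1 / 2, 0 < t0 &
    forall x0, (closure D `\` interior D) x0 ->
      exists2 a, unit_sphere a & forall t, 0 < t <= t0 ->
        forall w, enorm (w - (x0 + t *: a)) <= kappa * t -> ~ D w].
Proof.
move=> [a [th [h [a1 /andP[th0 th2] h0 DS]]]]; have pi0 := @pi_gt0 R.
have ct0 : 0 < cos th by rewrite cos_gt0_pihalf// th2 andbT; lra.
have ct1 : cos th < 1 by rewrite -[ltRHS]cos0 ltr_cos//= in_itv/= ?lexx; lra.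
exists ((1 - cos th) / 2), (h / 2); split => [||x0 /DS[S [SS _] DSx]]; [lra|lra|].
have SS' : S^T *m S = 1%:M by exact: mulmx1C.
have dS (y z : 'rV[R]_N) : dotv (y *m S) (z *m S) = dotv y z.
  by rewrite !dotv_mulmx trmx_mul mulmxA -(mulmxA y) SS mulmx1.
have dST (y z : 'rV[R]_N) : dotv (y *m S^T) (z *m S^T) = dotv y z.
  by rewrite !dotv_mulmx trmx_mul trmxK mulmxA -(mulmxA y) SS' mulmx1.
have nST (y : 'rV[R]_N) : enorm (y *m S^T) = enorm y by rewrite /enorm dST.
exists (a *m S); first by rewrite /unit_sphere/= /enorm dS -/(enorm a).
move=> t /andP[t0 th'] w; set v := w - _ => vt Dw.
pose z := t *: a + v *m S^T.
have wE : w = x0 + z *m S.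
  by rewrite mulmxDl -mulmxA SS' mulmx1 -scalemxAl /v addrA addrC subrK.
apply: (DSx z) => //; last by rewrite -wE.
have zn : enorm z <= t + enorm v.
  by rewrite (le_trans (enormD _ _))// enormZ a1 mulr1 gtr0_norm// nST.
have zd1 : t - enorm v <= dotv a z.
  rewrite dotvDr dotvZr -sqr_enorm a1 expr1n mulr1 lerD2l.
  have := norm_dotv_le a (v *m S^T); rewrite a1 mul1r nST ler_norml => /andP[]; lra.
have zd2 : dotv a z <= t + enorm v.
  rewrite dotvDr dotvZr -sqr_enorm a1 expr1n mulr1 lerD2l.
  have := norm_dotv_le a (v *m S^T); rewrite a1 mul1r nST ler_norml => /andP[]; lra.
have kt : (1 - cos th) / 2 * t < t.
  by rewrite gtr_pMl; [lra|exact: t0].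
right; have z0 : z != 0.
  apply/eqP => z0; move: zd1; rewrite z0 dotv0.
  lra.
split; last lra.
rewrite angle_le//; last by lra.
have : cos th * enorm z <= cos th * (t + enorm v) by rewrite ler_wpM2l// ltW.
have : cos th * enorm v <= enorm v by rewrite ler_piMl ?enorm_ge0// ltW.
have -> : cos th * (t + enorm v) = cos th * t + cos th * enorm v by ring.
have : (1 - cos th) / 2 * t = t / 2 - cos th * t / 2 by field.
lra.
Qed.

(** Young's inequality says that the graph of a concave power lies below its
    tangents. *)
Lemma powR_tangent (R : realType) (b r t : R) : 0 < b < 1 -> 0 < r -> 0 <= t ->
  t `^ b <= r `^ b + b * r `^ (b - 1) * (t - r).
Proof.
move=> /andP[b0 b1] r0 t0.
have tr0 : 0 <= t / r by rewrite divr_ge0// ltW.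
have H : (t / r) `^ b <= b * (t / r) + (1 - b).
  have := @conjugate_powR R ((t / r) `^ b) 1 b^-1 (1 - b)^-1.
  rewrite -powRrM mulfV ?gt_eqF// powRr1// powR1 !invrK mulr1 mul1r (mulrC (t / r) b).
  by apply; rewrite ?powR_ge0 ?invr_gt0 ?subr_gt0//; lra.
have rb0 : 0 < r `^ b by rewrite powR_gt0.
have -> : t `^ b = r `^ b * (t / r) `^ b.
  by rewrite -powRM ?(ltW r0)// mulrCA divff ?mulr1// gt_eqF.
have -> : r `^ b + b * r `^ (b - 1) * (t - r) = r `^ b * (b * (t / r) + (1 - b)).
  have rn0 : r != 0 by rewrite gt_eqF.
  by rewrite powRB ?rn0 ?implybT// powRr1 ?(ltW r0)//; field.
by rewrite ler_pM2l.
Qed.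

Section barrier.
Context (R : realType) (N : nat) (s alpha : R).
Hypotheses (N0 : (0 < N)%N) (C0 : 0 < frac_const N s) (hs : 1 / 2 < s < 1)
  (hal : 0 < alpha <= pi / 2).
Local Notation c := (cos alpha).
Local Notation T := (conetail c).
Local Notation kint := (kintegrable s).
Implicit Types (x y z p a : 'rV[R]_N) (E : set 'rV[R]_N).

(** The size of the second-order remainder of the Euclidean norm at distance [r]
    from the origin. *)
Definition rsize (r : R) z : R := Num.min (enorm z ^+ 2 / r) (enorm z).

(** For small [z] the bound comes from the expansion of [|x + z|^2], for large
    [z] from the triangle inequality. *)
Lemma enormD_tangent x z : x != 0 ->
  enorm (x + z) - enorm x <= dotv (normalize x) z + 2 * rsize (enorm x) z.
Proof.
move=> x0; have r0 : 0 < enorm x by rewrite enorm_gt0.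
have rn0 : enorm x != 0 by rewrite gt_eqF.
have dE : dotv x z = enorm x * dotv (normalize x) z.
  by rewrite dotvZl mulVKf.
have d1 : - enorm z <= dotv (normalize x) z.
  have := norm_dotv_le (normalize x) z; rewrite unit_normalize// mul1r ler_norml.
  by case/andP.
have z0 := enorm_ge0 z.
rewrite /rsize minr_pMr// -lerBlDl le_min; apply/andP; split; last first.
  by have := enormD x z; lra.
have aux (t r d q : R) : 0 < r -> t ^+ 2 = r ^+ 2 + 2 * (r * d) + q ^+ 2 ->
    t - r - d <= 2 * (q ^+ 2 / r).
  move=> {}r0 tE; have rn : r != 0 by rewrite gt_eqF.
  have q0 : 0 <= q ^+ 2 / r by rewrite divr_ge0 ?sqr_ge0// ltW.
  have : 0 <= (t - r) ^+ 2 / r by rewrite divr_ge0 ?sqr_ge0// ltW.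
  have -> : (t - r) ^+ 2 / r = (t ^+ 2 - r ^+ 2) / r - 2 * (t - r) by field.
  have -> : (t ^+ 2 - r ^+ 2) / r = 2 * d + q ^+ 2 / r by rewrite tE; field.
  lra.
by apply: aux => //; rewrite -dE sqr_enormD.
Qed.

Lemma rsize_scale r z : 0 < r -> rsize r (r *: z) = r * esize z.
Proof.
move=> r0; rewrite /rsize /esize enormZ gtr0_norm// minr_pMr ?(ltW r0)//.
by congr Num.min; field; rewrite gt_eqF.
Qed.

Lemma measurable_rsize r : measurable_fun setT (rsize r : 'rV[R]_N -> R).
Proof.
apply: measurable_minr; last exact: measurable_enorm.
apply: measurable_funM => //; apply: measurable_funX; exact: measurable_enorm.
Qed.

Lemma kint_rsize (r : R) (T' : set 'rV[R]_N) : 0 < r -> measurable T' -> kint T' (rsize r).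
Proof.
move=> r0 mT'; apply: (@kintegrable_dom _ _ _ C0 hs _ _ (1 + r^-1)) => //.
  exact: measurable_rsize.
move=> z _; have z0 := enorm_ge0 z; have i0 : 0 < r^-1 by rewrite invr_gt0.
have rs0 : 0 <= rsize r z by rewrite le_min divr_ge0 ?sqr_ge0 ?(ltW r0).
rewrite ger0_norm// /esize minr_pMr; last by lra.
rewrite le_min; apply/andP; split.
  rewrite /rsize ge_min; apply/orP; left; rewrite mulrC ler_wpM2r ?sqr_ge0//; lra.
by rewrite /rsize ge_min; apply/orP; right; rewrite ler_peMl//; lra.
Qed.

(** The second-order error at distance [r], of the order of [r ^ (1 - 2 s)]. *)
Lemma mu_int_rsize_le r eps y : 0 < r ->
  mu_int s (T eps y) (rsize r) <=
  r `^ (1 - 2 * s) * mu_int s setT (@esize R N).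
Proof.
move=> r0; have r0' : r != 0 by rewrite gt_eqF.
have mT : measurable [set: 'rV[R]_N] by [].
have E : (fun z => rsize r (r *: z)) = (fun z => r * esize z).
  by apply/funext => z; rewrite rsize_scale.
have iE : kint setT (fun z : 'rV[R]_N => r * esize z).
  by apply: kintegrableZ => //; exact: kintegrable_esize.
apply: (@le_trans _ _ (mu_int s setT (rsize r))).
  rewrite !mu_intE !/Rintegral fine_le//.
  - exact: (integrable_fin_num (measurable_conetail _ _ _) (kint_rsize r0 (measurable_conetail _ _ _))).
  - exact: (integrable_fin_num mT (kint_rsize r0 mT)).
  - apply: ge0_subset_integral => //; first exact: measurable_conetail.
      by apply/measurable_EFinP; apply: measurable_funM; [exact: measurable_rsize|exact: measurable_kern].
    move=> z _; rewrite lee_fin mulr_ge0 ?kern_ge0//.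
    by rewrite le_min enorm_ge0 divr_ge0 ?sqr_ge0 ?ltW.
rewrite (mu_int_scale r0 mT (measurable_rsize r)); last by rewrite E.
rewrite E mu_intZ//; last exact: kintegrable_esize.
rewrite le_eqVlt; apply/orP; left; apply/eqP.
by rewrite mulrA powRD ?r0' ?implybT// powRr1 ?(ltW r0)// (mulrC r).
Qed.

Lemma esize_int_ge0 : 0 <= mu_int s setT (@esize R N).
Proof. by apply: (mu_int_ge0 C0) => z _; exact: esize_ge0. Qed.

Definition eball p (r : R) : set 'rV[R]_N := [set z | enorm (z - p) < r].

Lemma measurable_eball p r : measurable (eball p r).
Proof.
rewrite /eball; have /(measurable_preimage_rV (f := fun z => z - p)) : measurable [set z : 'rV[R]_N | enorm z < r].
  exact: measurable_enorm_lt.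
apply => i; under eq_fun do rewrite !mxE.
by apply: measurable_funB => //; exact: measurable_coord_rV.
Qed.

(** A ball of radius [k r] at distance comparable to [r] is charged by [mu_s] at
    least a multiple of [r ^ (- 2 s)]: by scaling, it suffices to look at
    [r = 1]. *)
Lemma mu_ball_ge (k : R) : 0 < k -> exists2 c0, 0 < c0 &
  forall p r, 0 < r -> (forall z, eball p (k * r) z -> r / 2 < enorm z <= 2 * r) ->
    kint (eball p (k * r)) (cst 1) /\
    c0 * r `^ (- (2 * s)) <= mu_int s (eball p (k * r)) (cst 1).
Proof.
move=> k0.
pose V := fine (lebesgue_rV R N [set v | enorm v < k]).
have Vfin := lebesgue_rV_ball_lty N k.
have V0 : 0 < V by rewrite fine_gt0// lebesgue_rV_ball_gt0//= ltey_eq Vfin.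
pose d := frac_const N s / 2 `^ (N%:R + 2 * s).
have d0 : 0 < d by rewrite divr_gt0// powR_gt0.
exists (d * V); first by rewrite mulr_gt0.
move=> p r r0 Br.
have mB := measurable_eball p (k * r).
have kintB (p' : 'rV[R]_N) (k' r' : R) : 0 < r' ->
    (forall z, eball p' k' z -> r' / 2 < enorm z) -> kint (eball p' k') (cst 1).
  move=> r'0 Bp; apply: (@kintegrable_dom _ _ _ C0 hs _ _ (1 + (r' / 2)^-1 + (r' / 2) ^- 2)) => //.
    exact: measurable_eball.
  move=> z /Bp zr; rewrite normr1.
  by have [] := @shell_esize _ _ (r' / 2) z (divr_gt0 r'0 (ltr0n _ 2)) zr.
split; first by apply: (kintB _ _ r) => // z /Br /andP[].
pose p' := r^-1 *: p.
have BE : [set z | eball p (k * r) (r *: z)] = eball p' k.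
  apply/seteqP; split => z; rewrite /eball/=;
  rewrite (_ : r *: z - p = r *: (z - p')) ?enormZ ?gtr0_norm//.
  - by rewrite mulrC ltr_pM2r.
  - by rewrite scalerBr scalerA divff ?scale1r// gt_eqF.
  - by rewrite mulrC ltr_pM2r.
  - by rewrite scalerBr scalerA divff ?scale1r// gt_eqF.
have Bz z : eball p' k z -> 1 / 2 < enorm z <= 2.
  rewrite -BE => /Br; rewrite enormZ gtr0_norm// ltr_pM2l//.
  by rewrite (mulrC 2) ler_pM2l// div1r.
have iB' : kint (eball p' k) (cst 1) by apply: (kintB _ _ 1) => // z /Bz /andP[].
rewrite (mu_int_scale r0 mB) ?BE//.
rewrite mulrC ler_pM2l ?powR_gt0//.
have mB' := measurable_eball p' k.
have LB : lebesgue_rV R N (eball p' k) = lebesgue_rV R N [set v | enorm v < k].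
  rewrite -(lebesgue_rV_translate p' mB'); apply: congr1.
  by apply/seteqP; split => v; rewrite /eball/= addrK.
have fB : (lebesgue_rV R N (eball p' k) < +oo)%E by rewrite LB -ge0_fin_numE.
have VE : fine (lebesgue_rV R N (eball p' k)) = V by rewrite LB.
rewrite -VE -Rintegral_cst// mu_intE; apply: le_Rintegral => //.
- apply: measurable_bounded_integrable => //.
  + exact: bounded_cst.
- move=> z /Bz/andP[z1 z2]; rewrite /= mul1r /d /kern ler_pM2l// lef_pV2 ?posrE ?powR_gt0//.
    apply: ge0_ler_powR; rewrite ?nnegrE ?enorm_ge0//.
    by have := ler0n R N; case/andP: hs; lra.
  by lra.
Qed.

End barrier.

Section supersolution.
Context (R : realType) (N : nat) (s alpha : R).
Hypotheses (N0 : (0 < N)%N) (C0 : 0 < frac_const N s) (hs : 1 / 2 < s < 1)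
  (hal : 0 < alpha <= pi / 2).
Local Notation c := (cos alpha).
Local Notation T := (conetail c).
Local Notation kint := (kintegrable s).
Implicit Types (x y z p a : 'rV[R]_N) (E : set 'rV[R]_N).

(** A small power of the distance to the pole [p]. It is capped so as to be
    bounded, and cut to zero on a part [E] of the exterior of the domain. *)
Definition barrier E p (Lb b : R) x : R :=
  \1_(~` E) x * Num.min (enorm (x - p)) Lb `^ b.

Lemma min_enorm_ge0 p (Lb : R) x : 0 <= Lb -> 0 <= Num.min (enorm (x - p)) Lb.
Proof. by move=> L0; rewrite le_min enorm_ge0. Qed.

Lemma barrier_bound E p Lb b x : 0 <= Lb -> 0 < b ->
  `|barrier E p Lb b x| <= Lb `^ b.
Proof.
move=> L0 b0; rewrite /barrier ger0_norm; last by rewrite mulr_ge0 ?powR_ge0.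
apply: (@le_trans _ _ (1 * Num.min (enorm (x - p)) Lb `^ b)).
  by rewrite ler_wpM2r ?powR_ge0// indicE; case: (_ \in _).
rewrite mul1r; apply: ge0_ler_powR; rewrite ?nnegrE ?min_enorm_ge0 ?(ltW b0)//.
by rewrite ge_min lexx orbT.
Qed.

Lemma measurable_barrier E p Lb b : measurable E ->
  measurable_fun setT (barrier E p Lb b).
Proof.
move=> mE; apply: measurable_funM; first by apply: measurable_indic; exact: measurableC.
apply: (measurableT_comp (measurable_powR _)); apply: measurable_minr => //.
apply: (measurableT_comp (@measurable_enorm R N)); apply: measurable_fun_rV => i.
under eq_fun do rewrite !mxE.
by apply: measurable_funB => //; exact: measurable_coord_rV.
Qed.

(** The majorant is at least [(1 - b) r ^ b] everywhere, in particular on [E],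
    where the barrier vanishes: a jump into [E] gains that much. *)
Lemma barrier_le_tangent E p Lb b x z : 0 <= Lb -> 0 < b < 1 -> x - p != 0 ->
  let r := enorm (x - p) in
  barrier E p Lb b (x + z) <=
    r `^ b + b * r `^ (b - 1) * (dotv (normalize (x - p)) z + 2 * rsize r z) /\
  (1 - b) * r `^ b <=
    r `^ b + b * r `^ (b - 1) * (dotv (normalize (x - p)) z + 2 * rsize r z).
Proof.
move=> L0 /andP[b0 b1] xp r; have r0 : 0 < r by rewrite enorm_gt0.
have g0 : 0 <= b * r `^ (b - 1) by rewrite mulr_ge0 ?powR_ge0 ?ltW.
have tan := enormD_tangent z xp.
have H : r `^ b + b * r `^ (b - 1) * (enorm (x - p + z) - r) <=
    r `^ b + b * r `^ (b - 1) * (dotv (normalize (x - p)) z + 2 * rsize r z).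
  by rewrite lerD2l ler_wpM2l.
split; apply: le_trans H.
  apply: le_trans (powR_tangent _ r0 (enorm_ge0 _)); last by rewrite b0.
  apply: (@le_trans _ _ (1 * Num.min (enorm (x + z - p)) Lb `^ b)).
    by rewrite ler_wpM2r ?powR_ge0// indicE; case: (_ \in _).
  rewrite mul1r; apply: ge0_ler_powR; rewrite ?nnegrE ?min_enorm_ge0 ?enorm_ge0 ?(ltW b0)//.
  by rewrite ge_min addrAC lexx.
have rb : r `^ (b - 1) * r = r `^ b.
  by rewrite mulrC mulr_powRB1// ltW.
have t0 : 0 <= b * r `^ (b - 1) * enorm (x - p + z) by rewrite mulr_ge0 ?enorm_ge0.
rewrite mulrBr; have -> : b * r `^ (b - 1) * r = b * r `^ b by rewrite -mulrA rb.
lra.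
Qed.

(** With [r] the distance from [x] to the pole, the linear terms of the two
    averages compensate each other when the second one takes its cone with axis
    pointing to the pole. The second-order errors are at most of the order of
    [b r ^ (b - 2 s)]. The cone pointing to the pole contains a ball included in
    [E], of radius proportional to [r], and the jumps into that ball gain a
    multiple of [r ^ (b - 2 s)] in which [b] is no factor. Hence the barrier is
    a supersolution for small [b], uniformly in [eps]. *)
Lemma barrier_super (kap t1 Lb : R) : 0 < kap < 1 / 2 -> 0 < t1 -> 0 < Lb ->
  exists2 b, 0 < b < 1 & forall A p E a eps x, 0 <= A -> measurable E ->
    unit_sphere a ->
    (forall t, 0 < t <= t1 ->
       forall w, enorm (w - (p + t *: a)) < kap * t -> E w) ->
    0 < eps -> 2 * eps <= enorm (x - p) <= Lb -> ~ E x ->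
    averaging alpha s eps (fun x => A * barrier E p Lb b x) x <=
    A * barrier E p Lb b x.
Proof.
move=> /andP[k0 k1] t10 L0; have /andP[c0 c1] := cos_aperture hal.
(* By the first bound, the ball of centre [p + tau r a] and radius
   [kap tau r] is seen from [x] within the cone, and by the second one it lies
   at an admissible distance from the pole. *)
pose tau := Num.min ((1 - c) / 5) (t1 / Lb).
have tau0 : 0 < tau by rewrite lt_min !divr_gt0//; lra.
have tau1 : tau <= (1 - c) / 5 by rewrite ge_min lexx.
have tau2 : tau <= t1 / Lb by rewrite ge_min lexx orbT.
have [d d0 Hd] := @mu_ball_ge _ N s C0 hs (kap * tau) (mulr_gt0 k0 tau0).
pose I := mu_int s setT (@esize R N).
have I0 : 0 <= I by exact: esize_int_ge0.
pose b := Num.min (1 / 2) (d / (8 * I + 1)).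
have b0 : 0 < b by rewrite lt_min divr_gt0//= divr_gt0//; lra.
have b2 : b <= 1 / 2 by rewrite ge_min lexx.
have bI : 8 * (b * I) <= d.
  have : b * (8 * I + 1) <= d by rewrite -ler_pdivlMr ?ge_min ?lexx ?orbT//; lra.
  lra.
have b01 : 0 < b < 1 by rewrite b0; lra.
exists b => // A p E a eps x A0 mE a1 Eball e0 /andP[er rL] nEx.
set r := enorm (x - p) in er rL.
have r0 : 0 < r by lra.
have xp : x - p != 0 by rewrite -enorm_gt0.
set xh := normalize (x - p); have xh1 : unit_sphere xh by exact: unit_normalize.
have m0 := tailmass_gt0 N0 C0 hs (cos_aperture hal) e0.
have m10 := taildrift_gt0 N0 C0 hs (cos_aperture hal) e0.
set m := tailmass _ _ _ _ in m0; set m1 := taildrift _ _ _ _ in m10.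
pose g1 := A * (b * r `^ (b - 1)).
have g10 : 0 <= g1 by rewrite mulr_ge0// mulr_ge0 ?powR_ge0// ltW.
pose G z := (A * r `^ b) * cst 1 z + (g1 * dotv xh z + (2 * g1) * rsize r z).
pose u x := A * barrier E p Lb b x.
have GE z : G z = A * (r `^ b + b * r `^ (b - 1) * (dotv xh z + 2 * rsize r z)).
  by rewrite /G /g1 /=; ring.
have uG z : u (x + z) <= G z.
  rewrite GE /u ler_wpM2l//.
  by have [] := @barrier_le_tangent E p Lb b x z (ltW L0) b01 xp.
have uK z : `|u z| <= A * Lb `^ b.
  by rewrite normrM (ger0_norm A0) ler_wpM2l// barrier_bound// ltW.
have mu : measurable_fun setT u.
  by apply: measurable_funM => //; exact: measurable_barrier.
have mT y := measurable_conetail c eps y.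
have i1 y := kintegrable_tail1 c C0 hs y e0.
have id y := kintegrable_tail_dotv c C0 hs y xh e0.
have ir y := kint_rsize C0 hs r0 (mT y).
have iG2 y : kint (T eps y) (fun z => g1 * dotv xh z + (2 * g1) * rsize r z).
  by apply: kintegrableD => //; exact: kintegrableZ.
have iG y : kint (T eps y) G.
  by apply: kintegrableD => //; exact: kintegrableZ.
have iu y := kint_translate alpha C0 hs x y e0 mu uK.
pose e2 := r `^ (1 - 2 * s) * I.
have muG y : unit_sphere y -> mu_int s (T eps y) G <=
    A * r `^ b * m + (g1 * (dotv xh y * m1) + 2 * g1 * e2).
  move=> y1; rewrite /G mu_intD//; last exact: kintegrableZ.
  rewrite mu_intZ// tailmassE// -/m lerD2l mu_intD//; [|exact: kintegrableZ|exact: kintegrableZ].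
  rewrite !mu_intZ// mu_int_dotv// lerD2l ler_wpM2l//; first by lra.
  exact: mu_int_rsize_le.
have mn0 : m != 0 by rewrite gt_eqF.
(* [aa] bounds the average along any axis, and [bb] the one along [- xh]. *)
pose aa := (A * r `^ b * m + (g1 * m1 + 2 * g1 * e2)) / m.
pose bb := (A * r `^ b * m + (- (g1 * m1) + 2 * g1 * e2) - (A / 2 * r `^ b) * (d * r `^ (- (2 * s)))) / m.
apply: (@le_trans _ _ (2^-1 * (aa + bb))).
  apply: (averaging_le N0 C0 hs hal e0 mu uK _ (unitN xh1)).
    move=> y y1; rewrite avgE// ler_pM2r ?invr_gt0//.
    apply: le_trans (mu_int_le C0 (mT y) (iu y) (iG y) (fun z _ => uG z)) _.
    apply: le_trans (muG y y1) _; rewrite lerD2l lerD2r ler_wpM2l//.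
    rewrite ler_piMl ?(ltW m10)//.
    by have := dotv_le xh y; rewrite y1 xh1 mulr1.
  set B := eball (p - x + (tau * r) *: a) (kap * tau * r).
  have taur : tau * r <= t1.
    apply: le_trans (_ : t1 / Lb * r <= _); first by rewrite ler_wpM2r// ltW.
    by rewrite -mulrA ler_piMr ?(ltW t10)// ler_pdivrMl// mulr1.
  have tr0 : 0 < tau * r by rewrite mulr_gt0.
  have BE z : B z -> E (x + z).
    rewrite /B /eball/= => Bz; apply: (Eball (tau * r)); first by rewrite tr0.
    rewrite mulrA (_ : x + z - _ = z - (p - x + (tau * r) *: a))//.
    by rewrite !opprD opprK; apply/rowP => i; rewrite !mxE; ring.
  have Bv z : B z -> enorm (z + (x - p)) <= 2 * (tau * r).
    rewrite /B /eball/= => Bz.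
    rewrite (_ : z + (x - p) = z - (p - x + (tau * r) *: a) + (tau * r) *: a); last first.
      by rewrite !opprD opprK; apply/rowP => i; rewrite !mxE; ring.
    apply: (le_trans (enormD _ _)); rewrite enormZ a1 mulr1 gtr0_norm//.
    have : kap * tau * r <= tau * r by rewrite -mulrA ler_piMl ?(ltW tr0)//; lra.
    lra.
  have tr1 : tau * r <= (1 - c) / 5 * r by rewrite ler_wpM2r// ltW.
  have c5 : (1 - c) / 5 * r <= r / 5.
    by rewrite mulrAC ler_wpM2r// ler_piMl ?(ltW r0)//; lra.
  have Bn z : B z -> r - 2 * (tau * r) <= enorm z <= r + 2 * (tau * r).
    move=> /Bv Bz; have := lerB_enorm (x - p) (- (z + (x - p))).
    rewrite enormN (_ : x - p + _ = - z); last by rewrite opprD addrCA subrr addr0.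
    rewrite enormN => H1.
    have := enormD (z + (x - p)) (- (x - p)); rewrite addrK enormN => H2.
    by rewrite -/r in H1 H2; lra.
  have c5' : (1 - c) * r = r - c * r by ring.
  have cr0 : 0 <= c * r by rewrite mulr_ge0// ltW.
  have Br z : B z -> r / 2 < enorm z <= 2 * r.
    by move=> /Bn/andP[zn1 zn2]; apply/andP; split; lra.
  have [iB muB] := Hd (p - x + (tau * r) *: a) r r0 Br.
  have xhr : dotv xh (x - p) = r.
    by rewrite dotvZl -sqr_enorm expr2 mulKf// gt_eqF.
  have BT : B `<=` T eps (- xh).
    move=> z Bz; have /andP[zn1 zn2] := Bn z Bz; split; rewrite /opencone/shell/=.
      have -> : dotv (- xh) z = r - dotv xh (z + (x - p)).
        by rewrite dotvNl (dotvDr z) xhr; ring.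
      have := dotv_le xh (z + (x - p)); rewrite xh1 mul1r => H1.
      have H2 := Bv z Bz.
      have : c * enorm z <= c * (r + 2 * (tau * r)) by rewrite ler_wpM2l.
      have : c * (tau * r) <= tau * r by rewrite ler_piMl ?(ltW tr0)// ltW.
      have -> : c * (r + 2 * (tau * r)) = c * r + 2 * (c * (tau * r)) by ring.
      have : (1 - c) / 5 * r = r / 5 - c * r / 5 by field.
      have : 0 < (1 - c) * r by rewrite mulr_gt0// subr_gt0.
      rewrite c5'.
      by lra.
    by lra.
  have mB : measurable B by exact: measurable_eball.
  have IB : mu_int s (T eps (- xh)) (\1_B) = mu_int s B (cst 1).
    rewrite !mu_intE [RHS](_ : _ = \int[lebesgue_rV R N]_(z in T eps (- xh) `&` B) (1 * kern s z)).
      rewrite [RHS]Rintegral_mkcondr; apply: eq_Rintegral => z _.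
      by rewrite patchE indicE; case: (_ \in _); rewrite ?mul1r ?mul0r.
    by congr (Rintegral _ _ _); apply/esym/setIidPr.
  have i1B : kint (T eps (- xh)) (\1_B).
    apply: (@kintegrable_tail_bounded _ _ _ _ C0 hs _ _ _ 1) => //.
    by move=> z; rewrite indicE; case: (_ \in _); rewrite ?normr1 ?normr0.
  rewrite avgE//; last exact: unitN.
  rewrite ler_pM2r ?invr_gt0//.
  apply: (@le_trans _ _ (mu_int s (T eps (- xh)) (fun z => G z + - (A / 2 * r `^ b) * \1_B z))).
    apply: (mu_int_le C0) => //.
      by apply: kintegrableD => //; exact: kintegrableZ.
    move=> z _; rewrite indicE; have [/[!inE] zB|zB] := boolP (z \in B); last first.
      by rewrite mulr0 addr0.
    rewrite /u /barrier indicE memNset; last by move=> /(_ (BE z zB)).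
    rewrite mul0r mulr0 mulr1 GE subr_ge0.
    have [_ H] := @barrier_le_tangent E p Lb b x z (ltW L0) b01 xp.
    rewrite -mulrA ler_wpM2l//; apply: le_trans H; rewrite ler_wpM2r ?powR_ge0//; lra.
  rewrite mu_intD//; last exact: kintegrableZ.
  rewrite mu_intZ// IB mulNr lerB//.
    apply: le_trans (muG _ (unitN xh1)) _; rewrite dotvNr -sqr_enorm xh1 expr1n.
    by rewrite mulN1r mulrN.
  by rewrite ler_wpM2l// mulr_ge0 ?powR_ge0//; lra.
have WE : barrier E p Lb b x = r `^ b.
  by rewrite /barrier indicE mem_set// mul1r (min_idPl rL).
rewrite -[leRHS]/(A * barrier E p Lb b x) WE /aa /bb -mulrDl.
have e2E : r `^ (b - 1) * e2 = r `^ b * r `^ (- (2 * s)) * I.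
  have r0' : r != 0 by rewrite gt_eqF.
  by rewrite /e2 mulrA -!powRD ?r0' ?implybT//; congr (_ `^ _ * _); ring.
rewrite [X in X <= _]mulrA ler_pdivrMr//.
set q := r `^ (- (2 * s)) in e2E *.
have q0 : 0 <= q by exact: powR_ge0.
have rb0 : 0 <= r `^ b by exact: powR_ge0.
have -> : g1 * m1 = A * b * r `^ (b - 1) * m1 by rewrite /g1; ring.
have -> : 2 * g1 * e2 = 2 * A * b * (r `^ (b - 1) * e2) by rewrite /g1; ring.
rewrite e2E.
have : 0 <= (A * (r `^ b * q)) * (d - 8 * (b * I)) by rewrite mulr_ge0 ?subr_ge0// mulr_ge0// mulr_ge0.
lra.
Qed.

End supersolution.

(** * Equicontinuity up to the boundary *)

Section topology.
Context (R : realType) (N : nat).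
Implicit Types (x y z : 'rV[R]_N) (D : set 'rV[R]_N).

Lemma nbhs_enorm x (U : set 'rV[R]_N) :
  nbhs x U <-> exists2 r : R, 0 < r & forall y, enorm (y - x) < r -> U y.
Proof.
split=> [/nbhs_ballP[r /= r0 rU]|[r r0 rU]].
  exists r => // y yx; apply: rU; rewrite -ball_normE/= distrC.
  exact: le_lt_trans (normr_le_enorm _) yx.
apply/nbhs_ballP; exists (r / N.+1%:R); first by rewrite /= divr_gt0.
move=> y; rewrite -ball_normE/= distrC => yx; apply: rU.
apply: le_lt_trans (enorm_le_normr _) _.
apply: (@le_lt_trans _ _ (N%:R * (r / N.+1%:R))); first by rewrite ler_wpM2l// ltW.
by rewrite mulrCA gtr_pMr// ltr_pdivrMr// mul1r ltr_nat.
Qed.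

Lemma bounded_set_enorm D : bounded_set D ->
  exists2 r : R, 0 < r & forall x, D x -> enorm x <= r.
Proof.
move=> [M [_ HM]]; exists (N%:R * (`|M| + 1) + 1).
  by rewrite ltr_wpDl// mulr_ge0// addr_ge0.
move=> x Dx; apply: (le_trans (enorm_le_normr x)).
apply: (@le_trans _ _ (N%:R * (`|M| + 1))); last by rewrite lerDl.
rewrite ler_wpM2l// HM//; apply: le_lt_trans (ler_norm M) _.
by rewrite ltrDl.
Qed.

Lemma closure_enorm_le D (r : R) : (forall x, D x -> enorm x <= r) ->
  forall x, closure D x -> enorm x <= r.
Proof.
move=> Dr x Dx; apply/ler_addgt0Pr => e e0.
have /Dx[y [Dy /= yx]] : nbhs x [set y | enorm (y - x) < e].
  by apply/nbhs_enorm; exists e.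
have := lerB_enorm x (y - x); rewrite addrCA subrr addr0.
by have := Dr y Dy; lra.
Qed.

Lemma unif_continuous_enorm (F : 'rV[R]_N -> R) : unif_continuous F ->
  forall eta : R, 0 < eta -> exists2 d : R, 0 < d &
    forall x y, enorm (x - y) < d -> `|F x - F y| <= eta.
Proof.
move=> Fuc eta eta0.
have /Fuc : entourage [set xy : R * R | ball xy.1 eta xy.2] by exact: (entourage_ball _ (PosNum eta0)).
rewrite /= -entourage_ballE => -[d /= d0 dF].
exists d => // x y xy; have xyd : ball x d y.
  by rewrite -ball_normE/=; exact: le_lt_trans (normr_le_enorm _) xy.
by have := dF (x, y) xyd; rewrite /= /ball/= => /ltW.
Qed.

(** A segment leaving an open set crosses its boundary at the supremum of the
    times spent inside. *)
Lemma crossing D x y : open D -> D x -> ~ D y ->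
  exists x0, [/\ (closure D `\` interior D) x0,
    enorm (x - x0) <= enorm (y - x) & enorm (y - x0) <= enorm (y - x)].
Proof.
move=> oD Dx Dy; pose g (t : R) := x + t *: (y - x).
pose A := [set t : R | 0 <= t <= 1 /\ D (g t)].
have A0 : A 0 by split; rewrite ?lexx ?ler01// /g scale0r addr0.
have supA : has_sup A by split; [exists 0|exists 1 => t [/andP[]]].
pose t0 := sup A.
have t0A t : A t -> t <= t0 by move=> At; apply: ub_le_sup; [case: supA|].
have t00 : 0 <= t0 by exact: t0A.
have t01 : t0 <= 1 by apply: ge_sup; [case: supA|move=> t [/andP[]]].
have gE t t' : enorm (g t - g t') = `|t - t'| * enorm (y - x).
  by rewrite -enormZ /g opprD addrACA subrr add0r -scalerBl.
have n0 := enorm_ge0 (y - x).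
have near_g (U : set 'rV[R]_N) : nbhs (g t0) U ->
    exists2 d : R, 0 < d & forall t, `|t - t0| < d -> U (g t).
  move=> /nbhs_enorm[r r0 rU]; exists (r / (enorm (y - x) + 1)).
    by rewrite divr_gt0// ltr_wpDl.
  move=> t td; apply: rU; rewrite gE.
  apply: (@le_lt_trans _ _ (`|t - t0| * (enorm (y - x) + 1))).
    by rewrite ler_wpM2l// lerDl.
  by rewrite -ltr_pdivlMr// ltr_wpDl.
exists (g t0); split.
- split; first move=> U /near_g[d d0 dU].
    have [t At tt] := sup_adherent d0 supA; exists (g t); split; first by case: At.
    by apply: dU; rewrite ltr_norml; have := t0A t At; rewrite -/t0 in tt; lra.
  move=> /near_g[d d0 dD].
  have Dt0 : D (g t0) by apply: dD; rewrite subrr normr0.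
  have t01' : t0 < 1.
    rewrite lt_neqAle t01 andbT; apply/eqP => t0E; apply: Dy.
    by move: Dt0; rewrite t0E /g scale1r addrCA subrr addr0.
  pose t := Num.min 1 (t0 + d / 2).
  have tt0 : t0 < t by rewrite lt_min t01'/= ltrDl divr_gt0.
  have : A t.
    split; first by rewrite ge_min lexx andbT (le_trans t00 (ltW tt0)).
    apply: dD; rewrite ger0_norm; last by rewrite subr_ge0 ltW.
    by have : t <= t0 + d / 2 by [rewrite ge_min lexx orbT]; lra.
  by move=> /t0A; rewrite leNgt tt0.
- have {1}-> : x = g 0 by rewrite /g scale0r addr0.
  by rewrite gE ler_piMl// sub0r normrN ger0_norm.
- have {1}-> : y = g 1 by rewrite /g scale1r addrCA subrr addr0.
  by rewrite gE ler_piMl// ger0_norm; lra.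
Qed.

End topology.

Section regularity.
Context (R : realType) (N : nat) (s alpha : R).
Hypotheses (N0 : (0 < N)%N) (C0 : 0 < frac_const N s) (hs : 1 / 2 < s < 1)
  (hal : 0 < alpha <= pi / 2).
Variable D : set 'rV[R]_N.
Hypotheses (D_open : open D) (D_bounded : bounded_set D)
  (D_cone : external_cone D).
Implicit Types (x y z h : 'rV[R]_N) (F u : 'rV[R]_N -> R).
Local Notation bdry := (closure D `\` interior D).

Definition modulus F := forall eta : R, 0 < eta -> exists2 d : R, 0 < d &
  forall x y, enorm (x - y) < d -> `|F x - F y| <= eta.

Lemma averaging_solutionN eps F u : 0 < eps ->
  averaging_solution alpha s eps D F u ->
  averaging_solution alpha s eps D (fun x => - F x) (fun x => - u x).
Proof.
move=> e0 [[M [Mr HM]] mu uD uF]; split.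
- by exists M; split=> // K /HM H x Tx; rewrite /= normrN; exact: H.
- by apply: measurableT_comp.
- by move=> x Dx; rewrite averagingN// uD.
- by move=> x Dx; rewrite uF.
Qed.

Lemma solution_norm_le eps F u K : 0 < eps -> (forall x, `|F x| <= K) ->
  averaging_solution alpha s eps D F u -> forall x, `|u x| <= K.
Proof.
move=> e0; have [r r0 Dr] := bounded_set_enorm D_bounded.
have half F' u' : (forall x, `|F' x| <= K) ->
    averaging_solution alpha s eps D F' u' -> forall x, u' x <= K.
  move=> FK [/bounded_fun_ex[K' uK] mu uD uF] x.
  have z0 x0 : averaging alpha s eps (fun=> 0 : R) x0 <= 0.
    apply: le_trans (ler_norm _) _.
    by apply: (averaging_norm_le N0 C0 hs hal x0 e0) => // ?; rewrite normr0.
  have := @comparison _ _ _ _ N0 C0 hs hal D eps u' (fun=> 0) K' 0 K r e0 mu.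
  rewrite -[X in u' x <= X]add0r; apply => //.
  - by move=> ?; rewrite normr0.
  - by move=> y Dy; rewrite -uD.
  - by move=> y Dy; rewrite uF// add0r (le_trans (ler_norm _)).
move=> FK su x; rewrite ler_norml (half _ _ FK su) andbT lerNl.
apply: (half _ _ _ (averaging_solutionN e0 su)) => y; by rewrite normrN.
Qed.

(** At distance [eps] from the boundary point [x0] the barrier would feel the
    minimal jump length, so its pole is moved out of the domain, inside the
    exterior cone, by a fixed multiple of [eps]. Outside the domain, the barrier
    is compared with [F] by the continuity of [F] near [x0], and by the choice of
    a large factor [A] elsewhere. *)
Lemma boundary_upper F K : (forall x, `|F x| <= K) -> modulus F ->
  forall eta : R, 0 < eta -> exists d e1 : R, [/\ 0 < d, 0 < e1 &
    forall eps u x0 x, 0 < eps < e1 -> averaging_solution alpha s eps D F u ->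
      bdry x0 -> enorm (x - x0) < d -> u x <= F x0 + eta].
Proof.
move=> FK Fmod eta eta0.
have [r r0 Dr] := bounded_set_enorm D_bounded.
have [kap [t0 [/andP[k0 k1] t00 Dball]]] := exterior_balls D_cone.
have h0 : 0 < eta / 2 by rewrite divr_gt0.
have [d1 d10 Fd] := Fmod _ h0.
pose t1 := Num.min (t0 / 2) (d1 / 8).
have t10 : 0 < t1 by rewrite lt_min !divr_gt0.
have t1a : t1 <= t0 / 2 by rewrite ge_min lexx.
have t1b : t1 <= d1 / 8 by rewrite ge_min lexx orbT.
pose Lb := 2 * r + t1.
have L0 : 0 < Lb by rewrite /Lb; lra.
have k01 : 0 < kap < 1 / 2 by rewrite k0.
have [b /andP[b0 b1] Hb] := barrier_super N0 C0 hs hal k01 t10 L0.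
pose mu0 := Num.min (d1 / 2) Lb.
have mu00 : 0 < mu0 by rewrite lt_min L0 divr_gt0.
pose K1 := `|K| + 1; have K10 : 0 < K1 by rewrite ltr_wpDl.
have FK1 x : `|F x| <= K1 by rewrite (le_trans (FK x))// (le_trans (ler_norm K))// lerDl.
pose A := 2 * K1 / mu0 `^ b.
have A0 : 0 < A by rewrite divr_gt0 ?powR_gt0// mulr_gt0.
pose rho := (eta / 2 / A) `^ b^-1.
have rho0 : 0 < rho by apply: powR_gt0; exact: divr_gt0.
have rhob : A * rho `^ b = eta / 2.
  rewrite /rho -powRrM mulVf ?gt_eqF// powRr1; last by apply: divr_ge0; exact: ltW.
  by rewrite mulrC divfK// gt_eqF.
pose b1' := Num.min t1 (rho / 2).
have b1'0 : 0 < b1' by rewrite lt_min t10 divr_gt0.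
exists (Num.min (rho / 2) d1), (kap * b1' / 2); split.
- by rewrite lt_min d10 divr_gt0.
- by rewrite divr_gt0// mulr_gt0.
move=> eps u x0 x /andP[e0 e1] su bx0; rewrite lt_min => /andP[xx0 xd1].
have [nDx|Dx] := pselect (~ D x).
  have [_ _ _ ->//] := su.
  by have := Fd x x0 xd1; rewrite ler_norml => /andP[]; lra.
have {}Dx := contrapT _ Dx.
have [a a1 Da] := Dball x0 bx0.
pose bb := 2 * eps / kap.
have bb0 : 0 < bb by rewrite divr_gt0// mulr_gt0.
have kbb : kap * bb = 2 * eps by rewrite /bb mulrC divfK// gt_eqF.
have bbb : bb < b1'.
  by rewrite ltr_pdivrMr// mulrC; lra.
have bbt : bb < t1 by apply: lt_le_trans bbb _; rewrite ge_min lexx.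
have bbr : bb < rho / 2 by apply: lt_le_trans bbb _; rewrite ge_min lexx orbT.
pose p := x0 + bb *: a.
pose E := [set z | ~ D z /\ enorm (z - x0) < d1].
have mE : measurable E.
  apply: measurableI; first by apply: measurableC; exact: open_measurable_rV.
  exact: (measurable_eball x0 d1).
have [bu mu uD uF] := su; have uK := solution_norm_le e0 FK1 su.
have px0 z : enorm (z - p) <= enorm (z - x0) + bb.
  rewrite /p opprD addrA; apply: (le_trans (enormD _ _)).
  by rewrite enormN enormZ a1 mulr1 gtr0_norm.
have x0p z : enorm (z - x0) <= enorm (z - p) + bb.
  rewrite -[in leLHS](subrK p z) -addrA.
  have -> : p - x0 = bb *: a by rewrite /p addrAC subrr add0r.
  apply: (le_trans (enormD _ _)).
  by rewrite enormZ a1 mulr1 gtr0_norm.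
have pE t : 0 < t <= t1 -> forall w, enorm (w - (p + t *: a)) < kap * t -> E w.
  move=> /andP[tp tt] w wt.
  have wE : p + t *: a = x0 + (bb + t) *: a by rewrite /p scalerDl addrA.
  rewrite wE in wt; split.
    apply: (Da (bb + t)); first by apply/andP; split; lra.
    apply: le_trans (ltW wt) _; rewrite ler_wpM2l ?(ltW k0)//; lra.
  have : enorm (w - x0) <= enorm (w - (x0 + (bb + t) *: a)) + (bb + t).
    rewrite -[X in _ <= _ + X]gtr0_norm; last by lra.
    rewrite -[X in _ <= _ + X]mulr1 -a1 -enormZ.
    apply: le_trans (enormD _ _).
    by rewrite opprD addrA subrK.
  have : kap * t <= t by rewrite ler_piMl ?(ltW tp)//; lra.
  lra.
have Dp z : D z -> 2 * eps <= enorm (z - p) <= Lb.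
  move=> Dz; apply/andP; split.
    rewrite leNgt; apply/negP => zp; apply: (Da bb _ z _ Dz).
      by rewrite bb0/=; lra.
    by rewrite kbb ltW.
  apply: (le_trans (px0 z)); have := closure_enorm_le Dr bx0.1; have := Dr z Dz.
  have := enormD z (- x0); rewrite enormN /Lb; lra.
have key z : u z <= A * barrier E p Lb b z + (F x0 + eta / 2).
  move: z; apply: (comparison N0 C0 hs hal (D' := D) e0 mu _ uK (K' := A * Lb `^ b) (r := r)) => //.
  - by apply: measurable_funM => //; exact: measurable_barrier.
  - by move=> z; rewrite normrM (ger0_norm (ltW A0)) ler_wpM2l ?(ltW A0)// barrier_bound// ltW.
  - by move=> z Dz; rewrite -uD.
  - by move=> z Dz; apply: (Hb A p E a eps z (ltW A0) mE a1 pE e0 (Dp z Dz)); case.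
  - move=> z nDz; rewrite uF//; have [zd|zd] := ltP (enorm (z - x0)) d1.
      rewrite -[F z]add0r; apply: lerD.
        by rewrite mulr_ge0 ?(ltW A0)// mulr_ge0 ?powR_ge0.
      by have := Fd z x0 zd; rewrite ler_norml => /andP[]; lra.
    have mz : mu0 <= Num.min (enorm (z - p)) Lb.
      rewrite /mu0 le_min ge_min ge_min lexx orbT andbT; apply/orP; left.
      by have := x0p z; lra.
    have : 2 * K1 <= A * barrier E p Lb b z.
      rewrite /barrier indicE mem_set ?mul1r; last by move=> [_]; rewrite ltNge zd.
      rewrite /A mulrAC -mulrA ler_peMr ?mulr_ge0 ?(ltW K10)//.
      rewrite ler_pdivlMr ?powR_gt0// mul1r.
      by apply: ge0_ler_powR; rewrite ?nnegrE ?(ltW b0) ?(ltW mu00) ?min_enorm_ge0 ?(ltW L0).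
    have := FK1 z; have := FK1 x0; rewrite !ler_norml => /andP[? ?] /andP[? ?].
    lra.
apply: (le_trans (key x)).
have : A * barrier E p Lb b x <= A * rho `^ b.
  rewrite ler_wpM2l ?(ltW A0)//.
  apply: (@le_trans _ _ (1 * Num.min (enorm (x - p)) Lb `^ b)).
    by rewrite ler_wpM2r ?powR_ge0// indicE; case: (_ \in _).
  rewrite mul1r; apply: ge0_ler_powR; rewrite ?nnegrE ?(ltW b0) ?(ltW rho0) ?min_enorm_ge0 ?(ltW L0)//.
  by rewrite ge_min; apply/orP; left; have := px0 x; lra.
rewrite rhob; lra.
Qed.

Lemma modulusN F : modulus F -> modulus (fun x => - F x).
Proof.
move=> Fm eta /Fm[d d0 H]; exists d => // x y /H.
by rewrite -opprD normrN.
Qed.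

Lemma boundary_regularity F K : (forall x, `|F x| <= K) -> modulus F ->
  forall eta : R, 0 < eta -> exists d e1 : R, [/\ 0 < d, 0 < e1 &
    forall eps u x0 x, 0 < eps < e1 -> averaging_solution alpha s eps D F u ->
      bdry x0 -> enorm (x - x0) < d -> `|u x - F x0| <= eta].
Proof.
move=> FK Fm eta eta0.
have [d1 [e1 [d10 e10 H1]]] := boundary_upper FK Fm eta0.
have FK' x : `|- F x| <= K by rewrite normrN.
have [d2 [e2 [d20 e20 H2]]] := boundary_upper FK' (modulusN Fm) eta0.
exists (Num.min d1 d2), (Num.min e1 e2); split; rewrite ?lt_min ?d10 ?e10//.
move=> eps u x0 x; rewrite !lt_min => /andP[e0 /andP[ee1 ee2]] su bx0 /andP[xd1 xd2].
have e01 : 0 < eps < e1 by rewrite e0.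
have e02 : 0 < eps < e2 by rewrite e0.
have := H1 _ _ _ _ e01 su bx0 xd1.
have := H2 _ _ _ _ e02 (averaging_solutionN e0 su) bx0 xd2.
by rewrite ler_norml => ? ?; apply/andP; split; lra.
Qed.

Lemma averaging_translate eps u h x :
  averaging alpha s eps (fun z => u (z + h)) x = averaging alpha s eps u (x + h).
Proof.
rewrite /averaging.
by have -> : (fun z => u (x + z + h)) = (fun z => u (x + h + z))
  by apply/funext => z; rewrite addrAC.
Qed.

(** Translates of solutions are solutions: two of them that are close outside a
    common domain, hence near its boundary, are close everywhere. *)
Lemma equicontinuity F K : (forall x, `|F x| <= K) -> modulus F ->
  forall eta : R, 0 < eta -> exists d e1 : R, [/\ 0 < d, 0 < e1 &
    forall eps u x y, 0 < eps < e1 -> averaging_solution alpha s eps D F u ->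
      enorm (y - x) < d -> `|u y - u x| <= eta].
Proof.
move=> FK Fm eta eta0; have h0 : 0 < eta / 2 by rewrite divr_gt0.
have [r r0 Dr] := bounded_set_enorm D_bounded.
have [d1 [e1 [d10 e10 H1]]] := boundary_regularity FK Fm h0.
have [d2 d20 Fd] := Fm _ h0.
exists (Num.min d1 d2), e1; split; rewrite ?lt_min ?d10//.
move=> eps u x y e01 su; rewrite lt_min => /andP[yx1 yx2].
pose h := y - x; have yE : y = x + h by rewrite /h addrCA subrr addr0.
have /andP[e0 _] := e01.
have uK := solution_norm_le e0 FK su; have [_ mu uD uF] := su.
have out z : ~ (D z /\ D (z + h)) -> `|u (z + h) - u z| <= eta.
  have hE : z + h - z = h by rewrite addrAC subrr add0r.
  move=> nD; have [Dz|nDz] := pselect (D z).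
    have nDzh : ~ D (z + h) by move=> ?; apply: nD.
    have [x0 [bx0 zx0 zhx0]] := crossing D_open Dz nDzh.
    rewrite hE in zx0 zhx0.
    have A1 := H1 _ _ _ _ e01 su bx0 (le_lt_trans zx0 yx1).
    have A2 := H1 _ _ _ _ e01 su bx0 (le_lt_trans zhx0 yx1).
    move: A1 A2; rewrite !ler_norml => /andP[? ?] /andP[? ?].
    by apply/andP; split; lra.
  have [Dzh|nDzh] := pselect (D (z + h)).
    have [x0 [bx0 zhx0 zx0]] := crossing D_open Dzh nDz.
    rewrite (enormB z (z + h)) hE in zx0 zhx0.
    have A1 := H1 _ _ _ _ e01 su bx0 (le_lt_trans zx0 yx1).
    have A2 := H1 _ _ _ _ e01 su bx0 (le_lt_trans zhx0 yx1).
    move: A1 A2; rewrite !ler_norml => /andP[? ?] /andP[? ?].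
    by apply/andP; split; lra.
  rewrite !uF//; have := Fd (z + h) z; rewrite hE => /(_ yx2).
  by rewrite !ler_norml => /andP[? ?]; apply/andP; split; lra.
have mh : measurable_fun setT (fun z => u (z + h)).
  by have := measurable_translate h mu; under eq_fun do rewrite addrC.
have hK z : `|u (z + h)| <= K by exact: uK.
have Dr' z : D z /\ D (z + h) -> enorm z <= r by move=> [/Dr].
have C1 z : u z <= u (z + h) + eta.
  move: z; apply: (comparison N0 C0 hs hal e0 mu mh uK hK Dr').
  - by move=> z [Dz _]; rewrite -uD.
  - by move=> z [_ Dzh]; rewrite averaging_translate -uD.
  - by move=> z /out; rewrite ler_norml => /andP[]; lra.
have C2 z : u (z + h) <= u z + eta.
  move: z; apply: (comparison N0 C0 hs hal e0 mh mu hK uK Dr').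
  - by move=> z [_ Dzh]; rewrite averaging_translate -uD.
  - by move=> z [Dz _]; rewrite -uD.
  - by move=> z /out; rewrite ler_norml => /andP[]; lra.
by rewrite yE ler_norml; have := C1 x; have := C2 x => ? ?; apply/andP; split; lra.
Qed.

End regularity.

(** * Extraction of a uniform limit *)

Section compactness.
Context (R : realType) (N : nat).
Implicit Types (x y : 'rV[R]_N).
Variables (f : nat -> 'rV[R]_N -> R) (D : set 'rV[R]_N) (F : 'rV[R]_N -> R) (K : R).
Hypotheses (fK : forall n x, `|f n x| <= K) (D_bounded : bounded_set D)
  (fF : forall n x, ~ D x -> f n x = F x)
  (feq : forall eta : R, 0 < eta -> exists (d : R) (n0 : nat), 0 < d /\
    forall n x y, (n0 <= n)%N -> enorm (y - x) < d -> `|f n y - f n x| <= eta).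

(** Along an ultrafilter every bounded sequence converges: this replaces a
    diagonal extraction. *)
Lemma ultra_limit (U : set_system nat) : UltraFilter U ->
  forall x, exists l : R, `|l| <= K /\
    forall e : R, 0 < e -> U [set n | `|f n x - l| < e].
Proof.
move=> UU x; pose G : set_system R := fmap (f ^~ x) U.
have PG : ProperFilter G by apply: fmap_proper_filter; exact: ultra_proper.
have PU : ProperFilter U by exact: ultra_proper.
have FU : Filter U by exact: _.
have GK : G `[- K, K]%classic.
  rewrite /G /fmap/=; apply: (@filterS _ U FU setT) => [n _ /=|]; last exact: filterT.
  by rewrite in_itv/= -ler_norml; exact: fK.
have [l [lK cl]] := @segment_compact R (- K) K G PG GK.
exists l; split; first by move: lK; rewrite /= in_itv/= -ler_norml.
move=> e e0; have [//|HU] := in_ultra_setVsetC [set n | `|f n x - l| < e] UU.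
have [r [/= Gr lr]] : ([set r | ~ `|r - l| < e] `&` ball l e) !=set0.
  by apply: cl; [exact: HU|exact: nbhsx_ballx].
by exfalso; apply: Gr; move: lr; rewrite /ball/= distrC.
Qed.

(** By equicontinuity the convergence along the ultrafilter is uniform on a
    compact set containing [D]; outside [D] the functions coincide. The sets of
    the ultrafilter being infinite, a subsequence follows. *)
Lemma uniform_subsequence : exists (k : nat -> nat) (v : 'rV[R]_N -> R),
  [/\ increasing_seq k, (forall x, `|v x| <= K), modulus v &
    forall eta : R, 0 < eta -> exists n0, forall n x, (n0 <= n)%N ->
      `|f (k n) x - v x| <= eta].
Proof.
have [U [UU sU]] := ultraFilterLemma (@eventually_filter).
have PU : ProperFilter U by exact: ultra_proper.
have FU : Filter U by exact: _.
have /choice[v Hv] := ultra_limit UU.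
have vK x : `|v x| <= K by have [] := Hv x.
have vU x e : 0 < e -> U [set n | `|f n x - v x| < e] by have [_] := Hv x; exact.
have Uge n0 : U [set n | (n0 <= n)%N] by apply: sU; exists n0.
have vmod : modulus v.
  move=> eta eta0; have [d [n0 [d0 Hd]]] := feq eta0.
  exists d => // x y xy; apply/ler_addgt0Pr => e e0.
  have e2 : 0 < e / 2 by rewrite divr_gt0.
  have [n [[/= n1 n2] n3]] := filter_ex (filterI (filterI (vU x _ e2) (vU y _ e2)) (Uge n0)).
  have := Hd n y x n3 xy; move: n1 n2; rewrite !ler_norml !ltr_norml.
  by move=> /andP[? ?] /andP[? ?] /andP[? ?]; apply/andP; split; lra.
have Uunif (eta : R) : 0 < eta -> U [set n | forall x, `|f n x - v x| <= eta].
  move=> eta0; have e3 : 0 < eta / 3 by rewrite divr_gt0.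
  have [r r0 Dr] := bounded_set_enorm D_bounded.
  pose B := [set x : 'rV[R]_N | enorm x <= r].
  have cB : compact B.
    apply: bounded_closed_compact.
      exists r; split; first by rewrite num_real.
      by move=> M rM x xr; apply: le_trans (normr_le_enorm x) _; apply: le_trans xr (ltW rM).
    apply: (@closed_comp _ _ (@enorm R N) [set t | t <= r]); last exact: closed_le.
    by move=> x _; exact: (@continuous_enorm _ _ x).
  have [d [n0 [d0 Hd]]] := feq e3; have [d' d'0 Hd'] := vmod _ e3.
  have /compact_near_coveringP cov := cB.
  have HB : \forall n \near U, B `<=` (fun x => `|f n x - v x| <= eta).
    apply: cov => x Bx.
    exists ([set y | enorm (y - x) < Num.min d d'], [set n | `|f n x - v x| < eta / 3] `&` [set n | (n0 <= n)%N]).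
      split; last by apply: filterI; [exact: vU|exact: Uge].
      by apply/nbhs_enorm; exists (Num.min d d') => //; rewrite lt_min d0.
    move=> [y n] /= [+ [nx nn0]]; rewrite lt_min => /andP[yd yd'].
    have := Hd n x y nn0 yd; have := Hd' y x yd'.
    move: nx; rewrite !ler_norml !ltr_norml.
    by move=> /andP[? ?] /andP[? ?] /andP[? ?]; apply/andP; split; lra.
  have E : U [set n | B `<=` (fun x => `|f n x - v x| <= eta)] by exact: HB.
  apply: filterS E => n nB x; have [Dx|nDx] := pselect (D x).
    by apply: nB; exact: Dr.
  apply/ler_addgt0Pr => e e0; have [m /=] := filter_ex (vU x e e0).
  by rewrite !fF// => /ltW ?; rewrite (le_trans (_ : _ <= e))// lerDr ltW.
have /choice[g Hg] : forall mj : nat * nat, exists n, (mj.1 < n)%N /\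
    forall x, `|f n x - v x| <= mj.2.+1%:R^-1.
  move=> [m j]; have j0 : 0 < j.+1%:R^-1 :> R by rewrite invr_gt0.
  by have [n [n1 n2]] := filter_ex (filterI (Uge m.+1) (Uunif _ j0)); exists n.
pose k := fix k j := if j is j'.+1 then g (k j', j) else g (0%N, 0%N).
exists k, v; split => //.
  apply/increasing_seqP => n; rewrite ltEnat/=.
  by have [] := Hg (k n, n.+1).
move=> eta eta0; have [m meta] : exists m, m.+1%:R^-1 < eta.
  by have := ltr_add_invr eta0 => -[m]; rewrite add0r; exists m.
exists m => n x mn; apply: le_trans (ltW meta).
have : `|f (k n) x - v x| <= n.+1%:R^-1.
  by case: n {mn} => [|n] /=; [have [_] := Hg (0%N, 0%N); exact|have [_] := Hg (k n, n.+1); exact].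
move=> /le_trans; apply; rewrite lef_pV2 ?posrE// ler_nat//.
Qed.

End compactness.

(** * Second-order expansion of test functions *)

Section taylor.
Context (R : realType) (N : nat).
Implicit Types (x y z p : 'rV[R]_N) (f phi : 'rV[R]_N -> R).

Lemma enorm_mono x y : (forall i, `|x 0 i| <= `|y 0 i|) -> enorm x <= enorm y.
Proof.
move=> xy; rewrite ler_sqrt ?dotv_ge0//; apply: ler_sum => i _.
by rewrite -!expr2 -(real_normK (num_real (x 0 i))) -(real_normK (num_real (y 0 i))) ler_pXn2r ?nnegrE.
Qed.

Lemma MVT_line f x v (t : R) : (forall x, derivable f x v) ->
  exists2 a : R, `|a| <= `|t| & f (x + t *: v) - f x = t * 'D_v f (x + a *: v).
Proof.
move=> fd; pose g (a : R) := f (x + a *: v).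
have gE (a : R) : (fun h => h^-1 *: ((g \o shift a) (h *: (1 : R)) - g a)) =
    (fun h => h^-1 *: ((f \o shift (x + a *: v)) (h *: v) - f (x + a *: v))).
  apply/funext => h; rewrite /g /= [h *: 1]mulr1.
  by rewrite scalerDl addrCA.
have gd (a : R) : is_derive a (1 : R) g ('D_v f (x + a *: v)).
  split; first by rewrite /derivable gE; exact: fd.
  by rewrite /derive gE.
have gc : continuous g.
  by move=> a; apply: differentiable_continuous; apply/derivable1_diffP; case: (gd a).
have [t0|t0] := leP 0 t.
  have [a] := @MVT_segment R g (fun a => 'D_v f (x + a *: v)) 0 t t0
     (fun a _ => gd a) (continuous_subspaceT gc).
  rewrite in_itv/= => /andP[a0 at_]; rewrite /g scale0r addr0 subr0 => E.
  by exists a; [rewrite !ger0_norm|rewrite E mulrC].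
have [a] := @MVT_segment R g (fun a => 'D_v f (x + a *: v)) t 0 (ltW t0)
     (fun a _ => gd a) (continuous_subspaceT gc).
rewrite in_itv/= => /andP[a0 at_]; rewrite /g scale0r addr0 sub0r => E.
exists a; first by rewrite !ler0_norm// ?lerN2// ltW.
by rewrite -[LHS]opprB E; ring.
Qed.

(** Changing the coordinates one at a time, only partial derivatives are
    needed. *)
Lemma taylor1 f x z p (K : R) : (forall (i : 'I_N) x, derivable f x (stdbasis i)) ->
  (forall (i : 'I_N) y, enorm (y - x) <= enorm z -> `|'D_(stdbasis i) f y - p 0 i| <= K) ->
  `|f (x + z) - f x - dotv p z| <= N%:R * K * enorm z.
Proof.
move=> fd fK; pose zk (k : nat) : 'rV[R]_N := \row_(j < N) (if (j < k)%N then z 0 j else 0).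
have zS (i : 'I_N) : x + zk i.+1 = x + zk i + z 0 i *: stdbasis i.
  rewrite -addrA; congr (_ + _); apply/rowP => j; rewrite !mxE ltnS leq_eqVlt val_eqE.
  have [->|ji] := eqVneq j i; first by rewrite ltnn add0r mulr1.
  by rewrite orFb mulr0 addr0.
have step (i : 'I_N) : `|f (x + zk i.+1) - f (x + zk i) - p 0 i * z 0 i| <= K * enorm z.
  rewrite zS; have [a az ->] := MVT_line (x + zk i) (z 0 i) (fd i).
  rewrite (mulrC (p 0 i)) -mulrBr normrM mulrC.
  apply: ler_pM => //; last exact: enorm_coord.
  apply: fK; have -> : x + zk i + a *: stdbasis i - x = zk i + a *: stdbasis i.
    by apply/rowP => j; rewrite !mxE; ring.
  apply: enorm_mono => j; rewrite !mxE val_eqE.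
  have [->|ji] := eqVneq j i; first by rewrite ltnn add0r mulr1 az.
  by rewrite mulr0 addr0; case: ifP => // _; rewrite normr0.
have z0 : zk 0%N = 0 by apply/rowP => j; rewrite !mxE.
have zN : zk N = z by apply/rowP => j; rewrite !mxE ltn_ord.
have E : f (x + z) - f x - dotv p z =
    \sum_(i < N) (f (x + zk i.+1) - f (x + zk i) - p 0 i * z 0 i).
  rewrite sumrB /dotv; congr (_ - _).
  rewrite -(big_mkord xpredT (fun i => f (x + zk i.+1) - f (x + zk i))).
  by rewrite telescope_sumr// z0 zN addr0.
rewrite E; apply: (le_trans (ler_norm_sum _ _ _)).
apply: (le_trans (ler_sum _ (fun i _ => step i))).
by rewrite sumr_const card_ord -(mulr_natl (K * enorm z)) mulrA.
Qed.

Lemma ler_sum2_term (a : 'I_N -> 'I_N -> R) i j : (forall i j, 0 <= a i j) ->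
  a i j <= \sum_(i < N) \sum_(j < N) a i j.
Proof.
move=> a0; apply: (@le_trans _ _ (\sum_(l < N) a i l)).
  by rewrite (bigD1 j)//= lerDl sumr_ge0.
by rewrite [leRHS](bigD1 i)//= lerDl sumr_ge0// => k _; exact: sumr_ge0.
Qed.

(** [taylor1] is used twice: for the partial derivatives, whose own derivatives
    are bounded near [x0], and then for [phi]. *)
Lemma taylor2 phi x0 : C2 phi -> exists C r : R, [/\ 0 < r, 0 <= C &
  forall x z, enorm (x - x0) <= r -> enorm z <= r ->
    `|phi (x + z) - phi x - dotv (grad phi x) z| <= C * enorm z ^+ 2].
Proof.
move=> [_ d1 _ d2 c2].
have [M M0 HM] : exists2 M : R, 0 <= M & \forall y \near x0, forall i j : 'I_N,
    `|'D_(stdbasis j) ('D_(stdbasis i) phi) y| <= M.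
  pose M : R := \sum_(i < N) \sum_(j < N) (`|'D_(stdbasis j) ('D_(stdbasis i) phi) x0| + 1).
  exists M; first by apply: sumr_ge0 => i _; apply: sumr_ge0 => j _; rewrite addr_ge0.
  apply: (@filter_forall _ _ (fun (i : 'I_N) y => forall j : 'I_N,
    `|'D_(stdbasis j) ('D_(stdbasis i) phi) y| <= M) (nbhs x0) _) => i.
  apply: (@filter_forall _ _ (fun (j : 'I_N) y =>
    `|'D_(stdbasis j) ('D_(stdbasis i) phi) y| <= M) (nbhs x0) _) => j.
  have M1 : `|'D_(stdbasis j) ('D_(stdbasis i) phi) x0| + 1 <= M.
    by apply: (@ler_sum2_term (fun i j => `|'D_(stdbasis j) ('D_(stdbasis i) phi) x0| + 1)) => k l; exact: addr_ge0.
  have aux (a b : R) : `|a - b| < 1 -> `|b| <= `|a| + 1.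
    by move=> ab; have := lerB_dist b a; rewrite distrC; lra.
  have /cvgrPdist_lt/(_ 1 ltr01) := c2 i j x0.
  by apply: filterS => y yx; apply: le_trans M1; exact: aux.
move: HM => /nbhs_enorm[r r0 HM].
exists (N%:R * (N%:R * M)), (r / 3); split; [by rewrite divr_gt0|by rewrite !mulr_ge0|].
move=> x z xr zr.
have -> : N%:R * (N%:R * M) * enorm z ^+ 2 = N%:R * (N%:R * M * enorm z) * enorm z by ring.
apply: taylor1 => // i y yx.
have := @taylor1 ('D_(stdbasis i) phi) x (y - x) 0 M (d2 i).
rewrite dot0v subr0 addrCA subrr addr0 mxE => H.
apply: le_trans (H _) _; last by rewrite ler_wpM2l// mulr_ge0.
move=> j w wx; rewrite mxE subr0; apply: HM.
have := enorm_subD w x x0; lra.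
Qed.

End taylor.

(** * Null sets *)

Section null_sets.
Context (R : realType) (N : nat).
Local Notation L := (lebesgue_rV R N).
Implicit Types (A : set 'rV[R]_N) (y z : 'rV[R]_N).

Lemma ler_dist_enorm y z : `|enorm y - enorm z| <= enorm (y - z).
Proof.
rewrite ler_norml -{2}(enormN z) lerB_enorm andbT lerNl opprB.
by rewrite enormB -{1}(enormN y) lerB_enorm.
Qed.

(** A bounded region has no room for infinitely many disjoint copies of a set of
    positive measure. *)
Lemma null_of_copies A (Ak : nat -> set 'rV[R]_N) (b rho : R) : 0 < b ->
  (forall k, measurable (Ak k)) -> trivIset setT Ak ->
  (forall k z, Ak k z -> enorm z < rho) ->
  (forall k, (b%:E * L A <= L (Ak k))%E) -> L A = 0%E.
Proof.
move=> b0 mA tA Arho bA.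
have mB := @measurable_enorm_lt R N rho.
have Bfin := lebesgue_rV_ball_lty N rho.
set B := [set v | _] in Bfin mB.
have sumB n : (\sum_(k < n) (b%:E * L A) <= L B)%E.
  apply: (@le_trans _ _ (\sum_(k < n) L (Ak k))%E); first exact: lee_sum.
  have mU : measurable (\big[setU/set0]_(k < n) Ak k) by exact: bigsetU_measurable.
  have tI : trivIset `I_n Ak by exact: sub_trivIset tA.
  rewrite -(measure_semi_additive_ord_I L (fun k _ => mA k) tI mU).
  apply: le_measure; rewrite ?inE//.
  by rewrite -bigcup_mkord => z [k _]; exact: Arho.
apply/eqP; rewrite -measure_le0 leNgt; apply/negP => A0.
have bA0 : (0 < b%:E * L A)%E by rewrite mule_gt0.
have bAfin : (b%:E * L A)%E \is a fin_num.
  rewrite ge0_fin_numE ?(ltW bA0)//; apply: (@le_lt_trans _ _ (L B)).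
    by have := sumB 1%N; rewrite big_ord_recl big_ord0 adde0.
  by rewrite -ge0_fin_numE.
pose t := fine (b%:E * L A)%E; pose V := fine (L B).
have t0 : 0 < t by rewrite fine_gt0// bA0 ltey_eq bAfin.
have tV n : n%:R * t <= V.
  have := sumB n; rewrite -(fineK bAfin) -(fineK Bfin) sumEFin lee_fin.
  by rewrite sumr_const card_ord -/t -/V mulr_natl.
have V0 : 0 <= V / t by apply: divr_ge0; [exact: fine_ge0|exact: ltW].
have := archi_boundP V0.
by rewrite ltr_pdivrMr// ltNge tV.
Qed.

(** The spheres of radii [r / l k], with [1 < l k <= 2], are disjoint and of
    comparable measures. *)
Lemma null_sphere (r : R) : 0 < r -> L [set z | enorm z = r] = 0%E.
Proof.
move=> r0; pose l (k : nat) : R := 1 + k.+1%:R^-1.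
have l1 k : 1 < l k by rewrite ltrDl invr_gt0.
have l0 k : 0 < l k by apply: lt_trans (l1 k).
have l2 k : l k <= 2.
  have k1 : k.+1%:R^-1 <= 1 :> R by rewrite invf_le1// ler1n.
  by rewrite /l -lerBrDl (le_trans k1)// lerBrDl.
have mS (t : R) : measurable [set z : 'rV[R]_N | enorm z = t].
  have := @measurable_enorm R N measurableT [set t] (measurable_set1 t).
  by rewrite setTI.
apply: (@null_of_copies _ (fun k => [set z | enorm z = r / l k]) (2 ^- N) (2 * r)).
- by rewrite invr_gt0 exprn_gt0.
- by move=> k; exact: mS.
- move=> i j _ _ [z [/= zi zj]].
  have : l i = l j.
    by apply: invr_inj; apply: (@mulfI _ r); [rewrite gt_eqF|rewrite -zi].
  by move=> /addrI/invr_inj/eqP; rewrite eqr_nat => /eqP [].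
- move=> k z /= ->; rewrite ltr_pdivrMr//; have := l1 k; nra.
- move=> k; rewrite -(lebesgue_rV_scale (l0 k) (mS r)).
  rewrite (_ : [set z | _ (l k *: z)] = [set z | enorm z = r / l k]).
    rewrite muleCA -EFinM -[leRHS]mule1.
    rewrite lee_wpmul2l// lee_fin mulrC ler_pdivrMr ?exprn_gt0// mul1r.
    by rewrite lerXn2r ?nnegrE ?(ltW (l0 k)).
  apply/seteqP; split => z /=; rewrite enormZ gtr0_norm//.
    by move=> <-; rewrite mulrC mulKf ?gt_eqF.
  by move=> ->; rewrite mulrC divfK ?gt_eqF.
Qed.

Variable c : R.
Hypothesis hc : 0 <= c < 1.

(** Two translates of the boundary along the axis are disjoint: if they differ by
    [t], then so do the values of [dotv y], whereas those of [c * enorm] differ by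
    at most [c * t]. *)
Lemma null_cone_boundary y : unit_sphere y ->
  L.-negligible [set z | dotv y z = c * enorm z].
Proof.
move=> y1; case/andP: hc => c0 c1.
pose A (n : nat) := [set z : 'rV[R]_N | dotv y z = c * enorm z /\ enorm z < n%:R].
have mc : measurable [set z | dotv y z = c * enorm z].
  rewrite (_ : [set x | _] = (fun z => dotv y z - c * enorm z) @^-1` [set 0]).
    rewrite -[X in measurable X]setTI; apply: measurable_funB => //.
      exact: measurable_dotv.
    by apply: measurable_funM => //; exact: measurable_enorm.
  by apply/seteqP; split => z /=; [move=> ->; rewrite subrr|move=> /eqP; rewrite subr_eq0 => /eqP].
have mA n : measurable (A n) := measurableI _ _ mc (measurable_enorm_lt _).
have A0 n : L (A n) = 0%E.
  apply: (@null_of_copies _ (fun k => [set z | A n (z + k.+1%:R^-1 *: y)]) 1 (n%:R + 2)) => //.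
  - move=> k; apply: (@measurable_preimage_rV _ _ 'rV[R]_N _ _ _ _ (mA n)) => i.
    under eq_fun do rewrite mxE.
    by apply: measurable_funD => //; exact: measurable_coord_rV.
  - move=> i j _ _ [z [/= [zi _] [zj _]]].
    have E : dotv y (z + i.+1%:R^-1 *: y) - dotv y (z + j.+1%:R^-1 *: y) =
        i.+1%:R^-1 - j.+1%:R^-1.
      by rewrite !dotvDr !dotvZr -sqr_enorm y1; ring.
    have H (a b : R) : `|enorm (z + a *: y) - enorm (z + b *: y)| <= `|a - b|.
      have -> : `|a - b| = enorm (z + a *: y - (z + b *: y)).
        by rewrite opprD addrACA subrr add0r -scalerBl enormZ y1 mulr1.
      exact: ler_dist_enorm.
    have {}H := H i.+1%:R^-1 j.+1%:R^-1.
    rewrite zi zj -mulrBr in E.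
    apply: contrapT => /eqP ij.
    have p0 : 0 < `|i.+1%:R^-1 - j.+1%:R^-1 : R|.
      rewrite normr_gt0 subr_eq0; apply: contraNneq ij => /invr_inj/eqP.
      by rewrite eqr_nat => /eqP [->].
    have := p0; rewrite -[in X in X -> _]E normrM (ger0_norm c0) ltNge; case/negP.
    move: H p0; rewrite -E normrM (ger0_norm c0).
    set d := `|_ - _|; have := normr_ge0 (enorm (z + i.+1%:R^-1 *: y) - enorm (z + j.+1%:R^-1 *: y)).
    rewrite -/d; nra.
  - move=> k z /= [_].
    have : k.+1%:R^-1 <= 1 :> R by rewrite invf_le1// ler1n.
    have : 0 <= k.+1%:R^-1 :> R by rewrite invr_ge0.
    move: (k.+1%:R^-1) => t t0 t1 zk.
    have := enormD (z + t *: y) (- (t *: y)).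
    by rewrite addrK enormN enormZ y1 mulr1 ger0_norm//; lra.
  - by move=> k; rewrite mul1e (lebesgue_rV_translate _ (mA n)).
apply: (negligibleS (A := \bigcup_n A n)) => [z /= zc|].
  exists (Num.bound (enorm z)) => //; split => //.
  exact: archi_boundP (enorm_ge0 z).
by apply: negligible_bigcup => n; exists (A n); split => //; exact: A0.
Qed.

End null_sets.

(** * Test functions glued outside a ball *)

Section prelim.
Context (R : realType) (N : nat).
Implicit Types (x y z : 'rV[R]_N) (f phi : 'rV[R]_N -> R).

Definition cball x (r : R) : set 'rV[R]_N := [set y | enorm (y - x) <= r].

Lemma continuous_enormB x : continuous (fun y => enorm (y - x)).
Proof.
move=> y; apply: (@continuous_comp _ _ _ (fun y => y - x) (@enorm R N)).
  by apply: (@cvgB _ _ _ (nbhs y)); [exact: cvg_id|exact: cvg_cst].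
exact: (@continuous_enorm _ _ (y - x)).
Qed.

Lemma closed_cball x (r : R) : closed (cball x r).
Proof.
apply: (@closed_comp _ _ (fun y => enorm (y - x)) [set t | t <= r]); last exact: closed_le.
by move=> y _; exact: (@continuous_enormB x y).
Qed.

Lemma compact_cball x (r : R) : compact (cball x r).
Proof.
apply: bounded_closed_compact; last exact: closed_cball.
exists (r + enorm x); split; first by rewrite num_real.
move=> M rM y yr; apply: le_trans (normr_le_enorm y) (le_trans _ (ltW rM)).
have := enormD (y - x) x; rewrite subrK; move: yr; rewrite /cball/=; lra.
Qed.

Lemma modulus_continuous f : modulus f -> continuous f.
Proof.
move=> fm x; apply/(@cvgrPdist_le _ _ _ (nbhs x)) => e e0; have [d d0 H] := fm e e0.
by apply/nbhs_enorm; exists d => // y yx; apply: H; rewrite enormB.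
Qed.

Lemma grad_continuous phi x0 : C2 phi -> forall e : R, 0 < e ->
  exists2 d : R, 0 < d & forall x, enorm (x - x0) < d ->
    enorm (grad phi x - grad phi x0) <= e.
Proof.
move=> [_ _ c1 _ _] e e0; have e1 : 0 < e / N.+1%:R by rewrite divr_gt0.
have : \forall x \near x0, forall i : 'I_N,
    `|'D_(stdbasis i) phi x0 - 'D_(stdbasis i) phi x| < e / N.+1%:R.
  apply: (@filter_forall _ _ (fun (i : 'I_N) x =>
    `|'D_(stdbasis i) phi x0 - 'D_(stdbasis i) phi x| < e / N.+1%:R) (nbhs x0) _) => i.
  by have /cvgrPdist_lt/(_ _ e1) := c1 i x0.
move=> /nbhs_enorm[d d0 H]; exists d => // x xd.
apply: le_trans (enorm_le_normr _) _.
apply: (@le_trans _ _ (N%:R * (e / N.+1%:R))).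
  rewrite ler_wpM2l// [leLHS]mx_normrE; apply/bigmax_leP; split; first exact: ltW.
  by move=> [i j] _; rewrite /= (ord1 i) !mxE distrC ltW// H.
by rewrite mulrCA ler_piMr ?(ltW e0)// ler_pdivrMr// mul1r ler_nat.
Qed.

Lemma bounded_on_cball phi x (r : R) : continuous phi ->
  exists2 M : R, 0 <= M & forall y, cball x r y -> `|phi y| <= M.
Proof.
move=> cphi; have [r0|r0] := ltP r 0.
  exists 0 => // y; rewrite /cball/= => yr.
  by have := le_lt_trans yr r0; rewrite ltNge enorm_ge0.
have A0 : cball x r !=set0 by exists x; rewrite /cball/= subrr enorm0.
have cn : {within cball x r, continuous (fun y => `|phi y|)}.
  apply: continuous_subspaceT => y; apply: (@continuous_comp _ _ _ phi (@Num.norm R R)) => //.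
    exact: cphi.
  exact: norm_continuous.
have [c _ Hc] := EVT_max_rV A0 (@compact_cball x r) cn.
by exists `|phi c| => // y yr; apply: Hc; rewrite inE.
Qed.

(** Gluing any bounded function outside a ball preserves the first-order
    expansion at points near the centre, uniformly, with an error which
    [mu_s] integrates. *)
Lemma patch_expand phi x0 (r K0 : R) : 0 < r -> C2 phi ->
  exists C r1 : R, [/\ 0 <= C, 0 < r1, r1 <= r / 2 &
    forall x (w : 'rV[R]_N -> R) z, enorm (x - x0) <= r1 -> (forall y, `|w y| <= K0) ->
      `|patch w (cball x0 r) phi (x + z) - phi x - dotv (grad phi x) z| <= C * esize z].
Proof.
move=> r0 c2; have [C [r' [r'0 C0 Htay]]] := taylor2 x0 c2.
have [M M0 HM] := bounded_on_cball x0 r (let: And5 c _ _ _ _ := c2 in c).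
pose r1 := Num.min r' (Num.min (r / 2) 1).
have r10 : 0 < r1 by rewrite !lt_min r'0 ltr01 divr_gt0.
have r1a : r1 <= r' by rewrite ge_min lexx.
have r1b : r1 <= r / 2 by rewrite !ge_min lexx orbT.
have r1c : r1 <= 1 by rewrite !ge_min lexx !orbT.
pose P := (2 * M + C * r1 ^+ 2) / r1.
have P0 : 0 <= P by apply: divr_ge0; [apply: addr_ge0; apply: mulr_ge0; rewrite ?sqr_ge0|exact: ltW].
pose C' := C + 2 * (`|K0| + 2 * M + P) * (1 + r1^-1 + r1 ^- 2).
have C'0 : 0 <= 2 * (`|K0| + 2 * M + P) * (1 + r1^-1 + r1 ^- 2).
  have ir0 : 0 <= r1^-1 by rewrite invr_ge0 ltW.
  have ir2 : 0 <= r1 ^- 2 by rewrite invr_ge0 exprn_ge0 ?ltW.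
  by have := normr_ge0 K0; move=> ?; apply: mulr_ge0; [apply: mulr_ge0|]; lra.
exists C', r1; split => //; first by rewrite addr_ge0.
move=> x w z xr wK; have inB h : enorm h <= r1 -> cball x0 r (x + h).
  by move=> hr; rewrite /cball/= addrAC; have := enormD (x - x0) h; lra.
have Mx : `|phi x| <= M by rewrite HM//; have := inB 0; rewrite addr0 enorm0; apply; exact: ltW.
have gP : enorm (grad phi x) <= P.
  have [->|g0] := eqVneq (grad phi x) 0; first by rewrite enorm0.
  pose h := r1 *: normalize (grad phi x).
  have hn : enorm h = r1 by rewrite /h enormZ gtr0_norm// (unit_normalize g0) mulr1.
  have gh : dotv (grad phi x) h = r1 * enorm (grad phi x).
    by rewrite /h dotvZr dotvZr -sqr_enorm expr2 mulKf// enorm_eq0.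
  rewrite ler_pdivlMr// mulrC -gh.
  have := Htay x h (le_trans xr r1a); rewrite hn => /(_ r1a).
  have := HM _ (inB h _); rewrite hn lexx => /(_ isT).
  by move: Mx; rewrite !ler_norml => /andP[? ?] /andP[? ?] /andP[? ?]; lra.
have e0 := esize_ge0 z.
have [zr|zr] := leP (enorm z) r1.
  rewrite /patch mem_set; last exact: inB.
  apply: le_trans (Htay x z (le_trans xr r1a) (le_trans zr r1a)) _.
  have -> : esize z = enorm z ^+ 2.
    by rewrite /esize min_l// expr2 ler_piMl ?enorm_ge0// (le_trans zr).
  by rewrite ler_wpM2r ?sqr_ge0// /C' lerDl.
have [H1 H2] := shell_esize r10 zr.
have Mp : `|patch w (cball x0 r) phi (x + z)| <= `|K0| + M.
  rewrite /patch; case: ifPn => [|_]; first by rewrite inE => /HM; have := normr_ge0 K0; lra.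
  by have := wK (x + z); have := ler_norm K0; lra.
have gz : `|dotv (grad phi x) z| <= P * enorm z.
  by apply: le_trans (norm_dotv_le _ _) _; rewrite ler_wpM2r ?enorm_ge0.
set S := 1 + r1^-1 + r1 ^- 2 in H1 H2 C'0 *.
have Q0 : 0 <= `|K0| + 2 * M + P by have := normr_ge0 K0; lra.
apply: (@le_trans _ _ ((`|K0| + 2 * M + P) * (1 + enorm z))).
  have z0 := enorm_ge0 z; have n0 := normr_ge0 K0.
  have : 0 <= (`|K0| + 2 * M) * enorm z by rewrite mulr_ge0//; lra.
  have := ler_normB (patch w (cball x0 r) phi (x + z) - phi x) (dotv (grad phi x) z).
  have := ler_normB (patch w (cball x0 r) phi (x + z)) (phi x).
  rewrite mulrDr mulr1 mulrDl; lra.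
apply: (@le_trans _ _ ((`|K0| + 2 * M + P) * (2 * (S * esize z)))).
  by rewrite ler_wpM2l//; lra.
rewrite /C' -/S [leRHS]mulrDl.
have -> : (`|K0| + 2 * M + P) * (2 * (S * esize z)) =
  2 * (`|K0| + 2 * M + P) * S * esize z by ring.
by rewrite lerDr mulr_ge0.
Qed.

End prelim.

(** * The viscosity inequality in the limit *)

Section approximation.
Context (R : realType) (N : nat) (s alpha : R).
Hypotheses (N0 : (0 < N)%N) (C0 : 0 < frac_const N s) (hs : 1 / 2 < s < 1)
  (hal : 0 < alpha <= pi / 2).
Local Notation c := (cos alpha).
Local Notation T := (conetail c).
Local Notation kint := (kintegrable s).
Implicit Types (x y z : 'rV[R]_N) (w : 'rV[R]_N -> R).

(** Since [s > 1/2], the drift is of the order of the unbounded [e ^ (1 - 2 s)]. *)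
Lemma taildrift_large (Q : R) : exists2 e1 : R, 0 < e1 &
  forall e, 0 < e < e1 -> Q <= taildrift N s c e.
Proof.
have m0 := taildrift_gt0 N0 C0 hs (cos_aperture hal) ltr01.
have /andP[s1 _] := hs; have q0 : 0 < 2 * s - 1 by lra.
pose Q1 := `|Q| + 1; have Q10 : 0 < Q1 by rewrite ltr_wpDl.
pose e1 := (taildrift N s c 1 / Q1) `^ (2 * s - 1)^-1.
exists e1; first by apply: powR_gt0; exact: divr_gt0.
move=> e /andP[e0 ee1]; rewrite (taildrift_scale c C0 hs e0).
have ep0 : 0 < e `^ (2 * s - 1) by exact: powR_gt0.
have : e `^ (2 * s - 1) <= taildrift N s c 1 / Q1.
  have -> : taildrift N s c 1 / Q1 = e1 `^ (2 * s - 1).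
    rewrite /e1 -powRrM mulVf ?gt_eqF// powRr1//; apply: divr_ge0; exact: ltW.
  by apply: ge0_ler_powR; rewrite ?nnegrE ?powR_ge0 ?ltW.
rewrite ler_pdivlMr// mulrC -ler_pdivlMr// => H.
apply: (@le_trans _ _ Q1); first by rewrite (le_trans (ler_norm Q))// lerDl.
by rewrite -(opprB (2 * s)) powRN mulrC.
Qed.

Lemma mu_int_opp eps y (f : 'rV[R]_N -> R) : measurable_fun setT f ->
  mu_int s (T eps (- y)) f = mu_int s (T eps y) (fun z => f (- z)).
Proof.
move=> mf; rewrite (@mu_int_isometry _ _ s -%R) //.
- congr (mu_int s _ _); apply/seteqP; split => z;
  by rewrite /conetail/opencone/shell/= enormN dotvNl dotvNr opprK.
- by move=> a b; rewrite opprD.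
- exact: opprK.
- exact: enormN.
- move=> i; under eq_fun do rewrite mxE.
  by apply: measurableT_comp => //; exact: measurable_coord_rV.
- exact: measurable_conetail.
Qed.

Lemma kint_esize (T' : set 'rV[R]_N) : measurable T' -> kint T' (@esize R N).
Proof.
move=> mT; apply: (@kintegrableS _ _ _ setT) => //.
exact: kintegrable_esize.
Qed.

Lemma mu_int_esize_le eps y :
  mu_int s (T eps y) (@esize R N) <= mu_int s setT (@esize R N).
Proof.
have := @mu_int_rsize_le _ N s alpha C0 hs 1 eps y ltr01.
rewrite powR1 mul1r; congr (_ <= _).
by apply: eq_mu_int => z _; rewrite /rsize /esize divr1.
Qed.

(** The affine part of [f] is integrated exactly, thanks to [mu_int_dotv]. *)
Lemma mu_int_expand eps y (f : 'rV[R]_N -> R) (a : R) g (C1 : R) : 0 < eps ->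
  unit_sphere y -> measurable_fun setT f ->
  (forall z, `|f z - a - dotv g z| <= C1 * esize z) -> 0 <= C1 ->
  `|mu_int s (T eps y) f - (a * tailmass N s c eps + dotv g y * taildrift N s c eps)|
    <= C1 * mu_int s setT (@esize R N).
Proof.
move=> e0 y1 mf fC C10; pose h z := f z - a - dotv g z.
have mT := measurable_conetail c eps y.
have mh : measurable_fun setT h.
  by apply: measurable_funB; [exact: measurable_funB|exact: measurable_dotv].
have ih : kint (T eps y) h.
  by apply: (@kintegrable_dom _ _ _ C0 hs _ _ C1) => // z _; exact: fC.
have ie := kint_esize mT.
have i1 := kintegrable_tail1 c C0 hs y e0.
have ig := kintegrable_tail_dotv c C0 hs y g e0.
have -> : mu_int s (T eps y) f =
    mu_int s (T eps y) h + (a * tailmass N s c eps + dotv g y * taildrift N s c eps).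
  rewrite -(tailmassE s c N0 eps y1) -(mu_int_dotv c N0 C0 hs g e0 y1) -mu_intZ//.
  have iD : kint (T eps y) (fun z => a * cst 1 z + dotv g z).
    by apply: kintegrableD => //; exact: kintegrableZ.
  rewrite -mu_intD//; last exact: kintegrableZ.
  rewrite -mu_intD//; apply: eq_mu_int => z _.
  by rewrite /h /=; ring.
rewrite addrK; have CE : C1 * mu_int s (T eps y) (@esize R N) <= C1 * mu_int s setT (@esize R N).
  by rewrite ler_wpM2l// mu_int_esize_le.
rewrite ler_norml; apply/andP; split.
  have : mu_int s (T eps y) (fun z => - C1 * esize z) <= mu_int s (T eps y) h.
    apply: (mu_int_le C0) => //; first exact: kintegrableZ.
    by move=> z _; have := fC z; rewrite ler_norml mulNr => /andP[].
  by rewrite mu_intZ//; lra.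
have : mu_int s (T eps y) h <= mu_int s (T eps y) (fun z => C1 * esize z).
  apply: (mu_int_le C0) => //; first exact: kintegrableZ.
  by move=> z _; have := fC z; rewrite ler_norml => /andP[].
by rewrite mu_intZ//; lra.
Qed.

(** An almost optimal axis almost maximises the linear part of [f], the more so
    as the drift is large. *)
Lemma near_max_direction eps y y' (f : 'rV[R]_N -> R) (a : R) g (C1 t : R) :
  0 < eps -> unit_sphere y -> unit_sphere y' -> measurable_fun setT f ->
  (forall z, `|f z - a - dotv g z| <= C1 * esize z) -> 0 <= C1 ->
  mu_int s (T eps y') f <= mu_int s (T eps y) f + t * tailmass N s c eps ->
  (dotv g y' - dotv g y) * taildrift N s c eps <=
    2 * (C1 * mu_int s setT (@esize R N)) + t * tailmass N s c eps.
Proof.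
move=> e0 y1 y'1 mf fC C10.
have := mu_int_expand e0 y'1 mf fC C10; have := mu_int_expand e0 y1 mf fC C10.
rewrite !ler_norml mulrBl => /andP[_ h1] /andP[h2 _]; lra.
Qed.

Variables (D : set 'rV[R]_N) (K : R) (un : nat -> 'rV[R]_N -> R) (en : nat -> R)
  (v : 'rV[R]_N -> R).
Hypotheses (D_open : open D) (unK : forall n x, `|un n x| <= K)
  (mun : forall n, measurable_fun setT (un n))
  (en_gt0 : forall n, 0 < en n)
  (en_cvg : forall d : R, 0 < d -> exists n0, forall n, (n0 <= n)%N -> en n < d)
  (unD : forall n x, D x -> un n x <= averaging alpha s (en n) (un n) x)
  (vK : forall x, `|v x| <= K) (vmod : modulus v)
  (unv : forall eta : R, 0 < eta -> exists n0, forall n x, (n0 <= n)%N ->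
      `|un n x - v x| <= eta).

Variables (x0 : 'rV[R]_N) (r : R) (phi : 'rV[R]_N -> R).
Hypotheses (Dx0 : D x0) (r0 : 0 < r) (c2 : C2 phi) (phix0 : phi x0 = v x0)
  (touch : forall y, cball x0 r y -> y <> x0 -> v y < phi y).
Local Notation p := (grad phi x0).
Local Notation Phi w := (patch w (cball x0 r) phi).

Let c_phi : continuous phi. Proof. by case: c2. Qed.

(** By compactness, a strict touching leaves a gap away from the point of contact,
    which keeps the near-maxima of [un n - phi] close to [x0]. *)
Lemma touching_gap (rho : R) : 0 < rho -> rho <= r -> exists2 k : R, 0 < k &
  forall y, cball x0 r y -> rho <= enorm (y - x0) -> k <= phi y - v y.
Proof.
move=> rho0 rr; pose A := cball x0 r `&` [set y | rho <= enorm (y - x0)].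
have A0 : A !=set0.
  exists (x0 + r *: stdbasis 0); rewrite /A/cball/=.
  rewrite addrAC subrr add0r enormZ gtr0_norm// (stdbasis_unit R N0) mulr1.
  by split.
have cA : compact A.
  apply: (subclosed_compact _ (@compact_cball _ _ x0 r)); last by move=> y [].
  apply: closedI; first exact: closed_cball.
  apply: (@closed_comp _ _ (fun y => enorm (y - x0)) [set t | rho <= t]); last exact: closed_ge.
  by move=> y _; exact: (@continuous_enormB _ _ x0 y).
have cf : {within A, continuous (fun y => phi y - v y)}.
  apply: continuous_subspaceT => y; apply: (@cvgB _ _ _ (nbhs y)); first exact: c_phi.
  exact: (modulus_continuous vmod).
have [k /[!inE] -[kB kr] Hk] := EVT_min_rV A0 cA cf.
exists (phi k - v k).
  rewrite subr_gt0; apply: touch => // kx0; move: kr.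
  by rewrite /= kx0 subrr enorm0 leNgt rho0.
by move=> y yB yr; apply: Hk; rewrite inE.
Qed.

Let phi_ge y : cball x0 r y -> - K <= phi y.
Proof.
move=> yB; have /andP[vy _] : - K <= v y <= K by rewrite -ler_norml.
have [->|yx] := eqVneq y x0.
  by rewrite phix0; have := vK x0; rewrite ler_norml => /andP[].
by apply: le_trans vy (ltW (touch yB _)); exact/eqP.
Qed.

Lemma measurable_patch w : measurable_fun setT w -> measurable_fun setT (Phi w).
Proof.
move=> mw; have mB : measurable (cball x0 r).
  by apply: closed_measurable_rV; exact: closed_cball.
rewrite (_ : Phi w = fun z => \1_(cball x0 r) z * phi z + \1_(~` cball x0 r) z * w z).
  have m1 : measurable_fun setT (\1_(cball x0 r) : _ -> R).
    by apply: measurable_indic; exact: mB.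
  have m2 : measurable_fun setT (\1_(~` cball x0 r) : _ -> R).
    by apply: measurable_indic; apply: measurableC; exact: mB.
  have m3 := continuous_measurable_rV c_phi.
  exact: (measurable_funD (measurable_funM m1 m3) (measurable_funM m2 mw)).
apply/funext => z; rewrite /patch !indicE in_setC.
by case: (z \in _); rewrite /= ?mul1r ?mul0r ?addr0 ?add0r.
Qed.

(** The maximum of [un n - phi] over the ball need not be attained, since [un n]
    is only Borel: [x] realises it up to [t]. There [un n] is below its average,
    and replacing it by [Phi w] turns this into an inequality for a second
    difference, over the cone whose axis [y] is almost optimal. The error [t] is
    small compared to the inverse of the mass of that cone, and [y] is close to
    the direction of the gradient of [phi] by [near_max_direction]. *)
Lemma approximate_touching (delta : R) : 0 < delta ->
  exists eps x y w,
    [/\ 0 < eps < delta, enorm (x - x0) < delta, unit_sphere y &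
        enorm p - dotv p y <= delta] /\
    [/\ measurable_fun setT w, forall z, `|w z| <= K + 1,
        forall z, `|w z - v z| <= delta &
        - delta <= mu_int s (T eps y)
           (fun z => Phi w (x + z) + Phi w (x - z) - 2 * phi x)].
Proof.
move=> delta0.
have d4 : 0 < delta / 4 by rewrite divr_gt0.
have [C1 [r1 [C10 r10 r1r Hexp]]] := patch_expand x0 (K + 1) r0 c2.
have [dg dg0 Hg] := grad_continuous x0 c2 d4.
have [dD dD0 HD] : exists2 dD : R, 0 < dD & forall y, enorm (y - x0) < dD -> D y.
  by apply/nbhs_enorm; exact: open_nbhs_nbhs.
pose rho := Num.min (Num.min delta r1) (Num.min dg dD).
have rho0 : 0 < rho by rewrite !lt_min delta0 r10 dg0 dD0.
have rho1 : rho <= delta by rewrite !ge_min lexx.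
have rho2 : rho <= r1 by rewrite !ge_min lexx orbT.
have rho3 : rho <= dg by rewrite !ge_min lexx !orbT.
have rho4 : rho <= dD by rewrite !ge_min lexx !orbT.
have rhor : rho <= r by lra.
have [k k0 Hk] := touching_gap rho0 rhor.
pose tau := Num.min (Num.min (delta / 4) (k / 4)) (1 / 4).
have tau0 : 0 < tau by rewrite !lt_min !divr_gt0.
have tau1 : tau <= delta / 4 by rewrite !ge_min lexx.
have tau2 : tau <= k / 4 by rewrite !ge_min lexx orbT.
have tau3 : tau <= 1 / 4 by rewrite !ge_min lexx orbT.
pose E := mu_int s setT (@esize R N).
have E0 : 0 <= E by exact: esize_int_ge0.
have [e1 e10 He1] := taildrift_large (2 * (2 * (C1 * E) + 1) / delta).
have [n0 Hn0] := unv tau0.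
have ed0 : 0 < Num.min e1 delta by rewrite lt_min e10.
have [n1 Hn1] := en_cvg ed0.
pose n := maxn n0 n1; pose eps := en n.
have e0 : 0 < eps by exact: en_gt0.
have := Hn1 n (leq_maxr _ _); rewrite lt_min -/eps => /andP[ee1 ed].
have unvn z : `|un n z - v z| <= tau by apply: Hn0; exact: leq_maxl.
have m0 := tailmass_gt0 N0 C0 hs (cos_aperture hal) e0.
have m10 := taildrift_gt0 N0 C0 hs (cos_aperture hal) e0.
have m1Q := He1 eps; rewrite e0 ee1 in m1Q; have {}m1Q := m1Q isT.
set m := tailmass _ _ _ _ in m0; set m1 := taildrift _ _ _ _ in m10 m1Q.
(* The mass [m] blows up as [eps] tends to 0, which forces the precision [t] to
   be chosen after [eps]. *)
pose t := Num.min tau (Num.min (delta / (4 * m)) m^-1).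
have t0 : 0 < t.
  by rewrite lt_min tau0 lt_min invr_gt0 m0 andbT/= divr_gt0// mulr_gt0.
have t1 : t <= tau by rewrite ge_min lexx.
have tm : t <= Num.min (delta / (4 * m)) m^-1 by rewrite ge_min lexx orbT.
have t2 : 4 * t * m <= delta.
  have : t <= delta / (4 * m) by apply: le_trans tm _; rewrite ge_min lexx.
  by rewrite ler_pdivlMr ?mulr_gt0// => ?; rewrite (_ : 4 * t * m = t * (4 * m))//; ring.
have t3 : t * m <= 1.
  have : t <= m^-1 by apply: le_trans tm _; rewrite ge_min lexx orbT.
  by rewrite -[m^-1]div1r ler_pdivlMr.
pose S := [set un n z - phi z | z in cball x0 r].
have x0B : cball x0 r x0 by rewrite /cball/= subrr enorm0 ltW.
have supS : has_sup S.
  split; first by exists (un n x0 - phi x0), x0.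
  exists (2 * K) => _ [z zB <-]; have := phi_ge zB.
  by have := unK n z; rewrite ler_norml => /andP[]; lra.
have [_ [x xB <-] xS] := sup_adherent t0 supS.
pose d := un n x - phi x; rewrite -/d in xS.
have Sd z : cball x0 r z -> un n z - phi z <= d + t.
  move=> zB; rewrite -lerBlDr; apply: le_trans (ltW xS); rewrite lerD2r.
  by apply: ub_le_sup; [case: supS|exists z].
have d_ge : - tau - t <= d.
  have := Sd x0 x0B; rewrite phix0; have := unvn x0; rewrite ler_norml => /andP[]; lra.
have vphi : v x - phi x <= 0.
  have [->|xx0] := eqVneq x x0; first by rewrite phix0 subrr.
  by rewrite subr_le0 ltW//; apply: touch => //; exact/eqP.
have d_le : d <= tau.
  by rewrite /d; have := unvn x; rewrite ler_norml => /andP[]; lra.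
have xrho : enorm (x - x0) < rho.
  rewrite ltNge; apply/negP => /(Hk x xB) kx.
  have := unvn x; rewrite ler_norml => /andP[_ H].
  have : d <= tau - k by rewrite /d; lra.
  by lra.
pose w z := un n z - d.
have mw : measurable_fun setT w by apply: measurable_funB.
have wK z : `|w z| <= K + 1.
  apply: (le_trans (ler_normB _ _)); apply: lerD; first exact: unK.
  by rewrite ler_norml; apply/andP; split; lra.
have wv z : `|w z - v z| <= delta.
  have := unvn z; rewrite !ler_norml /w => /andP[? ?].
  by apply/andP; split; lra.
have mPhi := measurable_patch mw.
have [Mphi Mphi0 HMphi] := bounded_on_cball x0 r c_phi.
have PhiK z : `|Phi w z| <= K + 1 + Mphi.
  rewrite /patch; case: ifPn => [|_]; last by have := wK z; lra.
  rewrite inE => /HMphi; have := le_trans (normr_ge0 _) (unK n x0); lra.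
have unPhi z : un n z <= Phi w z + (d + t).
  rewrite /patch; case: ifPn => [|_]; first by rewrite inE => /Sd; lra.
  by rewrite /w; lra.
have Dx : D x by apply: HD; exact: lt_le_trans rho4.
have Aun : un n x <= averaging alpha s eps (Phi w) x + (d + t).
  apply: le_trans (unD n Dx) _.
  apply: (averaging_leD N0 C0 hs hal e0 (mun n) mPhi (unK n) PhiK) => y y1.
  rewrite !avgE// ler_pdivrMr// mulrDl divfK ?gt_eqF//.
  have mT := measurable_conetail c eps y.
  have i1 := kintegrable_tail1 c C0 hs y e0.
  have -> : (d + t) * tailmass N s c eps = mu_int s (T eps y) (fun z => (d + t) * cst 1 z).
    by rewrite mu_intZ// tailmassE.
  rewrite -mu_intD//; last first.
  - exact: kintegrableZ.
  - exact: (kint_translate alpha C0 hs x y e0 mPhi PhiK).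
  apply: (mu_int_le C0) => //.
  - exact: (kint_translate alpha C0 hs x y e0 (mun n) (unK n)).
  - apply: kintegrableD => //; last exact: kintegrableZ.
    exact: (kint_translate alpha C0 hs x y e0 mPhi PhiK).
  - by move=> z _; rewrite /= mulr1.
have [y [y1 ymax yA]] := averaging_near_max N0 C0 hs hal x e0 mPhi PhiK t0.
have e00 : 0 < eps < delta by rewrite e0.
exists eps, x, y, w; split; split => //.
- exact: lt_le_trans rho1.
- have [->|p0] := eqVneq p 0; first by rewrite enorm0 dot0v subr0 ltW.
  have xr1 : enorm (x - x0) <= r1 by exact: le_trans (ltW xrho) rho2.
  have gx : enorm (grad phi x - p) <= delta / 4 by apply: Hg; exact: lt_le_trans rho3.
  have p1 := unit_normalize p0.
  have mPx := measurable_translate x mPhi.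
  have b4 : (dotv (grad phi x) (normalize p) - dotv (grad phi x) y) * m1 <= delta / 2 * m1.
    have := ymax _ p1; rewrite !avgE// -/m ler_pdivrMr// mulrDl divfK ?gt_eqF//.
    move=> yt.
    have := near_max_direction e0 y1 p1 mPx (fun z => Hexp x w z xr1 wK) C10 yt.
    move=> H; apply: le_trans H _; rewrite -/m -/E mulrAC ler_pdivlMr// mulrC.
    move: m1Q; rewrite ler_pdivrMr// (mulrC m1) => m1Q.
    by apply: le_trans m1Q; rewrite ler_pM2l// lerD2l.
  rewrite ler_pM2r// in b4.
  have a1 : dotv p (normalize p) = enorm p.
    by rewrite dotvZr -sqr_enorm expr2 mulKf// enorm_eq0.
  have a2 (y' : 'rV[R]_N) : unit_sphere y' -> `|dotv (grad phi x - p) y'| <= delta / 4.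
    by move=> y'1; apply: le_trans (norm_dotv_le _ _) _; rewrite y'1 mulr1.
  have := a2 _ y1; have := a2 _ p1; rewrite !dotvBl a1 !ler_norml.
  by move=> /andP[? ?] /andP[? ?]; lra.
- have mT := measurable_conetail c eps y.
  have i1 := kintegrable_tail1 c C0 hs y e0.
  have mPx := measurable_translate x mPhi.
  have mPx' : measurable_fun setT (fun z => Phi w (x - z)).
    apply: (measurableT_comp mPhi); apply: measurable_fun_rV => i.
    under eq_fun do rewrite !mxE.
    by apply: measurable_funB => //; exact: measurable_coord_rV.
  have iP : kint (T eps y) (fun z => Phi w (x + z)).
    exact: (kint_translate alpha C0 hs x y e0 mPhi PhiK).
  have iP' : kint (T eps y) (fun z => Phi w (x - z)).
    by apply: (@kintegrable_tail_bounded _ _ _ _ C0 hs _ _ _ (K + 1 + Mphi)).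
  have -> : mu_int s (T eps y) (fun z => Phi w (x + z) + Phi w (x - z) - 2 * phi x) =
      mu_int s (T eps y) (fun z => Phi w (x + z)) + mu_int s (T eps y) (fun z => Phi w (x - z)) - 2 * phi x * m.
    rewrite (@eq_mu_int _ _ _ _ _ (fun z => (Phi w (x + z) + Phi w (x - z)) + - (2 * phi x) * cst 1 z)); last first.
      by move=> z _; rewrite /= mulr1.
    rewrite mu_intD//; [|exact: kintegrableD|exact: kintegrableZ].
    by rewrite mu_intD// mu_intZ// tailmassE// mulNr.
  have : un n x = phi x + d by rewrite /d addrCA subrr addr0.
  move: yA; rewrite !avgE//; last exact: unitN.
  rewrite (mu_int_opp eps y mPx) -/m.
  set I1 := mu_int _ _ (fun z => Phi w (x + z)); set I2 := mu_int _ _ _ => yA unE.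
  have : phi x - 2 * t <= 2^-1 * ((I1 + I2) / m) by rewrite mulrDl; lra.
  rewrite mulrA ler_pdivlMr// mulrBl => H.
  have -> : 2 * phi x * m = 2 * (phi x * m) by ring.
  have tE : 4 * t * m = 2 * (2 * t * m) by ring.
  lra.
Qed.

End approximation.

Section limit.
Context (R : realType) (N : nat) (s alpha : R).
Hypotheses (N0 : (0 < N)%N) (C0 : 0 < frac_const N s) (hs : 1 / 2 < s < 1)
  (hal : 0 < alpha <= pi / 2).
Local Notation c := (cos alpha).
Local Notation T := (conetail c).
Local Notation L := (lebesgue_rV R N).
Implicit Types (x y z : 'rV[R]_N) (w : 'rV[R]_N -> R).

Variables (D : set 'rV[R]_N) (K : R) (un : nat -> 'rV[R]_N -> R) (en : nat -> R)
  (v : 'rV[R]_N -> R).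
Hypotheses (D_open : open D) (unK : forall n x, `|un n x| <= K)
  (mun : forall n, measurable_fun setT (un n))
  (en_gt0 : forall n, 0 < en n)
  (en_cvg : forall d : R, 0 < d -> exists n0, forall n, (n0 <= n)%N -> en n < d)
  (unD : forall n x, D x -> un n x <= averaging alpha s (en n) (un n) x)
  (vK : forall x, `|v x| <= K) (vmod : modulus v)
  (unv : forall eta : R, 0 < eta -> exists n0, forall n x, (n0 <= n)%N ->
      `|un n x - v x| <= eta).

Variables (x0 : 'rV[R]_N) (r : R) (phi : 'rV[R]_N -> R).
Hypotheses (Dx0 : D x0) (r0 : 0 < r) (c2 : C2 phi) (phix0 : phi x0 = v x0)
  (touch : forall y, cball x0 r y -> y <> x0 -> v y < phi y)
  (p0 : grad phi x0 != 0).
Local Notation p := (grad phi x0).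
Local Notation ph := (normalize p).
Local Notation Phi w := (patch w (cball x0 r) phi).

Let c_phi : continuous phi. Proof. by case: c2. Qed.

Definition second_diff w x z : R := Phi w (x + z) + Phi w (x - z) - 2 * phi x.

Lemma measurable_second_diff w x : measurable_fun setT w ->
  measurable_fun setT (second_diff w x).
Proof.
move=> mw; have mP := measurable_patch x0 r c2 mw.
apply: measurable_funB => //; apply: measurable_funD.
  exact: measurable_translate.
apply: (measurableT_comp mP); apply: measurable_fun_rV => i.
under eq_fun do rewrite !mxE.
by apply: measurable_funB => //; exact: measurable_coord_rV.
Qed.

Lemma mu_int_indic (A : set 'rV[R]_N) (f : 'rV[R]_N -> R) :
  mu_int s A f = \int[L]_z (\1_A z * f z * kern s z).
Proof.
rewrite mu_intE Rintegral_mkcond; apply: eq_Rintegral => z _.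
by rewrite patchE indicE; case: (_ \in _); rewrite ?mul1r ?mul0r.
Qed.

(** On the sphere of radius [r] the glued functions jump. *)
Lemma Phi_cvg (xs : nat -> 'rV[R]_N) (ws : nat -> 'rV[R]_N -> R) z :
  (forall d : R, 0 < d -> exists m0, forall m, (m0 <= m)%N -> enorm (xs m - x0) < d) ->
  (forall d : R, 0 < d -> exists m0, forall m, (m0 <= m)%N ->
     forall y, `|ws m y - v y| <= d) ->
  enorm z != r ->
  Phi (ws m) (xs m + z) @[m --> \oo] --> Phi v (x0 + z).
Proof.
move=> xs_cvg ws_cvg zr; apply/cvgrPdist_le => e e0.
have xz m : enorm (xs m + z - (x0 + z)) = enorm (xs m - x0).
  by rewrite opprD addrACA subrr addr0.
have xz0 : x0 + z - x0 = z by rewrite addrAC subrr add0r.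
have [zlt|zgt] := ltP (enorm z) r.
  have := @c_phi (x0 + z).
  move=> /(@cvgrPdist_le _ _ _ (nbhs (x0 + z)))/(_ _ e0)/nbhs_enorm[d d0 Hd].
  have dr0 : 0 < Num.min d (r - enorm z) by rewrite lt_min d0 subr_gt0.
  have [m0 Hm0] := xs_cvg _ dr0.
  exists m0 => // m /= mm0; have := Hm0 m mm0; rewrite lt_min => /andP[xd xr].
  rewrite /patch mem_set; last by rewrite /cball/= xz0 ltW.
  rewrite mem_set; last first.
    by rewrite /cball/= addrAC; have := enormD (xs m - x0) z; lra.
  by apply: Hd; rewrite xz.
have {}zgt : r < enorm z by rewrite lt_neqAle eq_sym zr.
have e2 : 0 < e / 2 by rewrite divr_gt0.
have [d d0 Hd] := vmod e2.
have dr0 : 0 < Num.min d (enorm z - r) by rewrite lt_min d0 subr_gt0.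
have [m0 Hm0] := xs_cvg _ dr0; have [m1 Hm1] := ws_cvg _ e2.
exists (maxn m0 m1) => // m /=; rewrite geq_max => /andP[mm0 mm1].
have := Hm0 m mm0; rewrite lt_min => /andP[xd xr].
rewrite /patch memNset; last by rewrite /cball/= xz0 => ?; lra.
rewrite memNset; last first.
  by rewrite /cball/= addrAC addrC; have := lerB_enorm z (xs m - x0); lra.
have := Hm1 m mm1 (xs m + z); have := Hd (xs m + z) (x0 + z); rewrite xz => /(_ xd).
by rewrite !ler_norml => /andP[? ?] /andP[? ?]; apply/andP; split; lra.
Qed.


Lemma indic_conetail_near (q : 'rV[R]_N) (es : nat -> R) (ys : nat -> 'rV[R]_N) z :
  (forall m, 0 < es m) ->
  (forall d : R, 0 < d -> exists m0, forall m, (m0 <= m)%N -> es m < d) ->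
  (forall d : R, 0 < d -> exists m0, forall m, (m0 <= m)%N -> enorm (ys m - q) < d) ->
  dotv q z != c * enorm z ->
  exists m0, forall m, (m0 <= m)%N ->
    \1_(T (es m) (ys m)) z = \1_(T 0 q) z :> R.
Proof.
move=> es0 es_cvg ys_cvg zc.
have z0 : 0 < enorm z.
  rewrite enorm_gt0; apply: contra zc => /eqP ->.
  by rewrite dotv0 enorm0 mulr0.
pose g := `|dotv q z - c * enorm z|.
have g0 : 0 < g / enorm z by rewrite divr_gt0// normr_gt0 subr_eq0.
have [m0 Hm0] := es_cvg _ z0; have [m1 Hm1] := ys_cvg _ g0.
exists (maxn m0 m1) => m; rewrite geq_max => /andP[/Hm0 ez /Hm1].
rewrite ltr_pdivlMr// => yz.
have {yz} := le_lt_trans (norm_dotv_le (ys m - q) z) yz.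
rewrite dotvBl ltr_norml /g => /andP[b1 b2].
rewrite !indicE; suff -> : (z \in T (es m) (ys m)) = (z \in T 0 q) by [].
have Eb : T (es m) (ys m) z <-> c * enorm z < dotv (ys m) z.
  by split; [case|move=> ?; split].
have E0 : T 0 q z <-> c * enorm z < dotv q z by split; [case|move=> ?; split].
have [h|h] := leP (dotv q z - c * enorm z) 0.
  rewrite ler0_norm// in b1 b2; rewrite !memNset//.
    by move/E0; lra.
  by move/Eb; lra.
rewrite gtr0_norm// in b1 b2; rewrite !mem_set//.
  by apply/E0; lra.
by apply/Eb; lra.
Qed.

Lemma near_direction (y : 'rV[R]_N) delta : unit_sphere y ->
  enorm p - dotv p y <= delta -> enorm (y - ph) ^+ 2 <= 2 * (delta / enorm p).
Proof.
move=> y1 yd; have p1 := unit_normalize p0.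
have pp : 0 < enorm p by rewrite enorm_gt0.
have -> : enorm (y - ph) ^+ 2 = 2 * (1 - dotv p y / enorm p).
  rewrite sqr_enorm dotvBl !dotvBr -!sqr_enorm y1 p1 expr1n.
  by rewrite (dotvC y ph) /normalize dotvZl (mulrC _^-1); ring.
rewrite ler_pM2l// ler_pdivlMr// mulrBl divfK ?gt_eqF// mul1r.
exact: yd.
Qed.

(** The inequalities satisfied by the approximate touching configurations pass
    to the limit: the integrands converge off the boundary of the limit cone
    and off the sphere of radius [r], where the glued functions jump, and they
    are dominated by a multiple of [min(|z|^2, |z|)], which is integrable. *)
Lemma viscosity_limit : 0 <= mu_int s (T 0 ph) (second_diff v x0).
Proof.
have [C1 [r1 [C10 r10 r1r Hexp]]] := patch_expand x0 (K + 1) r0 c2.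
pose dl (m : nat) : R := Num.min r1 m.+1%:R^-1.
have dl0 m : 0 < dl m.
  by rewrite /dl lt_min r10/= invr_gt0 ltr0n.
have dl_cvg (d : R) : 0 < d -> exists m0, forall m, (m0 <= m)%N -> dl m < d.
  move=> d0; have [m0] := ltr_add_invr d0; rewrite add0r => Hm0.
  exists m0 => m mm0; rewrite gt_min; apply/orP; right; apply: le_lt_trans Hm0.
  by rewrite lef_pV2 ?posrE// ler_nat.
pose P m (q : R * 'rV[R]_N * 'rV[R]_N * ('rV[R]_N -> R)) :=
    [/\ 0 < q.1.1.1 < dl m, enorm (q.1.1.2 - x0) < dl m, unit_sphere q.1.2 &
        enorm p - dotv p q.1.2 <= dl m] /\
    [/\ measurable_fun setT q.2, forall z, `|q.2 z| <= K + 1,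
        forall z, `|q.2 z - v z| <= dl m &
        - dl m <= mu_int s (T q.1.1.1 q.1.2) (second_diff q.2 q.1.1.2)].
have /choice[Q HQ] : forall m, exists q, P m q.
  move=> m; have [e [x [y [w H]]]] := approximate_touching N0 C0 hs hal D_open
    unK mun en_gt0 en_cvg unD vK vmod unv Dx0 r0 c2 phix0 touch (dl0 m).
  by exists (e, x, y, w).
pose es m := (Q m).1.1.1; pose xs m := (Q m).1.1.2.
pose ys m := (Q m).1.2; pose ws m := (Q m).2.
have es0 m : 0 < es m by have [[/andP[]]] := HQ m.
have es_cvg d : 0 < d -> exists m0, forall m, (m0 <= m)%N -> es m < d.
  move=> /dl_cvg[m0 H]; exists m0 => m /H; apply: lt_trans.
  by have [[/andP[]]] := HQ m.
have xs_cvg d : 0 < d -> exists m0, forall m, (m0 <= m)%N -> enorm (xs m - x0) < d.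
  move=> /dl_cvg[m0 H]; exists m0 => m /H; apply: lt_trans.
  by have [[]] := HQ m.
have ws_cvg d : 0 < d -> exists m0, forall m, (m0 <= m)%N ->
    forall y, `|ws m y - v y| <= d.
  move=> /dl_cvg[m0 H]; exists m0 => m /H/ltW dd y; apply: le_trans dd.
  by have [_ [_ _ H' _]] := HQ m; exact: H'.
have pp : 0 < enorm p by rewrite enorm_gt0.
have ys_cvg d : 0 < d -> exists m0, forall m, (m0 <= m)%N -> enorm (ys m - ph) < d.
  move=> d0; have d1 : 0 < d ^+ 2 * enorm p / 2 by rewrite divr_gt0// mulr_gt0// exprn_gt0.
  have [m0 H] := dl_cvg _ d1; exists m0 => m /H dlm.
  have [[_ _ y1 yp] _] := HQ m.
  rewrite -(@ltr_pXn2r _ 2)// ?nnegrE ?enorm_ge0 ?(ltW d0)//.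
  apply: le_lt_trans (near_direction y1 yp) _.
  by rewrite mulrA ltr_pdivrMr//; lra.
have mws m : measurable_fun setT (ws m) by have [_ [H _ _ _]] := HQ m; exact: H.
have wsK m z : `|ws m z| <= K + 1 by have [_ [_ H _ _]] := HQ m; exact: H.
pose F m z := \1_(T (es m) (ys m)) z * second_diff (ws m) (xs m) z * kern s z.
pose G z := \1_(T 0 ph) z * second_diff v x0 z * kern s z.
have mT (e : R) (y : 'rV[R]_N) : measurable_fun setT (\1_(T e y) : _ -> R).
  by apply: measurable_indic; exact: measurable_conetail.
have mF m : measurable_fun setT (EFin \o F m).
  apply/measurable_EFinP; apply: measurable_funM; last exact: measurable_kern.
  by apply: measurable_funM => //; exact: measurable_second_diff.
have mG : measurable_fun setT (EFin \o G).
  apply/measurable_EFinP; apply: measurable_funM; last exact: measurable_kern.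
  apply: measurable_funM => //; apply: measurable_second_diff.
  apply: continuous_measurable_rV; exact: modulus_continuous.
have FG : {ae L, forall z, setT z -> (EFin \o F m) z @[m --> \oo] --> (EFin \o G) z}.
  have mS : measurable [set z : 'rV[R]_N | enorm z = r].
    have := @measurable_enorm R N measurableT [set r] (measurable_set1 _).
    by rewrite setTI.
  have n1 : L.-negligible [set z | enorm z = r].
    by exists [set z | enorm z = r]; split => //; exact: null_sphere.
  have n2 := null_cone_boundary (cos_aperture hal) (unit_normalize p0).
  apply: negligibleS (negligibleU n1 n2) => z /= nz.
  apply: contrapT => /not_orP[/eqP zr /eqP zc]; apply: nz => _.
  apply: cvg_EFin; first by exists 0%N.
  apply: cvgM; last exact: cvg_cst.
  apply: cvgM.
    have [m0 H] := indic_conetail_near es0 es_cvg ys_cvg zc.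
    by apply: cvg_near_cst; exists m0 => // m /= /H.
  apply: cvgB.
    apply: cvgD; first exact: Phi_cvg.
    by apply: (Phi_cvg (z := - z)) => //; rewrite enormN.
  apply: cvgM; first exact: cvg_cst.
  apply/cvgrPdist_le => e e0.
  have := @c_phi x0.
  move=> /(@cvgrPdist_le _ _ _ (nbhs x0))/(_ _ e0)/nbhs_enorm[d d0 Hd].
  have [m0 H] := xs_cvg _ d0.
  by exists m0 => // m /= /H; exact: Hd.
pose g z := (2 * C1 * esize z) * kern s z.
have ig : L.-integrable setT (EFin \o g).
  by apply: kintegrableZ => //; exact: kintegrable_esize.
have Fg : {ae L, forall z n, setT z -> (`|(EFin \o F n) z| <= (EFin \o g) z)%E}.
  apply: aeW => z m _; rewrite /= lee_fin.
  rewrite normrM (ger0_norm (kern_ge0 C0 z)) ler_wpM2r ?kern_ge0//.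
  have xr1 : enorm (xs m - x0) <= r1.
    have [[_ H _ _] _] := HQ m; apply: le_trans (ltW H) _.
    by rewrite ge_min lexx.
  have := Hexp (xs m) (ws m) (- z) xr1 (wsK m).
  have := Hexp (xs m) (ws m) z xr1 (wsK m).
  rewrite /esize enormN dotvNr -/(esize z) !ler_norml => /andP[? ?] /andP[? ?].
  have ez : 0 <= C1 * esize z.
    by rewrite mulr_ge0// le_min sqr_ge0 enorm_ge0.
  rewrite indicE /second_diff; case: (_ \in _); rewrite ?mul1r ?mul0r.
    by apply/andP; split; lra.
  by apply/andP; split; lra.
have [iG _ cvI] := dominated_convergence measurableT mF mG FG ig Fg.
have cvR : \int[L]_z F m z @[m --> \oo] --> mu_int s (T 0 ph) (second_diff v x0).
  rewrite mu_int_indic; apply: fine_cvg.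
  by rewrite fineK//; exact: integrable_fin_num iG.
have cvN : - dl m @[m --> \oo] --> (0 : R).
  rewrite -oppr0; apply: cvgN; apply/cvgrPdist_le => e e0.
  have [m0 H] := dl_cvg _ e0; exists m0 => // m /= /H/ltW.
  by rewrite sub0r normrN gtr0_norm.
apply: (ler_cvg_to cvN cvR); apply: nearW => m.
by have [_ [_ _ _]] := HQ m; rewrite mu_int_indic.
Qed.

End limit.

(** * Positivity of the normalising constant *)

Section gamma.
Context (R : realType).
Local Notation mu := (@lebesgue_measure R).

Lemma powR_le_max (t x : R) n : 0 < t -> 0 <= x <= n%:R -> t `^ x <= 1 + t ^+ n.
Proof.
move=> t0 /andP[x0 xn]; have [t1|t1] := leP t 1.
  rewrite -[leLHS]addr0; apply: lerD; last by rewrite exprn_ge0// ltW.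
  have -> : 1 = 1 `^ x :> R by rewrite powR1.
  by apply: ge0_ler_powR; rewrite ?nnegrE ?(ltW t0).
rewrite -powR_mulrn; last exact: ltW.
rewrite -[leLHS]add0r; apply: lerD => //.
by apply: ler_powR => //; exact: ltW.
Qed.

(** The majorant is a multiple of the derivative of [- (1 + t ^ x)^-1], which is
    bounded: a single primitive takes care of both ends of the half-line. *)
Lemma gamma_integrand_le (x : R) : 0 < x -> exists2 A : R, 0 < A &
  forall t, 0 < t -> t `^ (x - 1) * expR (- t) <=
    A * (x * t `^ (x - 1) / (1 + t `^ x) ^+ 2).
Proof.
move=> x0; pose n := (Num.bound x).
have xn : x <= n%:R by apply/ltW; apply: Num.Theory.archi_boundP; exact: ltW.
pose a : R := 2 + 2 ^+ n * n`!%:R.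
have a0 : 0 < a by rewrite ltr_pwDl// mulr_ge0// exprn_ge0.
exists (a ^+ 2 / x) => [|t t0]; first by rewrite divr_gt0// exprn_gt0.
have e0 := expR_gt0 (t / 2).
have e1 : 1 <= expR (t / 2) by rewrite -expR0 ler_expR divr_ge0// ltW.
have tn : t ^+ n <= 2 ^+ n * n`!%:R * expR (t / 2).
  have t2 : 0 <= t / 2 by rewrite divr_ge0// ltW.
  have : (t / 2) ^+ n / n`!%:R <= expR (t / 2).
    case: (n) => [|m]; first by rewrite expr0 fact0 divr1.
    by apply: le_trans (expR_ge1Dxn m t2); rewrite lerDr.
  rewrite ler_pdivrMr ?ltr0n ?fact_gt0// expr_div_n ler_pdivrMr ?exprn_gt0//.
  by move=> H; apply: le_trans H _; rewrite le_eqVlt; apply/orP; left; apply/eqP; ring.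
have tx : 1 + t `^ x <= a * expR (t / 2).
  have := @powR_le_max t x n t0; rewrite (ltW x0) xn => /(_ isT) H.
  by rewrite /a mulrDl; lra.
have q0 : 0 < 1 + t `^ x by rewrite ltr_pwDl// powR_ge0.
have -> : a ^+ 2 / x * (x * t `^ (x - 1) / (1 + t `^ x) ^+ 2) =
    t `^ (x - 1) * (a ^+ 2 / (1 + t `^ x) ^+ 2).
  by field; rewrite !gt_eqF.
apply: ler_wpM2l; first exact: powR_ge0.
rewrite ler_pdivlMr ?exprn_gt0// expRN mulrC ler_pdivrMr ?expR_gt0//.
have -> : expR t = expR (t / 2) ^+ 2 by rewrite -expRM_natl; congr expR; field.
by rewrite -exprMn ler_pXn2r// nnegrE ?ltW// mulr_gt0.
Qed.

Lemma continuous_powR_pos (x t : R) : 0 < t -> {for t, continuous (fun u : R => u `^ x)}.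
Proof.
move=> t0; apply: differentiable_continuous; apply/derivable1_diffP.
by have := is_derive1_powR x t0; case.
Qed.

Lemma integral_majorant (x a b : R) : 0 < x -> 0 < a -> a < b ->
  (\int[mu]_(t in `[a, b]) (x * t `^ (x - 1) / (1 + t `^ x) ^+ 2)%:E <= 1)%E.
Proof.
move=> x0 a0 ab; pose G (t : R) := - (1 + t `^ x)^-1.
have q0 (t : R) : 0 < 1 + t `^ x by rewrite ltr_pwDl// powR_ge0.
have dG (t : R) : 0 < t -> is_derive t 1 G (x * t `^ (x - 1) / (1 + t `^ x) ^+ 2).
  move=> t0; have d1 := is_derive1_powR x t0.
  have d2 : is_derive t 1 (fun u : R => 1 + u `^ x) (0 + x * t `^ (x - 1)).
    exact: is_deriveD.
  have d3 := @is_deriveV _ (fun u : R => 1 + u `^ x) _ _ _ (lt0r_neq0 (q0 t)) d2.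
  have : is_derive t 1 G (- (- (1 + t `^ x) ^- 2 *: (0 + x * t `^ (x - 1)))).
    exact: is_deriveN.
  by rewrite add0r scaleNr opprK /GRing.scale/= mulrC.
rewrite (@continuous_FTC2 _ _ G)//.
- rewrite -EFinB lee_fin /G opprK.
  have h1 : (1 + a `^ x)^-1 <= 1 by rewrite invf_le1// lerDl powR_ge0.
  by rewrite addrC lerBlDr (le_trans h1)// lerDl invr_ge0 ltW.
- apply/continuous_in_subspaceT => t; rewrite inE/= in_itv/= => /andP[at_ _].
  have t0 : 0 < t by exact: lt_le_trans at_.
  apply: cvgM.
    by apply: cvgM; [exact: cvg_cst|exact: continuous_powR_pos].
  apply: cvgV; first by rewrite expf_neq0// gt_eqF.
  apply: (@continuous_comp _ _ _ (fun u => 1 + u `^ x) (fun u => u ^+ 2)); last exact: exprn_continuous.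
  by apply: cvgD; [exact: cvg_cst|exact: continuous_powR_pos].
- have cG (t : R) : 0 < t -> {for t, continuous G}.
    move=> t0; apply: differentiable_continuous; apply/derivable1_diffP.
    by have := dG t t0; case.
  split.
  + by move=> t; rewrite in_itv/= => /andP[/(lt_trans a0)/dG[]].
  + by apply: cvg_at_right_filter; exact: cG.
  + by apply: cvg_at_left_filter; apply: cG; exact: lt_trans ab.
- move=> t; rewrite in_itv/= => /andP[/(lt_trans a0)/dG d _].
  by rewrite derive1E; exact: derive_val.
Qed.


Lemma Gamma_gt0 (x : R) : 0 < x -> 0 < Gamma x.
Proof.
move=> x0; have [A A0 HA] := gamma_integrand_le x0.
pose f (t : R) := t `^ (x - 1) * expR (- t).
have f0 t : 0 <= f t by rewrite mulr_ge0 ?powR_ge0 ?expR_ge0.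
have mp (a : R) : measurable_fun setT (fun t : R => t `^ a).
  exact: measurable_powR.
have mf : measurable_fun setT (EFin \o f).
  apply/measurable_EFinP; apply: measurable_funM => //.
  by apply: measurableT_comp => //; exact: measurable_expR.
pose S (k : nat) : set R := `[k.+2%:R^-1, k.+2%:R]%classic.
have mS k : measurable (S k) by exact: measurable_itv.
have k0 k : 0 < k.+2%:R^-1 :> R by rewrite invr_gt0 ltr0n.
have Sf k : (\int[mu]_(t in S k) (f t)%:E <= A%:E)%E.
  have mg : measurable_fun setT (fun t : R => x * t `^ (x - 1) / (1 + t `^ x) ^+ 2).
    apply: measurable_funM; first by apply: measurable_funM.
    rewrite (_ : (fun _ => _) = fun t : R => (1 + t `^ x) `^ (- 2)).
      apply: (measurableT_comp (mp (- 2))); exact: measurable_funD.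
    by apply/funext => t; rewrite powRN powR_mulrn// addr_ge0// powR_ge0.
  apply: (@le_trans _ _ (\int[mu]_(t in S k) (A%:E * (x * t `^ (x - 1) / (1 + t `^ x) ^+ 2)%:E))%E).
    apply: ge0_le_integral.
    - exact: mS.
    - by move=> t _; rewrite lee_fin.
    - exact: measurable_funTS.
    - apply: measurable_funTS; apply/measurable_EFinP; exact: measurable_funM.
    - move=> t; rewrite /S/= in_itv/= => /andP[kt _].
      by rewrite -EFinM lee_fin; apply: HA; exact: lt_le_trans kt.
  rewrite ge0_integralZl_EFin; last 4 first.
  - exact: mS.
  - by move=> t _; rewrite lee_fin divr_ge0 ?sqr_ge0// mulr_ge0 ?powR_ge0// ltW.
  - by apply: measurable_funTS; exact/measurable_EFinP.
  - exact: ltW.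
  rewrite -[leRHS]mule1; apply: lee_wpmul2l; first by rewrite lee_fin ltW.
  apply: integral_majorant => //.
  by apply: (@lt_trans _ _ 1); [rewrite invf_lt1 ?ltr0n// ltr1n|rewrite ltr1n].
have SU : \bigcup_k S k = `]0, +oo[%classic.
  apply/seteqP; split => [t [k _]|t]; rewrite /= !in_itv/= ?andbT.
    by move=> /andP[kt _]; exact: lt_le_trans (k0 k) kt.
  move=> t0; have [k1 H1] := ltr_add_invr t0; rewrite add0r in H1.
  pose k2 := Num.bound t; exists (maxn k1 k2) => //.
  rewrite /S/= in_itv/=; apply/andP; split.
    apply: le_trans (ltW H1); rewrite lef_pV2 ?posrE ?ltr0n// ler_nat ltnS.
    by rewrite (leq_trans (leq_maxl k1 k2)).
  have : t < k2%:R by apply: Num.Theory.archi_boundP; exact: ltW.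
  move/ltW/le_trans; apply; rewrite ler_nat.
  by rewrite (leq_trans (leq_maxr k1 k2))// (leq_trans (leqnSn _)).
have ndS : {homo S : n m / (n <= m)%N >-> (n <= m)%O}.
  move=> n m nm; apply/subsetPset => t; rewrite /S/= !in_itv/= => /andP[h1 h2].
  apply/andP; split.
    by apply: le_trans h1; rewrite lef_pV2 ?posrE ?ltr0n// ler_nat.
  by apply: le_trans h2 _; rewrite ler_nat.
have IA : (\int[mu]_(t in `]0%R, +oo[) (f t)%:E <= A%:E)%E.
  have := @ge0_nondecreasing_set_cvg_integral _ (measurableTypeR R) R S (EFin \o f) mu ndS mS.
  rewrite SU => /(_ _ _)/cvg_lim <-//; last 2 first.
  - by move=> i; exact: measurable_funTS.
  - by move=> i t _; rewrite lee_fin.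
  apply: lime_le; last by apply: nearW.
  apply: ereal_nondecreasing_is_cvgn.
  apply: ge0_nondecreasing_set_nondecreasing_integral => //.
  - by move=> i; exact: measurable_funTS.
  - by move=> i t _; rewrite lee_fin.
have Im : ((2^-1 * expR (- 2))%:E <= \int[mu]_(t in `]0%R, +oo[) (f t)%:E)%E.
  apply: (@le_trans _ _ (\int[mu]_(t in `[1%R, 2%R]) (f t)%:E)%E); last first.
    apply: ge0_subset_integral => //.
    - exact: measurable_funTS.
    - by move=> t _; rewrite lee_fin.
    - move=> t; rewrite /= !in_itv/= andbT => /andP[t1 _].
      exact: lt_le_trans t1.
  apply: (@le_trans _ _ (\int[mu]_(t in `[1%R, 2%R]) (2^-1 * expR (- 2))%:E)%E).
    rewrite integral_cst//= lebesgue_measure_itv/= lte_fin ltr1n/= -EFinD.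
    by rewrite -EFinM lee_fin; lra.
  apply: ge0_le_integral.
  - exact: measurable_itv.
  - by move=> t _; rewrite lee_fin mulr_ge0 ?expR_ge0.
  - exact: measurable_cst.
  - exact: measurable_funTS.
  - move=> t; rewrite /= in_itv/= => /andP[t1 t2]; rewrite lee_fin.
    have t0 : 0 < t by exact: lt_le_trans t1.
    apply: ler_pM; rewrite ?expR_ge0//; last by rewrite ler_expR lerN2.
    apply: (@le_trans _ _ (t `^ (-1))).
      by rewrite powR_inv1 ?(ltW t0)// lef_pV2 ?posrE.
    by apply: ler_powR => //; lra.
rewrite /Gamma /Rintegral fine_gt0//; apply/andP; split.
  by apply: lt_le_trans Im; rewrite lte_fin mulr_gt0 ?expR_gt0.
by apply: le_lt_trans IA _; rewrite ltry.
Qed.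

Lemma frac_const_gt0 (N : nat) (s : R) : 1 / 2 < s < 1 -> 0 < frac_const N s.
Proof.
move=> /andP[s0 s1]; rewrite /frac_const; apply: divr_gt0; last first.
  by rewrite mulr_gt0 ?powR_gt0 ?pi_gt0// Gamma_gt0// subr_gt0.
have s2 : 0 < s by lra.
rewrite mulr_gt0// ?mulr_gt0 ?powR_gt0// Gamma_gt0//.
by rewrite ltr_wpDl// divr_ge0.
Qed.

End gamma.

(** * Viscosity solutions as limits *)

Section conclusion.
Context (R : realType) (N : nat) (s alpha : R).
Hypotheses (N0 : (0 < N)%N) (C0 : 0 < frac_const N s) (hs : 1 / 2 < s < 1)
  (hal : 0 < alpha <= pi / 2).
Local Notation T := (conetail (cos alpha)).
Implicit Types (x y z : 'rV[R]_N) (phi v w : 'rV[R]_N -> R).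

Lemma grad_patch v x0 (r : R) phi : 0 < r ->
  grad (patch v (cball x0 r) phi) x0 = grad phi x0.
Proof.
move=> r0; apply/rowP => i; rewrite !mxE; apply: near_eq_derive.
apply/nbhs_enorm; exists r => // y /ltW yr /=.
by rewrite /patch mem_set.
Qed.

Lemma frac_op_patch v x0 (r : R) phi : 0 < r -> grad phi x0 != 0 ->
  frac_op alpha s (patch v (cball x0 r) phi) x0 =
  mu_int s (T 0 (normalize (grad phi x0))) (second_diff x0 r phi v x0).
Proof.
move=> r0 p0; rewrite /frac_op grad_patch// cone_shellE//; last exact: unit_normalize.
have Px : patch v (cball x0 r) phi x0 = phi x0.
  by rewrite /patch mem_set// /cball/= subrr enorm0 ltW.
by apply: eq_mu_int => z _; rewrite /second_diff Px.
Qed.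

Lemma gradN phi x : C2 phi -> grad (fun y => - phi y) x = - grad phi x.
Proof.
by move=> [_ d _ _ _]; apply/rowP => i; rewrite !mxE deriveN.
Qed.

Lemma C2N phi : C2 phi -> C2 (fun y => - phi y).
Proof.
move=> [c d cd dd cdd].
have E1 (i : 'I_N) : 'D_(stdbasis i) (fun y => - phi y) = (fun y => - 'D_(stdbasis i) phi y).
  by apply/funext => x; rewrite deriveN.
have E2 (i j : 'I_N) : 'D_(stdbasis j) ('D_(stdbasis i) (fun y => - phi y)) =
    (fun y => - 'D_(stdbasis j) ('D_(stdbasis i) phi) y).
  by rewrite E1; apply/funext => x; rewrite deriveN.
split.
- by move=> x; apply: (@cvgN _ _ _ (nbhs x)); exact: c.
- by move=> i x; apply: derivableN.
- by move=> i; rewrite E1 => x; apply: (@cvgN _ _ _ (nbhs x)); exact: cd.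
- by move=> i j x; rewrite E1; apply: derivableN.
- by move=> i j; rewrite E2 => x; apply: (@cvgN _ _ _ (nbhs x)); exact: cdd.
Qed.

Lemma second_diffN x0 (r : R) phi v x z :
  second_diff x0 r (fun y => - phi y) (fun y => - v y) x z =
  - second_diff x0 r phi v x z.
Proof.
have E y : patch (fun y => - v y) (cball x0 r) (fun y => - phi y) y =
    - patch v (cball x0 r) phi y by rewrite /patch; case: ifP.
by rewrite /second_diff !E; ring.
Qed.

Lemma increasing_seq_ge (k : nat -> nat) n : increasing_seq k -> (n <= k n)%N.
Proof.
move=> kk; elim: n => // n IH; apply: leq_ltn_trans IH _.
by rewrite ltnNge; have := kk n.+1 n; rewrite !leEnat => ->; rewrite -ltnNge.
Qed.

Lemma uniform_cvgP (f : nat -> 'rV[R]_N -> R) v :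
  (forall eta : R, 0 < eta -> exists n0, forall n x, (n0 <= n)%N ->
     `|f n x - v x| <= eta) ->
  {uniform, f n @[n --> \oo] --> v}.
Proof.
move=> H P /uniform_nbhs[E [entE EP]]; rewrite /nbhs/=.
have [e /= e0 He] : exists2 e : R, 0 < e & forall a b : R, `|a - b| < e -> E (a, b).
  by move: entE => [/= e e0 He]; exists e => // a b ab; apply: He.
have e2 : 0 < e / 2 by rewrite divr_gt0.
have [n0 Hn0] := H _ e2; exists n0 => // n /= nn0; apply: EP => y _ /=.
apply: He; rewrite distrC; apply: le_lt_trans (Hn0 n y nn0) _.
by rewrite ltr_pdivrMr// ltr_pMr// ltr1n.
Qed.


(** The second inequality is the first one for [- un], [- v] and [- phi]: the axis
    of the cone is reversed, which the parity of the second difference absorbs. *)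
Lemma viscosity_of_limit (D : set 'rV[R]_N) (K : R) (F : 'rV[R]_N -> R)
    (un : nat -> 'rV[R]_N -> R) (en : nat -> R) v :
  open D -> (forall n, 0 < en n) ->
  (forall d : R, 0 < d -> exists n0, forall n, (n0 <= n)%N -> en n < d) ->
  (forall n, averaging_solution alpha s (en n) D F (un n)) ->
  (forall n x, `|un n x| <= K) ->
  (forall x, `|v x| <= K) -> modulus v ->
  (forall eta : R, 0 < eta -> exists n0, forall n x, (n0 <= n)%N ->
      `|un n x - v x| <= eta) ->
  viscosity_solution alpha s D F v.
Proof.
move=> D_open en0 en_cvg su unK vK vm unv.
have vc : continuous v := modulus_continuous vm.
split.
- exists K; split; first exact: num_real.
  by move=> M KM x _; apply: le_trans (vK x) (ltW KM).
- exact: vc.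
- move=> x Dx; apply/eqP; rewrite -subr_eq0 -normr_le0.
  apply/ler_addgt0Pr => e e0; rewrite add0r.
  have [n0 H] := unv _ e0; have [_ _ _ uF] := su n0.
  by rewrite distrC -(uF x Dx); exact: H.
move=> x r phi Dx r0 c2 phix p0 /=; rewrite -/(cball x r) frac_op_patch//.
split => touch.
  apply: (viscosity_limit N0 C0 hs hal D_open unK _ en0 en_cvg _ vK vm unv Dx r0 c2 phix) => //.
    by move=> n; have [_ H _ _] := su n; exact: H.
  by move=> n y Dy; have [_ _ H _] := su n; rewrite -(H y Dy).
have sN n := averaging_solutionN hal (en0 n) (su n).
have gN := gradN x c2.
have := @viscosity_limit _ _ _ _ N0 C0 hs hal D K (fun n y => - un n y) en
  (fun y => - v y) D_open _ _ en0 en_cvg _ _ (modulusN vm) _ x r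
  (fun y => - phi y) Dx r0 (C2N c2) _ _ _.
rewrite gN oppr_eq0 => H.
have {H} : 0 <= mu_int s (T 0 (normalize (- grad phi x)))
    (second_diff x r (fun y => - phi y) (fun y => - v y) x).
  apply: H => //.
  - by move=> n y; rewrite normrN; exact: unK.
  - by move=> n; have [_ H _ _] := sN n; exact: H.
  - by move=> n y Dy; have [_ _ H _] := sN n; rewrite -(H y Dy).
  - by move=> y; rewrite normrN.
  - move=> eta /unv[n0 H]; exists n0 => n y nn0.
    by rewrite -opprD normrN; exact: H.
  - by rewrite phix.
  - by move=> y yB yx; rewrite ltrN2; exact: touch.
rewrite (_ : second_diff _ _ _ _ _ = fun z => - second_diff x r phi v x z); last first.
  by apply/funext => z; exact: second_diffN.
have md : measurable_fun setT (second_diff x r phi v x).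
  by apply: measurable_second_diff => //; exact: continuous_measurable_rV.
rewrite mu_intN oppr_ge0 {1}/normalize enormN scalerN -/(normalize _) mu_int_opp//.
congr (_ <= _); apply: eq_mu_int => z _.
by rewrite /second_diff opprK [in LHS]addrAC addrC addrA addrAC.
Qed.

End conclusion.

Theorem corollary9p5 (R : realType) (N : nat) (hN : (2 <= N)%N)
    (p s alpha : R) (hp : 2 <= p) (hs : 1 / 2 < s < 1)
    (halpha : is_aperture N p alpha)
    (D : set 'rV[R]_N) (D_nonempty : D !=set0) (D_open : open D)
    (D_bounded : bounded_set D) (D_connected : connected D)
    (D_cone : external_cone D)
    (F : 'rV[R]_N -> R) (F_bounded : bounded_fun F) (F_uc : unif_continuous F)
    (u : R -> 'rV[R]_N -> R)
    (hu : forall eps : R, 0 < eps ->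
      averaging_solution alpha s eps D F (u eps))
    (J : nat -> R) (J_gt0 : forall n, 0 < J n) (J_cvg : J n @[n --> \oo] --> 0) :
  exists (k : nat -> nat) (v : 'rV[R]_N -> R),
    [/\ increasing_seq k, viscosity_solution alpha s D F v &
        {uniform, u (J (k n)) @[n --> \oo] --> v}].
Proof.
have N0 : (0 < N)%N by exact: ltnW.
have C0 : 0 < frac_const N s := frac_const_gt0 N hs.
have [hal _] := halpha.
have [K FK] := bounded_fun_ex F_bounded.
have Fm : modulus F := unif_continuous_enorm F_uc.
have su n : averaging_solution alpha s (J n) D F (u (J n)) by exact: hu.
have J_small (d : R) : 0 < d -> exists n0, forall n, (n0 <= n)%N -> J n < d.
  move=> d0; move/cvgrPdist_lt: J_cvg => /(_ d d0)[n0 _ H].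
  exists n0 => n /H /=; rewrite sub0r normrN; exact: le_lt_trans (ler_norm _).
have uK n x : `|u (J n) x| <= K.
  exact: (solution_norm_le N0 C0 hs hal D_bounded (J_gt0 n) FK (su n)).
have equi (eta : R) : 0 < eta -> exists (d : R) (n0 : nat), 0 < d /\
    (forall (n : nat) (x y : 'rV[R]_N), (n0 <= n)%N -> enorm (y - x) < d ->
      `|u (J n) y - u (J n) x| <= eta).
  move=> eta0.
  have [d [e1 [d0 e10 H]]] := equicontinuity N0 C0 hs hal D_open D_bounded D_cone FK Fm eta0.
  have [n0 Hn0] := J_small _ e10; exists d, n0; split => // n x y nn0.
  by apply: (H (J n)) => //; rewrite J_gt0 Hn0.
have uF n x : ~ D x -> u (J n) x = F x by have [_ _ _] := su n; exact.
have [k [v [kk vK vm kv]]] :=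
  @uniform_subsequence _ _ (fun n => u (J n)) _ _ _ uK D_bounded uF equi.
exists k, v; split => //; last exact: (uniform_cvgP (f := fun n => u (J (k n)))).
apply: (viscosity_of_limit N0 C0 hs hal (K := K) (un := fun n => u (J (k n)))
  (en := fun n => J (k n))) => //.
move=> d /J_small[n0 H]; exists n0 => n nn0; apply: H.
exact: leq_trans nn0 (increasing_seq_ge n kk).
Qed.
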